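(* Let $k>0$, and let $T$ be the operator in the Hilbert space $(W,\phi(\cdot,\cdot))$ with domain $\mathcal{D}(T)=V_3\oplus W_2$ given by $Tf=\ell[f]$, where $\ell[f](x)=-(1-x^2)f''(x)+kf(x)$. Then $T$ is self-adjoint in $(W,\phi(\cdot,\cdot))$ and has domain $$\mathcal{D}(T)=\{f:[-1,1]\to\mathbb{C}\mid f\in AC[-1,1];\ f',f''\in AC_{\mathrm{loc}}(-1,1);\ (1-x^2)f''',\,(1-x^2)^{1/2}f'',\,f'\in L^2(-1,1)\}.$$ Furthermore, the spectrum of $T$ is $\sigma(T)=\{n(n-1)+k\mid n\in\mathbb{N}_0\}$, and $T$ has the Jacobi polynomials $\{\widetilde{P}_n^{(-1,-1)}\}_{n=0}^{\infty}$ as a complete set of eigenfunctions.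
   Context: $\mathbb{N}_0=\{0,1,2,\dots\}$. $AC$ means absolutely continuous, $AC_{\mathrm{loc}}(-1,1)$ means absolutely continuous on every compact subinterval of $(-1,1)$. $W=\{f:[-1,1]\to\mathbb{C}\mid f\in AC[-1,1];\ f'\in L^2(-1,1)\}$ with inner product $\phi(f,g)=\tfrac12 f(-1)\overline{g}(-1)+\tfrac12 f(1)\overline{g}(1)+\int_{-1}^1 f'(x)\overline{g}'(x)\,dx$; this is a Hilbert space. $W_1=\{f\in W\mid f(\pm1)=0\}$ and $W_2=\{f\in W\mid f'(x)=c \text{ for some constant } c=c(f)\}$ are closed orthogonal subspaces with $W=W_1\oplus W_2$. $V_3$ is the set of $f:(-1,1)\to\mathbb{C}$ with $f,f',f''\in AC_{\mathrm{loc}}(-1,1)$ and $(1-x^2)f'''$, $(1-x^2)^{1/2}f''$, $f'$, $(1-x^2)^{-1/2}f\in L^2(-1,1)$. Functions in $V_3$ are extended to $[-1,1]$ by continuity and thereby regarded as elements of $W_1$. The operator $T$ is the direct sum of $T_1$ in $W_1$ (domain $V_3$, $T_1f=\ell[f]$) and $T_2$ in $W_2$ (domain $W_2$, $T_2f=\ell[f]$): for $f=f_1+f_2$ with $f_1\in V_3$, $f_2\in W_2$, $Tf=\ell[f_1]+\ell[f_2]=\ell[f]$ (as an element of $W$, after continuous extension to $\pm1$). The Jacobi polynomials are $\widetilde{P}_0^{(-1,-1)}(x)=1$, $\widetilde{P}_1^{(-1,-1)}(x)=x/\sqrt3$, and for $n\ge2$ $$\widetilde{P}_n^{(-1,-1)}(x)=\frac{\sqrt{4n-2}}{n-1}\sum_{j=0}^n\binom{n-1}{n-j}\binom{n-1}{j}\Big(\frac{x-1}{2}\Big)^j\Big(\frac{x+1}{2}\Big)^{n-j},$$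 where $\binom{n-1}{n}=0$. ''Complete set of eigenfunctions'' means each $\widetilde{P}_n^{(-1,-1)}$ is an eigenfunction of $T$ and they form a complete orthogonal set in $(W,\phi)$. *)

(* Defs.v *)
From HB Require Import structures.
From mathcomp Require Import all_boot all_order all_algebra.
From mathcomp Require Import all_classical all_reals all_analysis.
From mathcomp Require Import complex.

Set Implicit Arguments.
Unset Strict Implicit.
Unset Printing Implicit Defensive.

Import Order.TTheory GRing.Theory Num.Theory.
Import numFieldNormedType.Exports.

Local Open Scope classical_set_scope.
Local Open Scope ring_scope.
Local Open Scope complex_scope.

(* A complex inner product space is presented as a subset H of a vector space
   E together with a form ip, of which only the values on H matter. *)
Section Operators.
Variables (R : realType) (E : lmodType R[i]).
Variables (H : set E) (ip : E -> E -> R[i]).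

Definition hnorm (f : E) : R := Num.sqrt (complex.Re (ip f f)).

Definition dense_in (S : set E) : Prop :=
  S `<=` H /\
  forall f, H f -> forall e : R, 0 < e -> exists2 g, S g & hnorm (f - g) < e.

(* An unbounded operator; the values of op outside dom are meaningless. *)
Record operator := Operator { dom : set E; op : E -> E }.

Definition linear_operator_in (A : operator) : Prop :=
  [/\ dom A `<=` H,
      dom A 0,
      forall (c : R[i]) f g, dom A f -> dom A g ->
        dom A (c *: f + g) /\ op A (c *: f + g) = c *: op A f + op A g
    & forall f, dom A f -> H (op A f)].

Definition graph (A : operator) : set (E * E) :=
  [set p | dom A p.1 /\ op A p.1 = p.2].

Definition adjoint_graph (A : operator) : set (E * E) :=
  [set p | [/\ H p.1, H p.2 &
    forall f, dom A f -> ip (op A f) p.1 = ip f p.2]].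

Definition self_adjoint (A : operator) : Prop :=
  [/\ linear_operator_in A, dense_in (dom A) & adjoint_graph A = graph A].

Definition resolvent_set (A : operator) : set R[i] :=
  [set lambda |
    set_bij (dom A) H (fun f => op A f - lambda *: f) /\
    exists M : R, forall f, dom A f ->
      hnorm f <= M * hnorm (op A f - lambda *: f)].

Definition spectrum (A : operator) : set R[i] := ~` resolvent_set A.

Definition eigenfunction (A : operator) (f : E) : Prop :=
  [/\ dom A f, f <> 0 & exists lambda : R[i], op A f = lambda *: f].

Definition lin_span (u : nat -> E) : set E :=
  [set f | exists (n : nat) (c : nat -> R[i]), f = \sum_(i < n) c i *: u i].

Definition complete_orthogonal (u : nat -> E) : Prop :=
  [/\ forall n, H (u n),
      forall m n, m <> n -> ip (u m) (u n) = 0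
    & dense_in (lin_span u)].

End Operators.

Section ComplexFunctions.
Variable R : realType.

(* The type R[i]^o carries the R[i]-module structure, so that cfun is a complex
   vector space.  A function f : [-1, 1] -> C is represented by the unique
   element of cfun that extends it and vanishes off [-1, 1]; see supported. *)
Definition cfun := R -> R[i]^o.

Implicit Types f g : cfun.

Definition supported f : Prop := forall x, ~~ (-1 <= x <= 1) -> f x = 0.

Definition restr f : cfun := fun x => if -1 <= x <= 1 then f x else 0.

(* Componentwise derivative; derive1 is 0 wherever the limit does not exist.
   This is harmless below: an absolutely continuous f is differentiable almost
   everywhere, and if the total function cderive f is moreover continuous then
   f is C^1 with derivative cderive f. *)
Definition cderive f : cfun := fun x =>
  derive1 (fun y => complex.Re (f y)) x +i*
  derive1 (fun y => complex.Im (f y)) x.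

Definition abs_cont (a b : R) f : Prop :=
  forall e : R, 0 < e -> exists2 d : R, 0 < d &
    forall (n : nat) (x y : 'I_n -> R),
      (forall i, a <= x i /\ x i <= y i /\ y i <= b) ->
      (forall i j, i != j -> `]x i, y i[ `&` `]x j, y j[ = set0) ->
      \sum_i (y i - x i) < d ->
      \sum_i complex.Re `|f (y i) - f (x i)| < e.

Definition abs_cont_loc f : Prop :=
  forall a b : R, -1 < a -> a <= b -> b < 1 -> abs_cont a b f.

Definition Ioo : set R := `]-1, 1[.

(* Borel measurability loses nothing here: L2 is only applied to products of
   continuous functions with (iterated) derivatives of continuous functions on
   ]-1, 1[, and the total function cderive f of a continuous f is Borel. *)
Definition L2 f : Prop :=
  [/\ measurable_fun Ioo (fun x => complex.Re (f x)),
      measurable_fun Ioo (fun x => complex.Im (f x))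
    & (\int[@lebesgue_measure R]_(x in Ioo)
         ((complex.Re `|f x|) ^+ 2)%:E < +oo)%E].

Definition cintegral f : R[i] :=
  Rintegral (@lebesgue_measure R) Ioo (fun x => complex.Re (f x)) +i*
  Rintegral (@lebesgue_measure R) Ioo (fun x => complex.Im (f x)).

(* Extension by continuity to [-1, 1] of a function on ]-1, 1[. *)
Definition cont_ext f : cfun := fun x =>
  if -1 < x < 1 then f x
  else if x == -1 then
    lim (complex.Re (f y) @[y --> (-1)^'+]) +i*
    lim (complex.Im (f y) @[y --> (-1)^'+])
  else if x == 1 then
    lim (complex.Re (f y) @[y --> 1^'-]) +i*
    lim (complex.Im (f y) @[y --> 1^'-])
  else 0.

Definition W : set cfun :=
  [set f | [/\ supported f, abs_cont (-1) 1 f & L2 (cderive f)]].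

Definition phi f g : R[i] :=
  2^-1 * f (-1) * (g (-1))^* + 2^-1 * f 1 * (g 1)^* +
  cintegral (fun x => cderive f x * (cderive g x)^*).

Definition W2 : set cfun :=
  [set f | W f /\ exists c : R[i], forall x, -1 < x < 1 -> cderive f x = c].

(* Membership only depends on the values of f on ]-1, 1[. *)
Definition V3 : set cfun :=
  [set f | [/\ abs_cont_loc f, abs_cont_loc (cderive f) & abs_cont_loc (cderive (cderive f))] /\
    [/\ L2 (fun x => (1 - x ^+ 2)%:C * cderive (cderive (cderive f)) x),
        L2 (fun x => (Num.sqrt (1 - x ^+ 2))%:C * cderive (cderive f) x),
        L2 (cderive f)
      & L2 (fun x => ((Num.sqrt (1 - x ^+ 2))^-1)%:C * f x)]].

Definition ell (k : R) f : cfun :=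
  fun x => - ((1 - x ^+ 2)%:C * cderive (cderive f) x) + k%:C * f x.

Definition T (k : R) : operator cfun :=
  Operator [set f | exists f1 f2, [/\ V3 f1, W2 f2 & f = cont_ext f1 + f2]]
           (fun f => cont_ext (ell k f)).

Definition jacobi (n : nat) : cfun :=
  match n with
  | 0 => fun=> 1
  | 1 => fun x => (x / Num.sqrt 3)%:C
  | _ => fun x =>
      (Num.sqrt (4 * n%:R - 2) / (n%:R - 1) *
       \sum_(0 <= j < n.+1) 'C(n.-1, n - j)%:R * 'C(n.-1, j)%:R *
         ((x - 1) / 2) ^+ j * ((x + 1) / 2) ^+ (n - j))%:C
  end.

End ComplexFunctions.

Arguments jacobi R n : clear implicits.

(* Main.v *)
Require Import Defs.
From HB Require Import structures.
From mathcomp Require Import all_boot all_order all_algebra.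
From mathcomp Require Import all_classical all_reals all_analysis.
From mathcomp Require Import measurable_realfun complex ring lra zify.

Set Implicit Arguments.
Unset Strict Implicit.
Unset Printing Implicit Defensive.

Import Order.TTheory GRing.Theory Num.Theory.
Import numFieldNormedType.Exports.

Local Open Scope classical_set_scope.
Local Open Scope ring_scope.

(** A complex function is treated through its real and imaginary parts.

    If f belongs to the domain on the right-hand side, then f'' is square
    integrable and the flux (1 - x^2) f'' lies in W and vanishes at both end
    points, so an integration by parts gives
      phi(T f, g) = k phi(f, g) + \int (1 - x^2) f'' g'',
    whence T is symmetric.  If g in W vanishes at the end points, then
    g / (1 - x^2) is square integrable by Hardy's inequality and two integrations
    of f'' = - g / (1 - x^2) solve (T - k) f = g with f in the domain.  So if
    (u, w) lies in the graph of the adjoint, then w - k u, being orthogonal to the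
    affine functions (on which T = k), vanishes at the end points and equals
    (T - k) f for some f; now u - f is orthogonal to all functions vanishing at
    the end points, hence is affine, and u is in the domain.

    The n-th Jacobi polynomial satisfies (x^2 - 1) P'' = n (n - 1) P and has
    degree n, so the Jacobi polynomials span the polynomials.  They are total: if
    f is orthogonal to them, then f(-1) = f(1) = 0 and f' is orthogonal in L^2 to
    all polynomials; since (1 - y^n)^(2^n) with y = 1/2 + (x - c)/4 converges
    boundedly to the indicator function of x < c, f(c) = 0.  W being complete,
    Fourier series converge.  The eigenvalues tend to infinity, so any other lam
    has positive distance to them, and the resolvent divides by lam_n - lam. *)

(** * Absolute continuity *)

(** Absolute continuity is given by an epsilon-delta condition and derivatives by limits with
    default value 0, so the two notions must first be tied together: the [abscont] functions are
    shown to be the indefinite integrals, with density [derv u]. Integration by parts and the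
    extension of functions to the end points rest on this. The end points are the delicate place,
    since the weight 1 - x^2 degenerates there. No limit of the flux is computed: its end values
    vanish because a nonzero end value divided by 1 - x^2 is not square integrable. In the same way
    the integral inequalities are proved on inner intervals ]a, b[ with bounds independent of a and
    b. The coefficients of the operator are real, so working with real and imaginary parts loses
    nothing. Density of the domain comes for free from the totality of the polynomials.
    Self-adjointness is used once more for the spectrum: that the series defining the resolvent has
    its sum in the domain is read off from the adjoint graph. *)

Section AbsCont.
Context {R : realType}.
Implicit Types (a b x y e d : R) (u v g h : R -> R) (p q : R * R).
Local Notation mu := (@lebesgue_measure R).

Definition abscont a b u : Prop :=
  forall e, 0 < e -> exists2 d, 0 < d &
    forall (n : nat) (x y : 'I_n -> R),
      (forall i, a <= x i /\ x i <= y i /\ y i <= b) ->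
      (forall i j, i != j -> `]x i, y i[ `&` `]x j, y j[ = set0) ->
      \sum_i (y i - x i) < d -> \sum_i `|u (y i) - u (x i)| < e.

(** Boolean form of the disjointness of two open intervals, so that families of intervals can be
    sequences under [pairwise]. The two equalities account for empty intervals. *)
Definition apart p q : bool :=
  [|| p.2 <= q.1, q.2 <= p.1, p.1 == p.2 | q.1 == q.2].

Definition inside a b p : bool := [&& a <= p.1, p.1 <= p.2 & p.2 <= b].

Lemma apart_sym : symmetric apart.
Proof. by move=> p q; rewrite /apart; do !case: (_ <= _); do !case: (_ == _). Qed.

Lemma apart_disjoint p q : apart p q -> `]p.1, p.2[ `&` `]q.1, q.2[ = set0.
Proof.
move=> pq; apply/seteqP; split => // z [] /=; rewrite !in_itv /=.
move=> /andP[z1 z2] /andP[z3 z4]; move: pq; rewrite /apart.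
case/or4P => [H|H|/eqP H|/eqP H].
- by have := lt_trans z3 (lt_le_trans z2 H); rewrite ltxx.
- by have := lt_trans z1 (lt_le_trans z4 H); rewrite ltxx.
- by have := lt_trans z1 z2; rewrite H ltxx.
- by have := lt_trans z3 z4; rewrite H ltxx.
Qed.

Lemma abscont_seq a b u : abscont a b u ->
  forall e, 0 < e -> exists2 d, 0 < d &
    forall s : seq (R * R), all (inside a b) s -> pairwise apart s ->
      \sum_(p <- s) (p.2 - p.1) < d -> \sum_(p <- s) `|u p.2 - u p.1| < e.
Proof.
move=> H e /H[d d0 {}H]; exists d => // s ins sap.
rewrite !(big_nth (0, 0)) !big_mkord; apply: H => [i|i j ij].
  by have /allP/(_ _ (mem_nth (0, 0) (ltn_ord i)))/and3P[] := ins.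
have /(pairwiseP (0, 0)) nap : pairwise apart s by [].
apply: apart_disjoint; have [ltij|ltji|/val_inj eqij] := ltngtP i j.
- by apply: nap => //; rewrite inE.
- by rewrite apart_sym; apply: nap => //; rewrite inE.
- by rewrite eqij eqxx in ij.
Qed.

(** The consecutive subintervals of a partition that starts at a, zipped as in [variation_zip]. *)
Definition pieces a (s : seq R) : seq (R * R) :=
  [seq (p.2, p.1) | p <- zip s (a :: s)].

Lemma pieces_cons a x s : pieces a (x :: s) = (a, x) :: pieces x s.
Proof. by []. Qed.

Lemma pieces_inside a b s : itv_partition a b s -> all (inside a b) (pieces a s).
Proof.
elim: s a => [//|x s IH] a [+ lxb]; rewrite pieces_cons /= => /andP[ax xs].
have xb : x <= b.
  move: lxb => /eqP <-; case: s xs {IH} => [//|y s] xs.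
  by have /allP/(_ _ (mem_last _ _))/ltW := order_path_min lt_trans xs.
rewrite {1}/inside /= lexx (ltW ax) xb /=.
have /allP sub := IH x (conj xs lxb).
by apply/allP => p /sub /and3P[? ? ?]; apply/and3P; split => //; apply: le_trans (ltW ax) _.
Qed.

Lemma pieces_apart a b s : itv_partition a b s -> pairwise apart (pieces a s).
Proof.
elim: s a => [//|x s IH] a [+ lxb]; rewrite pieces_cons /= => /andP[ax xs].
rewrite IH // andbT.
have /allP sub := pieces_inside (conj xs lxb).
by apply/allP => p /sub /and3P[? ? ?]; rewrite /apart /= (_ : x <= p.1).
Qed.

Lemma pieces_length a b s : itv_partition a b s ->
  \sum_(p <- pieces a s) (p.2 - p.1) = b - a.
Proof.
elim: s a => [|x s IH] a [/= + lxb].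
  by move=> _; rewrite big_nil (eqP lxb) subrr.
by move=> /andP[ax xs]; rewrite pieces_cons big_cons IH //= addrC addrA subrK.
Qed.

Lemma pieces_variation a b u s : itv_partition a b s ->
  \sum_(p <- pieces a s) `|u p.2 - u p.1| = variation a b u s.
Proof. by move=> abs; rewrite (variation_zip u abs) /pieces big_map. Qed.

Lemma sub_apart p q r : inside p.1 p.2 r -> apart p q -> apart r q.
Proof.
move=> /and3P[pr1 r12 rp2]; rewrite /apart => /or4P[H|H|/eqP H|->].
- by rewrite (le_trans rp2 H).
- by rewrite (le_trans H pr1) orbT.
- suff -> : r.1 == r.2 by rewrite !orbT.
  by rewrite eq_le r12 /= (le_trans rp2) // -H.
- by rewrite !orbT.
Qed.

Local Open Scope ereal_scope.

(* An absolutely continuous u has small total variation on small families of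
   intervals: refine them one at a time by partitions almost attaining it. *)
Lemma total_variation_sum_le a b u e d :
  (forall s : seq (R * R), all (inside a b) s -> pairwise apart s ->
     (\sum_(p <- s) (p.2 - p.1) < d -> \sum_(p <- s) `|u p.2 - u p.1| < e)%R) ->
  forall s t : seq (R * R), all (inside a b) (s ++ t) -> pairwise apart (s ++ t) ->
    (\sum_(p <- s ++ t) (p.2 - p.1) < d)%R ->
    \sum_(p <- s) total_variation p.1 p.2 u + (\sum_(p <- t) `|u p.2 - u p.1|)%:E
    <= e%:E.
Proof.
move=> H; elim => [|p s IH] t ins ap len.
  by rewrite big_nil add0e lee_fin ltW // H.
have /and3P[ap1 p12 p2b] : inside a b p by case/andP: ins.
have Tge0 : 0 <= \sum_(q <- s) total_variation q.1 q.2 u.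
  rewrite big_seq; apply: sume_ge0 => q qs; apply: total_variation_ge0.
  by move/allP : ins => /(_ q); rewrite inE mem_cat qs orbT => /(_ isT)/and3P[].
have step l : itv_partition p.1 p.2 l ->
    \sum_(q <- s) total_variation q.1 q.2 u +
     (variation p.1 p.2 u l + \sum_(q <- t) `|u q.2 - u q.1|)%:E <= e%:E.
  move=> pl; rewrite -(pieces_variation u pl) -big_cat; apply: IH.
  - move: ins; rewrite /= !all_cat => /and3P[_ -> ->]; rewrite andbT /=.
    apply/allP => q /(allP (pieces_inside pl))/and3P[h1 h2 h3].
    by rewrite /inside h2 (le_trans ap1 h1) (le_trans h3 p2b).
  - move: ap; rewrite /= !pairwise_cat /= (pieces_apart pl) !allrel_catr all_cat.
    move=> /andP[/andP[aps apt]] /and3P[-> -> ->]; rewrite /= !andbT; apply/andP; split.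
      apply/allrelP => q r qs /(allP (pieces_inside pl)) rp.
      by rewrite apart_sym (sub_apart rp)//; exact: (allP aps).
    apply/allrelP => r q /(allP (pieces_inside pl)) rp qt.
    by rewrite (sub_apart rp)//; exact: (allP apt).
  - move: len; rewrite /= big_cons !big_cat /= (pieces_length pl).
    by rewrite [X in (_ + X)%R]addrC addrCA addrC [X in (_ + X)%R]addrC addrA.
(* Finiteness, needed to move this sum across the inequality, comes from [step] for the coarsest
   partition of [p]. *)
have S0 : \sum_(q <- s) total_variation q.1 q.2 u \is a fin_num.
  rewrite ge0_fin_numE //; have [l pl] : exists l, itv_partition p.1 p.2 l.
    move: p12; rewrite le_eqVlt => /predU1P[<-|p12]; first by exists [::].
    by exists [:: p.2]; exact: itv_partition1.
  have := step l pl.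
  rewrite -leeBrDr // => /le_lt_trans -> //.
  by rewrite -EFinB ltry.
rewrite big_cons -addeA -leeBrDr; last by rewrite fin_numD S0.
apply: ub_ereal_sup => _ [_ [l pl <-] <-].
rewrite leeBrDr; last by rewrite fin_numD S0.
by rewrite addeCA -EFinD; exact: step.
Qed.

Lemma abscont_total_variation a b u : abscont a b u ->
  forall e, (0 < e)%R -> exists2 d, (0 < d)%R &
    forall s : seq (R * R), all (inside a b) s -> pairwise apart s ->
      (\sum_(p <- s) (p.2 - p.1) < d)%R ->
      \sum_(p <- s) total_variation p.1 p.2 u <= e%:E.
Proof.
move=> /abscont_seq H e /H[d d0 {}H]; exists d => // s ins ap len.
have := total_variation_sum_le H (s := s) (t := [::]).
by rewrite cats0 big_nil adde0; apply.
Qed.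

(** Cut [a, b] into n equal pieces shorter than the d that belongs to e = 1: each has variation at
    most 1, so the total is at most n. *)
Lemma abscont_total_variation_lty a b u : (a <= b)%R -> abscont a b u ->
  total_variation a b u < +oo.
Proof.
move=> ab /abscont_total_variation/(_ _ ltr01)[d d0 H].
pose n := (Num.truncn ((b - a) / d)).+1.
have nd : ((b - a) / n%:R < d)%R.
  by rewrite ltr_pdivrMr ?ltr0n // mulrC -ltr_pdivrMr // truncnS_gt.
have hn k : (k <= n)%N -> total_variation a (a + k%:R * ((b - a) / n%:R)) u <= k%:R%:E.
  elim: k => [_|k IH kn]; first by rewrite mul0r addr0 total_variationxx.
  have st0 : (0 <= (b - a) / n%:R)%R by rewrite divr_ge0 // subr_ge0.
  rewrite (@total_variationD _ _ _ (a + k%:R * ((b - a) / n%:R))%R); last 2 first.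
  - by rewrite lerDl mulr_ge0.
  - by rewrite lerD2l ler_wpM2r // ler_nat.
  rewrite -[X in _ <= X%:E]natr1 EFinD; apply: leeD; first exact/IH/ltnW.
  have := H [:: (a + k%:R * ((b - a) / n%:R), a + k.+1%:R * ((b - a) / n%:R))%R].
  rewrite !big_seq1; apply => //=.
  - rewrite andbT /inside /= lerDl mulr_ge0 //= lerD2l ler_wpM2r ?ler_nat //=.
    rewrite -lerBrDl mulrCA ler_piMr ?subr_ge0 //.
    by rewrite ler_pdivrMr ?ltr0n // mul1r ler_nat.
  - by rewrite opprD addrACA subrr add0r -mulrBl -natrB // subSnn mul1r.
have := hn n (leqnn _); rewrite mulrCA divff ?pnatr_eq0 // mulr1 subrKC.
by move=> /le_lt_trans -> //; rewrite ltry.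
Qed.

(** An interval without an upper or lower bound contains a half-line, which has infinite measure.
    This is applied to the components of an open set of small measure. *)
Lemma open_itv_bounded (J : set R) : open J -> is_interval J -> mu J < +oo ->
  J = set0 \/ exists p, (p.1 < p.2)%R /\ J = `]p.1, p.2[%classic.
Proof.
move=> oJ iJ Jy; have [J0|/set0P J0] := eqVneq J set0; [by left|right].
have Jsub x : J x -> (forall N : R, exists2 y, J y & (N <= y)%R) -> mu J = +oo.
  move=> Jx Ju; apply/eqP; rewrite -leye_eq.
  have -> : +oo = mu `[x, +oo[ by rewrite lebesgue_measure_itv /= ltry.
  apply: le_measure; rewrite ?inE //; first exact: open_measurable.
  move=> y /=; rewrite in_itv /= andbT => xy; have [z Jz yz] := Ju y.
  exact: iJ Jx Jz _ (introT andP (conj xy yz)).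
have Jsub' x : J x -> (forall N : R, exists2 y, J y & (y <= N)%R) -> mu J = +oo.
  move=> Jx Ju; apply/eqP; rewrite -leye_eq.
  have -> : +oo = mu `]-oo, x] by rewrite lebesgue_measure_itv /= ltNyr.
  apply: le_measure; rewrite ?inE //; first exact: open_measurable.
  move=> y /=; rewrite in_itv /= => xy; have [z Jz yz] := Ju y.
  exact: iJ Jz Jx _ (introT andP (conj yz xy)).
have [x Jx] := J0.
have Ju : has_ubound J.
  apply: contrapT => /has_ubPn nub; move: Jy; rewrite (Jsub x) ?ltxx // => N.
  by have [y ? /ltW] := nub N; exists y.
have Jl : has_lbound J.
  apply: contrapT => /has_lbPn nub; move: Jy; rewrite (Jsub' x) ?ltxx // => N.
  by have [y ? /ltW] := nub N; exists y.
have JE : J = `]inf J, sup J[%classic.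
  by rewrite -interval_bounded_interior // (interior_id _).1.
exists (inf J, sup J); split => //=.
by move: Jx; rewrite {1}JE /= in_itv /= => /andP[]; exact: lt_trans.
Qed.

(** * Stieltjes measures and Radon-Nikodym densities *)

Lemma stieltjes_measure_oc (g : cumulative R R) x y : (x <= y)%R ->
  lebesgue_stieltjes_measure g `]x, y]%classic = (g y - g x)%:E.
Proof.
move=> xy; rewrite /lebesgue_stieltjes_measure /measure_extension /=.
by rewrite measurable_mu_extE /=; [rewrite wlength_itv_bnd|exact: is_ocitv].
Qed.

(** By outer regularity a null set lies in an open set of length less than d, which is a countable
    disjoint union of bounded open intervals. Every finite subfamily has total length less than d,
    hence total increment of g at most e, and so does the union in the limit. *)
Lemma null_dominates_stieltjes (g : cumulative R R) :
  (forall e, (0 < e)%R -> exists2 d, (0 < d)%R &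
    forall s : seq (R * R), all (fun p => p.1 <= p.2)%R s -> pairwise apart s ->
      (\sum_(p <- s) (p.2 - p.1) < d -> \sum_(p <- s) (g p.2 - g p.1) <= e)%R) ->
  lebesgue_stieltjes_measure g `<< mu.
Proof.
set nu := lebesgue_stieltjes_measure g.
move=> H; apply/null_content_dominatesP => A mA A0.
apply/eqP; rewrite eq_le measure_ge0 andbT; apply/lee_addgt0Pr => e e0.
rewrite add0e; have [d d0 {}H] := H _ e0.
have [|U [oU AU Ud]] := lebesgue_regularity_outer mA _ d0; first by rewrite A0.
have mU : measurable U by exact: open_measurable.
have {}Ud : mu U < d%:E.
  rewrite (le_lt_trans _ Ud) // -[leRHS]adde0 -A0 -measureU ?setDKU //.
  - exact: measurableD.
  - by rewrite -subset0 => x [[_ nAx] Ax]; exact: nAx.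
have [I [Ioi tI UI]] := OpenSetDisjointItvs.open_disjoint_itv oU.
have mI i : measurable (I i) by apply: open_measurable; have [] := Ioi i.
have Iy i : mu (I i) < +oo.
  rewrite (@le_lt_trans _ _ (mu U)) ?(lt_trans Ud) ?ltry // le_measure ?inE //.
    exact: mI.
  by rewrite UI; exact: bigcup_sup.
(* The Stieltjes measure is known on half-open intervals, so the open one is only bounded by the
   increment of g. An empty component gets the degenerate pair (0, 0). *)
have {Iy} pP i : exists p, [/\ (p.1 <= p.2)%R, mu (I i) = (p.2 - p.1)%:E,
    nu (I i) <= (g p.2 - g p.1)%:E & I i = `]p.1, p.2[%classic].
  have [I0|[p [p12 IE]]] := open_itv_bounded (Ioi i).1 (Ioi i).2 (Iy i).
    exists (0%R, 0%R); rewrite /= !subrr I0 measure0; split => //; first by rewrite /nu measure0.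
    by rewrite set_itvoo0.
  exists p; split => //; first exact: ltW.
    by rewrite IE lebesgue_measure_itv /= lte_fin p12.
  rewrite -(stieltjes_measure_oc g (ltW p12)) IE; apply: le_measure; rewrite ?inE.
  - exact: measurable_itv.
  - exact: measurable_itv.
  - by apply: subset_itvl; rewrite bnd_simp.
have [p {}pP] := choice pP.
have sumU (m : {measure set (measurableTypeR R) -> \bar R}) :
    m U = \sum_(0 <= i <oo) m (I i).
  by rewrite UI measure_semi_bigcup //; apply: bigcup_measurable => i _; exact: mI.
have nuU : nu U = \sum_(0 <= i <oo) nu (I i) by exact: sumU.
have muU : mu U = \sum_(0 <= i <oo) mu (I i) by exact: sumU.
apply: (@le_trans _ _ (nu U)); first by apply: le_measure; rewrite ?inE.
rewrite nuU; apply: lime_le; first exact: is_cvg_nneseries.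
apply: nearW => n; apply: (@le_trans _ _ (\sum_(i <- iota 0 n) (g (p i).2 - g (p i).1)%:E)).
  rewrite /index_iota subn0 big_seq [leRHS]big_seq; apply: lee_sum => i _.
  by have [_ _] := pP i.
rewrite sumEFin lee_fin -(big_map p xpredT (fun p => g p.2 - g p.1))%R; apply: H.
- by apply/allP => q /mapP[i _ ->]; have [] := pP i.
- rewrite pairwise_map; apply: (@sub_pairwise _ ltn); last first.
    by rewrite -sorted_pairwise ?iota_ltn_sorted //; exact: ltn_trans.
  move=> i j ij /=; have [pi _ _ Ei] := pP i; have [pj _ _ Ej] := pP j.
  have /trivIsetP/(_ i j Logic.I Logic.I) := tI.
  rewrite neq_ltn (ij : (i < j)%N) => /(_ isT); rewrite Ei Ej /apart.
  have [->|ni] := eqVneq (p i).1 (p i).2; first by rewrite !orbT.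
  have [->|nj] := eqVneq (p j).1 (p j).2; first by rewrite !orbT.
  rewrite !orbF; have [//|/= ji] := leP (p i).2 (p j).1.
  have [//|/= ij'] := leP (p j).2 (p i).1.
  have pi' : ((p i).1 < (p i).2)%R by rewrite lt_neqAle ni.
  have pj' : ((p j).1 < (p j).2)%R by rewrite lt_neqAle nj.
  have [z /andP[z1 z2]] : exists z, (Num.max (p i).1 (p j).1 < z < Num.min (p i).2 (p j).2)%R.
    have : (Num.max (p i).1 (p j).1 < Num.min (p i).2 (p j).2)%R.
      by rewrite lt_min !gt_max pi' pj' ij' ji.
    move: (Num.max _ _) (Num.min _ _) => m M mM.
    by exists ((m + M) / 2)%R; apply/andP; split; lra.
  move: z1 z2; rewrite gt_max lt_min => /andP[z1 z2] /andP[z3 z4].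
  by move/seteqP => [/(_ z) /=]; rewrite !in_itv /= z1 z2 z3 z4 => /(_ (conj isT isT)).
- rewrite big_map -lte_fin (le_lt_trans _ Ud) // muU -sumEFin.
  rewrite (eq_bigr (fun i => mu (I i))); last by move=> i _; have [] := pP i.
  rewrite -[X in iota 0 X]subn0; exact: nneseries_lim_ge.
Qed.

(** The density is the Radon-Nikodym derivative of the restriction to []a, b]], which is a finite
    measure. *)
Lemma stieltjes_integral (g : cumulative R R) a b : (a <= b)%R ->
  lebesgue_stieltjes_measure g `<< mu ->
  exists2 h : R -> R, mu.-integrable [set: R] (EFin \o h) &
    forall x y, (a <= x)%R -> (x <= y)%R -> (y <= b)%R ->
      (g y - g x)%:E = \int[mu]_(t in `]x, y]) (h t)%:E.
Proof.
move=> ab dom.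
have mab : measurable (`]a, b]%classic : set (measurableTypeR R)).
  by apply: sub_sigma_algebra; exact: is_ocitv.
have nuy : lebesgue_stieltjes_measure g `]a, b]%classic < +oo.
  by rewrite stieltjes_measure_oc // ltry.
pose nu : {finite_measure set (measurableTypeR R) -> \bar R} := mfrestr mab nuy.
have dom' : nu `<< mu.
  apply/null_content_dominatesP => A mA A0; rewrite /nu /= /mfrestr /mrestr.
  apply/eqP; rewrite eq_le measure_ge0 andbT.
  have /null_content_dominatesP/(_ A mA A0) <- := dom.
  by apply: le_measure; rewrite ?inE //; exact: measurableI.
have [h [_ hfin hint hE]] := radon_nikodym_sigma_finite dom'.
have hfine : EFin \o (fine \o h) = h.
  by apply/funext => x /=; rewrite fineK.
exists (fine \o h); first by rewrite hfine.
move=> x y ax xy yb; rewrite -stieltjes_measure_oc //.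
have -> : lebesgue_stieltjes_measure g `]x, y]%classic = nu `]x, y]%classic.
  rewrite /nu /= /mfrestr /mrestr setIidl //.
  by apply: subset_itv; rewrite bnd_simp.
by rewrite hE //; apply: eq_integral => t _ /=; rewrite fineK.
Qed.

Local Close Scope ereal_scope.

Definition clamp a b x : R := Num.max a (Num.min x b).

Lemma clampP a b x : a <= b -> a <= clamp a b x <= b.
Proof.
by move=> ab; rewrite /clamp le_max lexx /= ge_max ab ge_min lexx orbT.
Qed.

Lemma clamp_id a b x : a <= x <= b -> clamp a b x = x.
Proof. by move=> /andP[ax xb]; rewrite /clamp min_l // max_r. Qed.

Lemma clamp_nd a b x y : x <= y -> clamp a b x <= clamp a b y.
Proof.
move=> xy; rewrite /clamp /Num.max /Num.min.
by do !case: ifPn; rewrite -?leNgt => *; lra.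
Qed.

Lemma clamp_lipschitz a b x y : x <= y -> clamp a b y - clamp a b x <= y - x.
Proof.
move=> xy; rewrite /clamp /Num.max /Num.min.
by do !case: ifPn; rewrite -?leNgt => *; lra.
Qed.

(** A Stieltjes measure requires a monotone right-continuous function on the whole line. Composing g
    with [clamp], which is monotone and does not increase distances, provides one that satisfies the
    same small-increment condition; right continuity is the case of a single interval. *)
Lemma nd_abscont_integral a b g : a <= b ->
  (forall x y, a <= x -> x <= y -> y <= b -> g x <= g y) ->
  (forall e, 0 < e -> exists2 d, 0 < d &
    forall s : seq (R * R), all (inside a b) s -> pairwise apart s ->
      \sum_(p <- s) (p.2 - p.1) < d -> \sum_(p <- s) (g p.2 - g p.1) <= e) ->
  exists2 h : R -> R, mu.-integrable [set: R] (EFin \o h) &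
    forall x y, a <= x -> x <= y -> y <= b ->
      (g y - g x)%:E = (\int[mu]_(t in `]x, y]) (h t)%:E)%E.
Proof.
move=> ab gnd gac; pose f x := g (clamp a b x).
have fnd : nondecreasing f.
  move=> x y xy; have /andP[? ?] := clampP x ab; have /andP[? ?] := clampP y ab.
  by apply: gnd => //; exact: clamp_nd.
have fac e : 0 < e -> exists2 d, 0 < d &
    forall s : seq (R * R), all (fun p => p.1 <= p.2)%R s -> pairwise apart s ->
      (\sum_(p <- s) (p.2 - p.1) < d -> \sum_(p <- s) (f p.2 - f p.1) <= e)%R.
  move=> /gac[d d0 {}gac]; exists d => // s s12 sap len.
  pose cl p := (clamp a b p.1, clamp a b p.2).
  rewrite -(big_map cl xpredT (fun p => g p.2 - g p.1)); apply: gac.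
  - apply/allP => _ /mapP[q /(allP s12) q12 ->]; rewrite /inside /=.
    by have /andP[-> _] := clampP q.1 ab; have /andP[_ ->] := clampP q.2 ab; rewrite clamp_nd.
  - rewrite pairwise_map; apply: sub_pairwise sap => p q; rewrite /apart /=.
    case/or4P => [H|H|/eqP ->|/eqP ->].
    + by rewrite clamp_nd.
    + by rewrite (clamp_nd _ _ H) orbT.
    + by rewrite eqxx !orbT.
    + by rewrite eqxx !orbT.
  - rewrite big_map; apply: le_lt_trans len; rewrite big_seq [leRHS]big_seq.
    by apply: ler_sum => q /(allP s12) q12 /=; exact: clamp_lipschitz.
have frc : right_continuous f.
  move=> x; apply/cvgrPdist_le => e /fac[d d0 H]; near=> y.
  have xy : x <= y by apply: ltW; near: y; exact: nbhs_right_gt.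
  have yd : y < x + d by near: y; apply: nbhs_right_lt; rewrite ltrDl.
  have := H [:: (x, y)]; rewrite !big_seq1 /= xy => /(_ isT isT).
  rewrite ltrBlDl => /(_ yd); rewrite ler0_norm ?opprB //.
  by rewrite subr_le0; exact: fnd.
pose fc : cumulative R R := HB.pack f (isCumulative.Build R _ R f fnd frc).
have [h hint hE] := @stieltjes_integral fc a b ab (@null_dominates_stieltjes fc fac).
exists h => // x y ax xy yb; rewrite -hE // /fc /= /f !clamp_id //.
  by rewrite ax (le_trans xy).
by rewrite yb (le_trans ax).
Unshelve. all: by end_near. Qed.

(* Radon-Nikodym for the Stieltjes measures of the increasing functions v and
   v - u, where v is the total variation of u. *)
Lemma abscont_integral a b u : a <= b -> abscont a b u ->
  exists2 h : R -> R, mu.-integrable [set: R] (EFin \o h) &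
    forall x y, a <= x -> x <= y -> y <= b ->
      (u y - u x)%:E = (\int[mu]_(t in `]x, y]) (h t)%:E)%E.
Proof.
move=> ab uac; pose v x := fine (total_variation a x u).
have TVfin x : a <= x -> x <= b -> total_variation a x u \is a fin_num.
  move=> ax xb; rewrite ge0_fin_numE ?total_variation_ge0 //.
  apply: le_lt_trans (abscont_total_variation_lty ab uac).
  by rewrite (total_variationD u ax xb) leeDl // total_variation_ge0.
have vE x y : a <= x -> x <= y -> y <= b -> (v y - v x)%:E = total_variation x y u.
  move=> ax xy yb; have := total_variationD u ax xy.
  have := TVfin y (le_trans ax xy) yb; have := TVfin x ax (le_trans xy yb).
  rewrite /v; case: (total_variation a x u) => // r _.
  case: (total_variation a y u) => // s _; case: (total_variation x y u) => // t.
  by rewrite -EFinD => -[->]; rewrite /= addrAC subrr add0r.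
have duv x y : a <= x -> x <= y -> y <= b -> `|u y - u x| <= v y - v x.
  by move=> ax xy yb; rewrite -lee_fin vE // total_variation_ge.
have vac e : 0 < e -> exists2 d, 0 < d &
    forall s : seq (R * R), all (inside a b) s -> pairwise apart s ->
      \sum_(p <- s) (p.2 - p.1) < d -> \sum_(p <- s) (v p.2 - v p.1) <= e.
  move=> /(abscont_total_variation uac)[d d0 H]; exists d => // s ins ap len.
  rewrite -lee_fin -sumEFin; apply: le_trans (H s ins ap len).
  rewrite big_seq [leRHS]big_seq; apply: lee_sum => p /(allP ins)/and3P[? ? ?].
  by rewrite vE.
have [|h1 h1int h1E] := nd_abscont_integral ab _ vac.
  by move=> x y ax xy yb; rewrite -subr_ge0 (le_trans _ (duv _ _ ax xy yb)).
have [||h2 h2int h2E] := @nd_abscont_integral a b (fun x => v x - u x) ab.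
- move=> x y ax xy yb; have := duv _ _ ax xy yb; rewrite ler_norml => /andP[_].
  by lra.
(* As |u y - u x| <= v y - v x, the increments of v - u are at most twice those of v. *)
- move=> e e0; have [|d d0 H] := vac (e / 2); first by rewrite divr_gt0.
  exists d => // s ins ap len; have -> : e = 2 * (e / 2) by field.
  apply: le_trans (ler_wpM2l (ler0n _ 2) (H s ins ap len)).
  rewrite mulr_sumr big_seq [leRHS]big_seq; apply: ler_sum => p /(allP ins)/and3P[p1 p2 p3].
  by have := duv _ _ p1 p2 p3; rewrite ler_norml => /andP[+ _]; lra.
exists (fun x => h1 x - h2 x) => [|x y ax xy yb].
  by have := integrableB measurableT h1int h2int.
have mxy : measurable (`]x, y]%classic : set R) by [].
under eq_integral do rewrite EFinB.
rewrite integralB //; last 2 first.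
- exact: integrableS h1int.
- exact: integrableS h2int.
by rewrite -h1E // -h2E // -EFinB; congr EFin; lra.
Qed.

End AbsCont.

(** * Derivatives and the fundamental theorem of calculus *)

Section DerivMeas.
Context {R : realType}.
Implicit Types (a b x y e d : R) (u v g : R -> R).
Local Notation mu := (@lebesgue_measure R).

Definition dquot g (h x : R) : R := h^-1 * (g (h + x) - g x).

(* The Cauchy criterion for difference quotients is a closed condition on the
   base point, so the set of differentiability points is Borel. *)
Lemma measurable_derive1_continuous g : continuous g -> measurable_fun setT (derive1 g).
Proof.
move=> gc.
have dqc h : continuous (dquot g h).
  move=> x; apply: cvgM; first exact: cvg_cst.
  apply: cvgB; last exact: gc.
  by apply: (@continuous_comp _ _ _ (fun x => h + x) g); [apply: cvgD => //; exact: cvg_cst|exact: gc].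
pose C m n := [set x | forall hk : R * R, 0 < `|hk.1| < n.+1%:R^-1 ->
  0 < `|hk.2| < n.+1%:R^-1 -> `|dquot g hk.1 x - dquot g hk.2 x| <= (m.+1%:R : R)^-1].
have mC m n : measurable (C m n).
  apply: closed_measurable.
  have -> : C m n = \bigcap_(hk in [set hk : R * R |
     0 < `|hk.1| < n.+1%:R^-1 /\ 0 < `|hk.2| < n.+1%:R^-1])
     (fun x => `|dquot g hk.1 x - dquot g hk.2 x|) @^-1` [set y | y <= (m.+1%:R : R)^-1].
    apply/seteqP; split => x /= H hk; first by case=> h1 h2; exact: H.
    by move=> h1 h2; exact: (H hk (conj h1 h2)).
  apply: closed_bigI => hk _; apply: closed_comp; last exact: closed_le.
  move=> x _; apply: cvg_norm; apply: cvgB; exact: dqc.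
pose D := \bigcap_m \bigcup_n C m n.
have mD : measurable D by apply: bigcapT_measurable => m; exact: bigcupT_measurable.
have inv_small e : 0 < e -> exists n : nat, n.+1%:R^-1 < e.
  move=> e0; exists (Num.truncn e^-1); rewrite -[ltRHS]invrK ltf_pV2 ?posrE ?invr_gt0 //.
  exact: truncnS_gt.
have Dcvg x : D x -> cvg (dquot g h x @[h --> 0^']).
  move=> Dx; apply/cauchy_cvgP; apply: cauchy_exP => e /inv_small[m me].
  have [n _ Cn] := Dx m Logic.I; exists (dquot g (n.+2%:R)^-1 x).
  suff : \forall h \near 0^', ball (dquot g n.+2%:R^-1 x) e (dquot g h x) by [].
  near=> h; rewrite /ball /=; apply: le_lt_trans me.
  apply: (Cn ((n.+2%:R)^-1, h)) => /=.
    by rewrite gtr0_norm ?invr_gt0 ?ltr0n //= ltf_pV2 ?posrE ?ltr0n // ltr_nat.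
  apply/andP; split; first by rewrite normr_gt0; near: h; exact: nbhs_dnbhs_neq.
  by near: h; apply: dnbhs0_lt; rewrite invr_gt0 ltr0n.
have cvgD x : cvg (dquot g h x @[h --> 0^']) -> D x.
  move=> /cvg_ex[l /cvgrPdist_lt lE] m _.
  have [|r /= r0 H] := lE (2 * m.+1%:R)^-1; first by rewrite invr_gt0 mulr_gt0.
  have [n nr] := inv_small r r0; exists n => // -[h k] /= /andP[h0 hn] /andP[k0 kn].
  have /= H1 := H h; have /= H2 := H k.
  rewrite !sub0r !normrN -!normr_gt0 in H1 H2.
  have {}H1 := H1 (lt_trans hn nr) h0; have {}H2 := H2 (lt_trans kn nr) k0.
  have E : (2 * m.+1%:R)^-1 = (m.+1%:R)^-1 / 2 :> R by rewrite invfM mulrC.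
  rewrite E in H1 H2; rewrite [leRHS]splitr.
  rewrite (_ : _ - _ = (l - dquot g k x) - (l - dquot g h x)); last by ring.
  by rewrite (le_trans (ler_normB _ _)) // addrC lerD // ltW.
rewrite -(setvU D) setUC; apply/measurable_funU => //; first exact: measurableC.
split.
- apply: (@measurable_fun_cvg _ _ _ _ (fun n => dquot g (n.+1%:R)^-1)) => [n|x Dx].
    by apply: measurable_funTS; exact: continuous_measurable_fun.
  apply: (@cvg_comp _ _ _ (fun n : nat => (n.+1%:R)^-1) (fun h => dquot g h x) \oo 0^').
    move=> A [r r0 rA]; have /cvgrPdist_lt/(_ r r0) := @cvg_harmonic R.
    by apply: filterS => n /= Hn; apply: rA => //=; rewrite invr_neq0 // pnatr_eq0.
  have := Dcvg x Dx; rewrite /derive1.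
  suff -> : (fun h : R => h^-1 *: (g (h + x) - g x)) = (fun h => dquot g h x) by [].
  by apply/funext.
(* Off [D] the quotients have no limit and [derive1] takes its default value 0. *)
- apply: (@eq_measurable_fun _ _ _ _ _ (cst (0:R))); last exact: measurable_cst.
  move=> x /[1!inE] nDx; rewrite /derive1 dvgP // => H; apply: nDx.
  exact: cvgD.
Unshelve. all: by end_near. Qed.

(* Locked: comparing iterated derivatives by unfolding them diverges. *)
Definition derv : (R -> R) -> R -> R := locked (@derive1 R R).

Lemma dervE u : derv u = derive1 u.
Proof. by rewrite /derv -lock. Qed.

Lemma itv_exhaust a b : `]a, b[%classic = \bigcup_n `]a + n.+2%:R^-1, b - n.+2%:R^-1[%classic.
Proof.
apply/seteqP; split => x /=.
  rewrite in_itv /= => /andP[ax xb].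
  have d0 : 0 < Num.min (x - a) (b - x) by rewrite lt_min !subr_gt0 ax xb.
  exists (Num.truncn (Num.min (x - a) (b - x))^-1) => //.
  have : ((Num.truncn (Num.min (x - a) (b - x))^-1).+2%:R)^-1 < Num.min (x - a) (b - x).
    rewrite -[ltRHS]invrK ltf_pV2 ?posrE ?invr_gt0 ?ltr0n //.
    by apply: lt_trans (truncnS_gt _) _; rewrite ltr_nat.
  rewrite lt_min /= in_itv /=; move: (_%:R^-1) => r /andP[? ?].
  by apply/andP; split; lra.
move=> [n _] /=; rewrite !in_itv /= => /andP[ax xb].
have : 0 < n.+2%:R^-1 :> R by rewrite invr_gt0 ltr0n.
move: (n.+2%:R^-1 : R) ax xb => r ax xb r0.
by apply/andP; split; lra.
Qed.

(** Continuity is only available inside ]a, b[. On each interval of an exhaustion, u agrees with its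
    composition with [clamp], which is continuous on the whole line and has the same derivative
    there. *)
Lemma measurable_derive1 a b u : {in `]a, b[, continuous u} ->
  measurable_fun `]a, b[ (derv u).
Proof.
move=> uc; rewrite dervE.
rewrite itv_exhaust; apply/measurable_fun_bigcup => // n; set e := n.+2%:R^-1.
have e0 : 0 < e by rewrite invr_gt0 ltr0n.
have [ab|ba] := leP (b - e) (a + e).
  rewrite set_itv_ge ?bnd_simp -?leNgt //; exact: measurable_fun_set0.
pose g x := u (clamp (a + e) (b - e) x).
have gc : continuous g.
  move=> x; apply: (@continuous_comp _ _ _ (clamp (a + e) (b - e)) u).
    apply: (@continuous_max _ _ (cst (a + e)) (fun x => Num.min x (b - e)) x); first exact: cvg_cst.
    by apply: (@continuous_min _ _ id (cst (b - e))); [exact: cvg_id|exact: cvg_cst].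
  apply: uc; rewrite in_itv /=.
  have /andP[] := @clampP _ _ _ x (ltW ba).
  by move=> ? ?; apply/andP; split; lra.
apply: (eq_measurable_fun (derive1 g)); last first.
  by apply: measurable_funTS; exact: measurable_derive1_continuous.
move=> x /[1!inE] /= xab; rewrite !derive1E; apply: near_eq_derive.
near=> y; rewrite /g clamp_id //.
have : y \in `]a + e, b - e[ by near: y; exact: near_in_itvoo.
by rewrite in_itv /= => /andP[/ltW -> /ltW ->].
Unshelve. all: by end_near. Qed.

Implicit Types h : R -> R.

Lemma abscont_unif a b u : abscont a b u -> forall e, 0 < e -> exists2 d, 0 < d &
  forall x y, a <= x <= b -> a <= y <= b -> `|x - y| < d -> `|u x - u y| < e.
Proof.
move=> /abscont_seq uac e /uac[d d0 H]; exists d => // x y /andP[ax xb] /andP[ay yb].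
wlog xy : x y ax xb ay yb / x <= y => [hw|].
  have [xy|/ltW yx] := leP x y; first exact: hw.
  by rewrite distrC [in X in _ -> X]distrC; apply: hw.
move=> xyd; have := H [:: (x, y)]; rewrite !big_seq1 /= /inside /= ax xy yb.
rewrite distrC => /(_ isT isT); apply; apply: le_lt_trans xyd.
by rewrite distrC ler_norm.
Qed.

Lemma abscont_continuous_in a b u : abscont a b u -> {in `]a, b[, continuous u}.
Proof.
move=> uac x; rewrite in_itv /= => /andP[ax xb].
apply/cvgrPdist_lt => e /(abscont_unif uac)[d d0 H]; near=> y.
apply: H; first by rewrite !ltW.
- apply/andP; split; apply: ltW; near: y; [exact: lt_nbhsr|exact: lt_nbhsl].
- by near: y; exact: cvgr_dist_lt.
Unshelve. all: by end_near. Qed.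

Lemma abscont_cvg_right a b u : a < b -> abscont a b u -> u x @[x --> a^'+] --> u a.
Proof.
move=> ab uac; apply/cvgrPdist_lt => e /(abscont_unif uac)[d d0 H]; near=> y.
have ay : a < y by near: y; exact: nbhs_right_gt.
apply: H; first by rewrite lexx ltW.
- by rewrite ltW //=; near: y; exact: nbhs_right_le.
- rewrite distrC gtr0_norm ?subr_gt0 // ltrBlDl; near: y.
  by apply: nbhs_right_lt; rewrite ltrDl.
Unshelve. all: by end_near. Qed.

Lemma abscont_cvg_left a b u : a < b -> abscont a b u -> u x @[x --> b^'-] --> u b.
Proof.
move=> ab uac; apply/cvgrPdist_lt => e /(abscont_unif uac)[d d0 H]; near=> y.
have yb : y < b by near: y; exact: nbhs_left_lt.
apply: H; first by rewrite lexx ltW.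
- by rewrite (ltW yb) andbT; near: y; exact: nbhs_left_ge.
- rewrite gtr0_norm ?subr_gt0 // ltrBlDr -ltrBlDl; near: y.
  by apply: nbhs_left_gt; rewrite ltrBlDr ltrDl.
Unshelve. all: by end_near. Qed.

(* [measurable_itv] at the sigma-algebra that [lebesgue_measure] carries. *)
Lemma mitv (i : interval R) :
  (R.-ocitv.-measurable).-sigma.-measurable ([set` i] : set (measurableTypeR R)).
Proof. exact: measurable_itv. Qed.

(** * Indefinite integrals and absolute continuity *)

Lemma EFin_Rintegral (i : interval R) f : mu.-integrable [set` i] (EFin \o f) ->
  (\int[mu]_(x in [set` i]) f x)%:E = (\int[mu]_(x in [set` i]) (f x)%:E)%E.
Proof.
by move=> fi; rewrite /Rintegral fineK //; apply: integrable_fin_num => //; exact: mitv.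
Qed.

Lemma ae_imp (P Q : R -> Prop) : (forall x, P x -> Q x) ->
  {ae mu, forall x, P x} -> {ae mu, forall x, Q x}.
Proof.
move=> PQ; apply: filterS => //; exact: (ae_filter_ringOfSetsType mu).
Qed.

Lemma ae_imp2 (P Q S : R -> Prop) : (forall x, P x -> Q x -> S x) ->
  {ae mu, forall x, P x} -> {ae mu, forall x, Q x} -> {ae mu, forall x, S x}.
Proof.
move=> PQ; apply: filterS2 => //; exact: (ae_filter_ringOfSetsType mu).
Qed.

Lemma integrable_ae_eq a b g h : mu.-integrable `]a, b[ (EFin \o h) ->
  measurable_fun `]a, b[ g -> {ae mu, forall x, x \in `]a, b[ -> h x = g x} ->
  mu.-integrable `]a, b[ (EFin \o g).
Proof.
move=> /integrableP[mh hy] mg hg; apply/integrableP; split; first exact/measurable_EFinP.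
suff <- : (\int[mu]_(x in `]a, b[) `|(h x)%:E| = \int[mu]_(x in `]a, b[) `|(g x)%:E|)%E by [].
apply: ae_eq_integral; [exact: mitv|exact: measurableT_comp mh| |].
  by apply: measurableT_comp => //; exact/measurable_EFinP.
by apply: ae_imp hg => x + xab => /(_ xab) ->.
Qed.

(** The working form of absolute continuity: [abscont_ftc] (for a < b) and [primitive_on_abscont]
    translate between the two. *)
Definition primitive_on a b h u := mu.-integrable `]a, b[ (EFin \o h) /\
  forall x y, a <= x -> x <= y -> y <= b -> \int[mu]_(t in `]x, y[) h t = u y - u x.

Lemma primitive_on_near a b h u x : primitive_on a b h u -> x \in `]a, b[ ->
  mu.-integrable `]a, b] (EFin \o (h \_ `]a, b[)) /\
  {near x, (fun y => \int[mu]_(t in `]a, y]) (h \_ `]a, b[) t) =1 (fun y => u y - u a)}.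
Proof.
move=> [hint hE] xab; have hab : mu.-integrable `]a, b] (EFin \o (h \_ `]a, b[)).
  rewrite -restrict_EFin; apply: integrableS (measurableT) _ _ _ => //.
  by have [+ _] := integrable_mkcond (mu := mu) (EFin \o h) (measurable_itv `]a, b[); exact.
split => //; near=> y.
have : y \in `]a, b[ by near: y; exact: near_in_itvoo.
rewrite in_itv /= => /andP[ay yb].
rewrite -(hE a y (lexx a) (ltW ay) (ltW yb)).
transitivity (\int[mu]_(t in `]a, y[) (h \_ `]a, b[) t).
  apply/esym/Rintegral_itv_bndo_bndc.
  by apply: integrableS hab => //; apply: subset_itvl; rewrite bnd_simp ltW.
apply: eq_Rintegral => t; rewrite inE /= in_itv /= => /andP[at_ ty].
by rewrite patchE mem_set //= in_itv /= at_ (lt_trans ty).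
Unshelve. all: by end_near. Qed.

Lemma primitive_on_derive1 a b h u x : primitive_on a b h u -> x \in `]a, b[ ->
  lebesgue_pt (h \_ `]a, b[) x -> derivable u x 1 /\ derv u x = h x.
Proof.
move=> hu xab hx; have [hab hnear] := primitive_on_near hu xab.
move: (xab); rewrite in_itv /= => /andP[ax xb].
have [] := FTC1_lebesgue_pt xb hab (_ : (BRight a < BRight x)%O) hx.
  by rewrite bnd_simp.
set F := fun y => _ => dF.
have hnear' : {near x, F + cst (u a) =1 u}.
  by apply: filterS hnear => y /= Hy; rewrite fctE /= [F y]Hy subrK.
rewrite dervE !derive1E patchE mem_set // => DF.
have [D1 D2] := is_deriveD (DeriveDef dF DF) (is_derive_cst (u a) x (1 : R)).
split; first exact: near_eq_derivable hnear' D1.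
by rewrite -(near_eq_derive (1 : R) hnear') D2 addr0.
Qed.

Lemma primitive_on_ae a b h u : primitive_on a b h u ->
  {ae mu, forall x, x \in `]a, b[ -> derivable u x 1 /\ derv u x = h x}.
Proof.
move=> hu; have : locally_integrable setT (h \_ `]a, b[).
  apply: integrable_locally_restrict => //; exact: hu.1.
move/lebesgue_differentiation; apply: ae_imp => x hx xab.
exact: primitive_on_derive1 hu xab hx.
Qed.

(** A continuity point of h is a Lebesgue point, so the derivative exists at this very x and not
    just almost everywhere. *)
Lemma primitive_on_continuous a b h u x : primitive_on a b h u -> x \in `]a, b[ ->
  {for x, continuous h} -> derivable u x 1 /\ derv u x = h x.
Proof.
move=> hu xab hx; apply: (primitive_on_derive1 hu xab).
apply: (@continuous_lebesgue_pt _ _ _ `]a, b[%classic) => //.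
- have [/integrableP[/measurable_EFinP mh _] _] := hu.
  apply: (eq_measurable_fun h) => //.
  by move=> y /[1!inE] yab; rewrite patchE mem_set.
- have hn : {near x, h =1 h \_ `]a, b[}.
    near=> y; rewrite patchE mem_set //=; near: y; exact: near_in_itvoo.
  suff : (h \_ `]a, b[) y @[y --> x] --> (h \_ `]a, b[) x by [].
  rewrite patchE mem_set //.
  by apply: cvg_trans hx; apply: near_eq_cvg.
Unshelve. all: by end_near. Qed.

(** Lebesgue differentiation identifies the density of [abscont_integral] with [derv u] almost
    everywhere; as [derv u] is measurable, it can replace that density under the integral. *)
Lemma abscont_ftc a b u : a < b -> abscont a b u ->
  primitive_on a b (derv u) u /\
  {ae mu, forall x, x \in `]a, b[ -> derivable u x 1}.
Proof.
move=> ab uac; have [h hint hE] := abscont_integral (ltW ab) uac.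
have hu : primitive_on a b h u.
  split; first exact: integrableS hint.
  move=> x y ax xy yb; rewrite Rintegral_itv_bndo_bndc; last exact: integrableS hint.
  by rewrite /Rintegral -hE.
have ae_h := primitive_on_ae hu.
have mu' : measurable_fun `]a, b[ (derv u).
  by apply: measurable_derive1; exact: abscont_continuous_in.
have mh : measurable_fun [set: R] h by case/integrableP : hint => /measurable_EFinP.
have ae_sub x y : a <= x -> y <= b -> ae_eq mu `]x, y[%classic (EFin \o h) (EFin \o derv u).
  move=> ax yb; apply: ae_imp ae_h => t + /= tab.
  case => [|_ ->] //; apply: subset_itv tab; rewrite bnd_simp //.
have ms x y : a <= x -> y <= b -> measurable_fun `]x, y[ (derv u).
  move=> ax yb; apply: measurable_funS mu' => //.
  by apply: subset_itv; rewrite bnd_simp.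
split; last by apply: ae_imp ae_h => x + xab => /(_ xab)[].
split.
  by apply: integrable_ae_eq hu.1 mu' _; apply: ae_imp ae_h => t + tab => /(_ tab)[_ ->].
move=> x y ax xy yb; rewrite -(hu.2 _ _ ax xy yb) /Rintegral; congr fine.
apply/esym/ae_eq_integral => //.
- by apply/measurable_EFinP; exact: measurable_funTS.
- by apply/measurable_EFinP; exact: ms.
- exact: ae_sub.
Qed.

(** Absolute continuity of the integral of |h|, applied to the union [A] of the given disjoint
    intervals, whose measure is the sum of their lengths. *)
Lemma primitive_on_abscont a b h u : primitive_on a b h u -> abscont a b u.
Proof.
move=> [hint hE] e e0.
have hT : mu.-integrable setT (EFin \o (h \_ `]a, b[)).
  rewrite -restrict_EFin.
  by have [+ _] := integrable_mkcond (mu := mu) (EFin \o h) (measurable_itv `]a, b[); exact.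
have [d [d0 H]] := integral_normr_continuous hT e0.
exists d => // n x y xy dis len; pose I i := `]x i, y i[%classic.
have muI i : mu `]x i, y i[ = (y i - x i)%:E.
  rewrite lebesgue_measure_itv /= lte_fin.
  have [_ [+ _]] := xy i; rewrite le_eqVlt => /predU1P[->|->]; last by rewrite EFinB.
  by rewrite ltxx subrr.
pose A := \big[setU/set0]_(i <- enum 'I_n) I i.
have mI i : measurable (I i) by exact: measurable_itv.
have tI : trivIset [set` enum 'I_n] I.
  by apply/trivIsetP => i j _ _ ij; exact: dis.
have mA : measurable A by apply: bigsetU_measurable.
have muA : (mu A < d%:E)%E.
  rewrite -[mu A]mul1e -[1%E]/(1%:E) -integral_cst //.
  rewrite (ge0_integral_bigsetU mu mI (enum_uniq 'I_n) tI) //.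
  rewrite big_enum /= (eq_bigr (fun i => (y i - x i)%:E)) ?sumEFin ?lte_fin //.
  move=> i _; rewrite integral_cst; last exact: mI.
  by rewrite mul1e; exact: muI.
have {}H := H A mA muA; apply: le_lt_trans H.
have hA : mu.-integrable A (EFin \o (h \_ `]a, b[)) by exact: integrableS hT.
have mh : measurable_fun setT (h \_ `]a, b[).
  by case/integrableP : hT => /measurable_EFinP.
rewrite -lee_fin /Rintegral fineK; last first.
  by apply: integrable_fin_num => //; exact: (integrable_abse hA).
rewrite (ge0_integral_bigsetU mu mI (enum_uniq 'I_n) tI) //; last first.
  by apply/measurable_EFinP; apply: measurableT_comp => //; exact: measurable_funTS.
rewrite big_enum -sumEFin; apply: lee_sum => i _.
have [axi [xyi yib]] := xy i; rewrite -hE //.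
have hi : mu.-integrable (I i) (EFin \o (h \_ `]a, b[)).
  by apply: integrableS hT => //; exact: mI.
have -> : \int[mu]_(t in `]x i, y i[) h t = \int[mu]_(t in I i) (h \_ `]a, b[) t.
  apply: eq_Rintegral => t; rewrite inE /= => ti; rewrite patchE mem_set //.
  by apply: subset_itv ti; rewrite bnd_simp.
rewrite (EFin_normr_Rintegral (mitv _) hi); apply: le_abse_integral; first exact: mitv.
by case/integrableP : hi.
Qed.

(** The closure properties below (sums, products, inverses, change of representative) are all
    reduced to this comparison of increments. *)
Lemma abscont_dom a b K u v w : 0 <= K -> abscont a b u -> abscont a b v ->
  (forall x y, a <= x -> x <= y -> y <= b ->
     `|w y - w x| <= K * (`|u y - u x| + `|v y - v x|)) -> abscont a b w.
Proof.
move=> K0 uac vac H e e0.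
(* K + 1 instead of K, because K may be 0 and a strict inequality is wanted. *)
have c0 : 0 < e / (2 * (K + 1)) by rewrite divr_gt0 // mulr_gt0 // ltr_wpDl.
have [d1 d10 H1] := uac _ c0; have [d2 d20 H2] := vac _ c0.
exists (Num.min d1 d2) => [|n x y xy dis]; first by rewrite lt_min d10.
rewrite lt_min => /andP[/(H1 n x y xy dis) {}H1 /(H2 n x y xy dis) {}H2].
apply: (@le_lt_trans _ _ (K * (\sum_i `|u (y i) - u (x i)| + \sum_i `|v (y i) - v (x i)|))).
  rewrite -big_split mulr_sumr; apply: ler_sum => i _.
  by have [? [? ?]] := xy i; exact: H.
apply: (@le_lt_trans _ _ (K * (e / (2 * (K + 1)) + e / (2 * (K + 1))))).
  by rewrite ler_wpM2l // lerD // ltW.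
have -> : K * (e / (2 * (K + 1)) + e / (2 * (K + 1))) = e * (K / (K + 1)).
  by field; lra.
by rewrite gtr_pMr // ltr_pdivrMr ?ltr_wpDl //; lra.
Qed.

Lemma abscont_id a b : abscont a b id.
Proof.
move=> e e0; exists e => // n x y xy _; apply: le_lt_trans.
by apply: ler_sum => i _; have [_ [? _]] := xy i; rewrite ger0_norm ?subr_ge0.
Qed.

Lemma abscont_cst a b c : abscont a b (cst c).
Proof.
move=> e e0; exists e => // n x y _ _ _.
by rewrite big1 // => i _; rewrite subrr normr0.
Qed.

Lemma abscont_eq a b u v : (forall x, a <= x <= b -> u x = v x) ->
  abscont a b u -> abscont a b v.
Proof.
move=> uv uac; apply: (abscont_dom ler01 uac uac) => x y ax xy yb.
rewrite -!uv ?ax ?(le_trans ax xy) ?(le_trans xy) //.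
by rewrite mul1r lerDl.
Qed.

Lemma abscont_sub a b a' b' u : a <= a' -> b' <= b -> abscont a b u -> abscont a' b' u.
Proof.
move=> aa bb uac e /uac[d d0 H]; exists d => // n x y xy; apply: H => i.
by have [h1 [h2 h3]] := xy i; rewrite (le_trans aa h1) (le_trans h3 bb).
Qed.

Lemma abscont_bounded a b u : a <= b -> abscont a b u ->
  exists2 M, 0 <= M & forall x, a <= x <= b -> `|u x| <= M.
Proof.
move=> ab uac; have TVy := abscont_total_variation_lty ab uac.
have TV0 := total_variation_ge0 u ab.
exists (`|u a| + fine (total_variation a b u)); first by rewrite addr_ge0 // fine_ge0.
move=> x /andP[ax xb]; rewrite -[u x](subrK (u a)) addrC.
rewrite (le_trans (ler_normD _ _)) // lerD2l -lee_fin fineK ?ge0_fin_numE //.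
rewrite (total_variationD u ax xb) (le_trans (total_variation_ge u ax)) //.
by rewrite leeDl // total_variation_ge0.
Qed.

Lemma abscontD a b u v : abscont a b u -> abscont a b v -> abscont a b (fun x => u x + v x).
Proof.
move=> uac vac; apply: (abscont_dom ler01 uac vac) => x y _ _ _.
by rewrite mul1r opprD addrACA ler_normD.
Qed.

Lemma abscontM a b u v : a <= b -> abscont a b u -> abscont a b v ->
  abscont a b (fun x => u x * v x).
Proof.
move=> ab uac vac; have [M M0 uM] := abscont_bounded ab uac.
have [N N0 vN] := abscont_bounded ab vac.
apply: (@abscont_dom a b (M + N) u v _ _ uac vac) => [|x y ax xy yb].
  by rewrite addr_ge0.
rewrite (_ : u y * v y - u x * v x = u y * (v y - v x) + (u y - u x) * v x); last by ring.
rewrite (le_trans (ler_normD _ _)) // !normrM mulrDr addrC lerD //.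
  rewrite mulrC ler_wpM2r //.
  by rewrite (le_trans (vN x _)) ?ax ?(le_trans xy) // lerDr.
by rewrite ler_wpM2r // (le_trans (uM y _)) ?yb ?(le_trans ax) // lerDl.
Qed.

Lemma abscontZ a b c u : a <= b -> abscont a b u -> abscont a b (fun x => c * u x).
Proof. by move=> ab uac; apply: abscontM => //; exact: abscont_cst. Qed.

Lemma abscontB a b u v : a <= b -> abscont a b u -> abscont a b v ->
  abscont a b (fun x => u x - v x).
Proof.
move=> ab uac vac; apply: (abscont_eq (u := fun x => u x + -1 * v x)).
  by move=> x _; rewrite mulN1r.
by apply: abscontD => //; exact: abscontZ.
Qed.

Lemma abscontV a b c u : 0 < c -> (forall x, a <= x <= b -> c <= `|u x|) ->
  abscont a b u -> abscont a b (fun x => (u x)^-1).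
Proof.
move=> c0 uc uac; apply: (@abscont_dom a b (c^-2) u u _ _ uac uac) => [|x y ax xy yb].
  by rewrite invr_ge0 exprn_ge0 // ltW.
have cx := uc x; have cy := uc y; rewrite ax (le_trans xy yb) in cx.
rewrite yb (le_trans ax xy) in cy; have {}cx := cx isT; have {}cy := cy isT.
have ux : u x != 0 by rewrite -normr_gt0; exact: lt_le_trans cx.
have uy : u y != 0 by rewrite -normr_gt0; exact: lt_le_trans cy.
have -> : (u y)^-1 - (u x)^-1 = (u y * u x)^-1 * (u x - u y).
  by field; rewrite ux uy.
rewrite normrM distrC ler_pM // ?lerDl // normfV normrM lef_pV2 ?posrE.
- by rewrite expr2 ler_pM // ltW.
- by rewrite mulr_gt0 // normr_gt0.
- by rewrite exprn_gt0.
Qed.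

(** Integrates the differential inequality p <= u' + q. The left-hand side stays an extended real
    because its finiteness is what [hardy] and [sqint_of_weighted] are after. *)
Lemma abscont_integral_le a b u (p q : R -> R) : a < b -> abscont a b u ->
  measurable_fun `]a, b[ p -> (forall x, x \in `]a, b[ -> 0 <= p x) ->
  mu.-integrable `]a, b[ (EFin \o q) ->
  {ae mu, forall x, x \in `]a, b[ -> derivable u x 1 -> p x <= derv u x + q x} ->
  (\int[mu]_(x in `]a, b[) (p x)%:E <=
   (u b - u a + \int[mu]_(x in `]a, b[) q x)%:E)%E.
Proof.
move=> ab uac mp p0 qint pq; have [[dint dE] dae] := abscont_ftc ab uac.
have sint : mu.-integrable `]a, b[ (EFin \o (fun x => derv u x + q x)).
  by have := integrableD (mitv _) dint qint.
have -> : (u b - u a + \int[mu]_(x in `]a, b[) q x)%:E =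
    (\int[mu]_(x in `]a, b[) (derv u x + q x)%:E)%E.
  rewrite -(dE a b) ?lexx ?ltW // -(RintegralD (mitv _) dint qint).
  exact: EFin_Rintegral sint.
have ms : measurable_fun `]a, b[ (fun x => derv u x + q x).
  by case/integrableP : sint => /measurable_EFinP.
have pae : {ae mu, forall x, x \in `]a, b[ -> p x <= derv u x + q x}.
  by apply: ae_imp2 pq dae => x h1 h2 xab; exact: h1 xab (h2 xab).
(* The comparison of integrals asks for nonnegativity everywhere, whereas u' + q is known to
   dominate p, and hence 0, only almost everywhere. *)
apply: (@le_trans _ _ (\int[mu]_(x in `]a, b[) (Num.max 0 (derv u x + q x))%:E)%E); last first.
  rewrite le_eqVlt; apply/orP; left; apply/eqP; apply: ae_eq_integral.
  - exact: mitv.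
  - by apply/measurable_EFinP; apply: measurable_maxr => //; exact: measurable_cst.
  - exact/measurable_EFinP.
  - apply: ae_imp pae => x + xab => /(_ xab) h /=; rewrite max_r //.
    exact: le_trans (p0 x xab) h.
apply: ae_ge0_le_integral.
- exact: mitv.
- by move=> x xab; rewrite lee_fin p0.
- exact/measurable_EFinP.
- by move=> x xab; rewrite lee_fin le_max lexx.
- by apply/measurable_EFinP; apply: measurable_maxr => //; exact: measurable_cst.
- by apply: ae_imp pae => x + xab => /(_ xab) h; rewrite lee_fin le_max h orbT.
Qed.

End DerivMeas.

(** * Square integrable functions on ]-1, 1[ *)

Section SqInt.
Context {R : realType}.
Implicit Types (a b x y e d c : R) (u v w : R -> R).
Local Notation mu := (@lebesgue_measure R).
Local Notation I := (@Ioo R).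

Lemma mIoo : (R.-ocitv.-measurable).-sigma.-measurable (I : set (measurableTypeR R)).
Proof. exact: mitv. Qed.

Lemma muIoo : mu I = 2%:E.
Proof.
rewrite lebesgue_measure_itv /= lte_fin (_ : -1 < 1 = true) ?opprK //.
by apply/idP; lra.
Qed.

Record sqint u : Prop := SqInt {
  sqint_measurable : measurable_fun I u;
  sqint_lty : (\int[mu]_(x in I) (u x ^+ 2)%:E < +oo)%E }.

(* Locked: unification must not try to compare integrals by unfolding them. *)
Definition dot : (R -> R) -> (R -> R) -> R :=
  locked (fun u v => \int[mu]_(x in I) (u x * v x)).

Lemma dotE u v : dot u v = \int[mu]_(x in I) (u x * v x).
Proof. by rewrite /dot -lock. Qed.

Lemma le_integrable_Ioo u v : measurable_fun I u -> mu.-integrable I (EFin \o v) ->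
  (forall x, I x -> `|u x| <= v x) -> mu.-integrable I (EFin \o u).
Proof.
move=> mu' vi uv; apply: le_integrable vi; first exact: mIoo.
  exact/measurable_EFinP.
move=> x Ix /=; rewrite lee_fin (le_trans (uv x Ix)) //; exact: ler_norm.
Qed.

Lemma integrable_cst_Ioo c : mu.-integrable I (EFin \o cst c).
Proof.
apply/integrableP; split; first by apply/measurable_EFinP; exact: measurable_cst.
rewrite (eq_integral (cst `|c|%:E)) // integral_cst; last exact: mIoo.
set m := (X in (_ * X)%E); have -> : m = 2%:E by exact: muIoo.
by rewrite -EFinM ltry.
Qed.

Lemma integrable_nonneg u : measurable_fun I u -> (forall x, 0 <= u x) ->
  mu.-integrable I (EFin \o u) <-> (\int[mu]_(x in I) (u x)%:E < +oo)%E.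
Proof.
move=> mu' u0; have E : (\int[mu]_(x in I) `|(u x)%:E| = \int[mu]_(x in I) (u x)%:E)%E.
  by apply: eq_integral => x _ /=; rewrite ger0_norm.
split=> [/integrableP[_]|uy]; first by rewrite E.
by apply/integrableP; split; [exact/measurable_EFinP|rewrite E].
Qed.

Lemma sqint_sqr u : sqint u -> mu.-integrable I (EFin \o (fun x => u x ^+ 2)).
Proof.
move=> [mu' uy]; apply/integrable_nonneg => // [|x]; last exact: sqr_ge0.
exact: measurable_funX.
Qed.

Lemma sqintP u : measurable_fun I u -> mu.-integrable I (EFin \o (fun x => u x ^+ 2)) ->
  sqint u.
Proof.
move=> mu' ui; split => //; apply/integrable_nonneg => // [|x]; last exact: sqr_ge0.
exact: measurable_funX.
Qed.

Lemma sqint_integrableM u v : sqint u -> sqint v ->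
  mu.-integrable I (EFin \o (fun x => u x * v x)).
Proof.
move=> us vs; have su := sqint_sqr us; have sv := sqint_sqr vs.
apply: (@le_integrable_Ioo _ (fun x => u x ^+ 2 + v x ^+ 2)).
- by apply: measurable_funM; [exact: (sqint_measurable us)|exact: (sqint_measurable vs)].
- by have := integrableD mIoo su sv.
- move=> x _; rewrite normrM -(real_normK (num_real (u x))) -(real_normK (num_real (v x))).
  have := normr_ge0 (u x); have := normr_ge0 (v x); nra.
Qed.

Lemma sqint_dom u v w : measurable_fun I w -> sqint u -> sqint v ->
  (forall x, I x -> w x ^+ 2 <= u x ^+ 2 + v x ^+ 2) -> sqint w.
Proof.
move=> mw us vs H; apply: sqintP => //.
apply: (@le_integrable_Ioo _ (fun x => u x ^+ 2 + v x ^+ 2)).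
- exact: measurable_funX.
- by have := integrableD mIoo (sqint_sqr us) (sqint_sqr vs).
- by move=> x Ix; rewrite ger0_norm ?sqr_ge0 // H.
Qed.

Lemma sqint0 : sqint (cst 0).
Proof.
split; first exact: measurable_cst.
by rewrite (eq_integral (cst 0%E)) ?integral0 // => x _; rewrite /= expr0n.
Qed.

Lemma sqintZ c u : sqint u -> sqint (fun x => c * u x).
Proof.
move=> us; apply: sqintP; first by apply: measurable_funM (sqint_measurable us); exact: measurable_cst.
have := integrableZl mIoo (c ^+ 2) (sqint_sqr us).
rewrite (_ : (fun x => _) = (EFin \o (fun x => (c * u x) ^+ 2))) //.
by apply/funext => x /=; rewrite -EFinM exprMn.
Qed.

Lemma sqintD u v : sqint u -> sqint v -> sqint (fun x => u x + v x).
Proof.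
move=> us vs; apply: (sqint_dom (u := fun x => 2 * u x) (v := fun x => 2 * v x)).
- by apply: measurable_funD; [exact: (sqint_measurable us)|exact: (sqint_measurable vs)].
- exact: sqintZ.
- exact: sqintZ.
- by move=> x _; nra.
Qed.

Lemma sqintN u : sqint u -> sqint (fun x => - u x).
Proof.
move=> /(sqintZ (-1)); congr sqint.
by apply/funext => x; rewrite mulN1r.
Qed.

Lemma sqintB u v : sqint u -> sqint v -> sqint (fun x => u x - v x).
Proof. by move=> us /sqintN; exact: sqintD. Qed.

Lemma sqint_bounded M u : measurable_fun I u -> (forall x, I x -> `|u x| <= M) -> sqint u.
Proof.
move=> mu' uM; apply: sqintP => //.
apply: (@le_integrable_Ioo _ (cst (M ^+ 2))); first exact: measurable_funX.
  exact: integrable_cst_Ioo.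
move=> x Ix /=; rewrite ger0_norm ?sqr_ge0 // -(real_normK (num_real (u x))).
by rewrite lerXn2r ?nnegrE ?(le_trans _ (uM x Ix)) // uM.
Qed.

Lemma sqint_mul_bounded M u v : measurable_fun I u -> (forall x, I x -> `|u x| <= M) ->
  sqint v -> sqint (fun x => u x * v x).
Proof.
move=> mu' uM vs; apply: (sqint_dom (u := fun x => M * v x) (v := cst 0)).
- by apply: measurable_funM (sqint_measurable vs).
- exact: sqintZ.
- exact: sqint0.
- move=> x Ix; rewrite /= expr0n addr0 !exprMn ler_wpM2r ?sqr_ge0 //.
  rewrite -(real_normK (num_real (u x))).
  by rewrite lerXn2r ?nnegrE ?(le_trans _ (uM x Ix)) // uM.
Qed.

Lemma integral_ae_eq_Ioo u v : measurable_fun I u -> measurable_fun I v ->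
  {ae mu, forall x, I x -> u x = v x} ->
  (\int[mu]_(x in I) (u x)%:E = \int[mu]_(x in I) (v x)%:E)%E.
Proof.
move=> mu' mv uv; apply: ae_eq_integral.
- exact: mIoo.
- exact/measurable_EFinP.
- exact/measurable_EFinP.
- by apply: ae_imp uv => x + Ix => /(_ Ix) ->.
Qed.

Lemma Rintegral_ae_eq_Ioo u v : measurable_fun I u -> measurable_fun I v ->
  {ae mu, forall x, I x -> u x = v x} ->
  \int[mu]_(x in I) u x = \int[mu]_(x in I) v x.
Proof. by move=> ? ? ?; rewrite /Rintegral (@integral_ae_eq_Ioo u v). Qed.

Lemma sqint_ae u v : measurable_fun I v -> {ae mu, forall x, I x -> u x = v x} ->
  sqint u -> sqint v.
Proof.
move=> mv uv [mu' uy]; split => //.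
rewrite -(@integral_ae_eq_Ioo (fun x => u x ^+ 2)) //; [exact: measurable_funX..|].
by apply: ae_imp uv => x + Ix => /(_ Ix) ->.
Qed.

Lemma dotC u v : dot u v = dot v u.
Proof. by rewrite !dotE; apply: eq_Rintegral => x _; rewrite mulrC. Qed.

Lemma dotDl u v w : sqint u -> sqint v -> sqint w ->
  dot (fun x => u x + v x) w = dot u w + dot v w.
Proof.
move=> us vs ws; rewrite !dotE -RintegralD; last 3 first.
- exact: mIoo.
- exact: sqint_integrableM.
- exact: sqint_integrableM.
by apply: eq_Rintegral => x _; rewrite mulrDl.
Qed.

Lemma dotZl c u w : sqint u -> sqint w -> dot (fun x => c * u x) w = c * dot u w.
Proof.
move=> us ws; rewrite !dotE -RintegralZl; last 2 first.
- exact: mIoo.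
- exact: sqint_integrableM.
by apply: eq_Rintegral => x _; rewrite mulrA.
Qed.

Lemma dotBl u v w : sqint u -> sqint v -> sqint w ->
  dot (fun x => u x - v x) w = dot u w - dot v w.
Proof.
move=> us vs ws; rewrite (dotDl us (sqintN vs) ws); congr (_ + _).
rewrite -mulN1r -dotZl // !dotE; apply: eq_Rintegral => x _; by rewrite mulN1r.
Qed.

Lemma dotBr u v w : sqint u -> sqint v -> sqint w ->
  dot w (fun x => u x - v x) = dot w u - dot w v.
Proof. by move=> us vs ws; rewrite dotC dotBl // ![dot _ w]dotC. Qed.

Lemma dotZr c u w : sqint u -> sqint w -> dot w (fun x => c * u x) = c * dot w u.
Proof. by move=> us ws; rewrite dotC dotZl // dotC. Qed.

Lemma dot_ge0 u : 0 <= dot u u.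
Proof. by rewrite dotE; apply: Rintegral_ge0 => x _; rewrite -expr2 sqr_ge0. Qed.

Lemma EFin_dot u : sqint u -> (dot u u)%:E = (\int[mu]_(x in I) (u x ^+ 2)%:E)%E.
Proof. by move=> us; rewrite dotE EFin_Rintegral //; exact: sqint_integrableM. Qed.

Lemma dot_eq0 u : sqint u -> dot u u = 0 -> {ae mu, forall x, I x -> u x = 0}.
Proof.
move=> us u0; have : (\int[mu]_(x in I) `|(u x ^+ 2)%:E| = 0)%E.
  transitivity (dot u u)%:E; last by rewrite u0.
  rewrite EFin_dot //; apply: eq_integral => x _ /=.
  by rewrite ger0_norm // sqr_ge0.
move/(@ae_eq_integral_abs _ _ _ mu I mIoo (fun x => (u x ^+ 2)%:E)).
have m2 : measurable_fun I (fun x => (u x ^+ 2)%:E).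
  by apply/measurable_EFinP; apply: measurable_funX (sqint_measurable us).
move=> /(_ m2); apply: ae_imp => x + Ix => /(_ Ix) [] /eqP.
by rewrite sqrf_eq0 => /eqP.
Qed.

Lemma dot_Cauchy_Schwarz u v : sqint u -> sqint v -> dot u v ^+ 2 <= dot u u * dot v v.
Proof.
move=> us vs; have [v0|v0] := eqVneq (dot v v) 0.
  have -> : dot u v = 0; last by rewrite expr0n v0 mulr0.
  rewrite dotE; transitivity (\int[mu]_(x in I) (cst (0 : R) x)); last first.
    by rewrite /Rintegral /= integral0_eq.
  apply: Rintegral_ae_eq_Ioo.
  - by apply: measurable_funM; [exact: (sqint_measurable us)|exact: (sqint_measurable vs)].
  - exact: measurable_cst.
  - by apply: ae_imp (dot_eq0 vs v0) => x + Ix => /(_ Ix) ->; rewrite mulr0.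
have {}v0 : 0 < dot v v by rewrite lt_neqAle eq_sym v0 dot_ge0.
have := dot_ge0 (fun x => u x - dot u v / dot v v * v x).
have sv c : sqint (fun x => c * v x) by exact: sqintZ.
rewrite dotBl ?dotBr ?dotZl ?dotZr //; last exact: sqintB.
rewrite (dotC v u); have -> : dot u u - dot u v / dot v v * dot u v -
   (dot u v / dot v v * dot u v - dot u v / dot v v * (dot u v / dot v v * dot v v)) =
   dot u u - dot u v ^+ 2 / dot v v by field; lra.
by rewrite subr_ge0 ler_pdivrMr.
Qed.

Lemma sqint_integrable u : sqint u -> mu.-integrable I (EFin \o u).
Proof.
move=> us; have := sqint_integrableM us (v := cst 1).
rewrite (_ : (fun x => u x * cst 1 x) = u); last by apply/funext => x; rewrite mulr1.
apply; apply: (@sqint_bounded 1); first exact: measurable_cst.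
by move=> x _; rewrite normr1.
Qed.

Lemma Ioo_exhaust : I = \bigcup_n `](-1) + n.+2%:R^-1, 1 - n.+2%:R^-1[%classic.
Proof. exact: itv_exhaust. Qed.

(** Monotone convergence along an exhaustion. The bound is asked for only when a < 0 < b, so that
    the signs of boundary terms at a and b can be used. *)
Lemma integral_Ioo_le u (M : R) : measurable_fun I u -> (forall x, I x -> 0 <= u x) ->
  (forall a b, -1 < a -> a < 0 -> 0 < b -> b < 1 ->
     (\int[mu]_(x in `]a, b[) (u x)%:E <= M%:E)%E) ->
  (\int[mu]_(x in I) (u x)%:E <= M%:E)%E.
Proof.
move=> mu' u0 H; pose F n := `](-1) + n.+2%:R^-1, 1 - n.+2%:R^-1[%classic : set R.
have ndF : nondecreasing_seq F.
  move=> m n mn; apply/subsetPset; apply: subset_itv; rewrite bnd_simp.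
    by rewrite lerD2l lef_pV2 ?posrE ?ltr0n // ler_nat.
  by rewrite lerD2l lerN2 lef_pV2 ?posrE ?ltr0n // ler_nat.
have mF n : (R.-ocitv.-measurable).-sigma.-measurable (F n : set (measurableTypeR R)).
  exact: mitv.
have FI n : F n `<=` I by rewrite Ioo_exhaust; exact: bigcup_sup.
have muF n : measurable_fun (F n) (fun x => (u x)%:E).
  by apply/measurable_EFinP; apply: measurable_funS (FI n) mu'; exact: mIoo.
have u0F n x : F n x -> (0 <= (u x)%:E)%E by move=> /FI Ix; rewrite lee_fin u0.
have := @ge0_nondecreasing_set_cvg_integral _ _ _ (F : nat -> set (measurableTypeR R)) (fun x => (u x)%:E) mu ndF mF muF u0F.
rewrite -Ioo_exhaust => /cvg_lim <- //; apply: lime_le.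
  apply: ereal_nondecreasing_is_cvgn.
  exact: (@ge0_nondecreasing_set_nondecreasing_integral _ _ _
    (F : nat -> set (measurableTypeR R)) (fun x => (u x)%:E) mu ndF mF muF u0F).
apply: nearW => n.
(* The shift by 2 in the exhaustion ensures a < 0 < b already for n = 0. *)
have : n.+2%:R^-1 <= 2^-1 :> R by rewrite lef_pV2 ?posrE ?ltr0n // ler_nat.
have : 0 < n.+2%:R^-1 :> R by rewrite invr_gt0 ltr0n.
rewrite /F; move: (n.+2%:R^-1 : R) => r r0 r2; apply: H; lra.
Qed.

Lemma limn_einf_le (f : (\bar R)^nat) (M : \bar R) :
  (forall n, f n <= M)%E -> (limn_einf f <= M)%E.
Proof.
move=> fM; rewrite limn_einf_lim; apply: lime_le; first exact: is_cvg_einfs.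
by apply: nearW => n; apply: le_trans (fM n); apply: ereal_inf_lbound; exists n => /=.
Qed.

Lemma geometric_half_le K : \sum_(0 <= k < K) (2 ^+ k)^-1 <= 2 :> R.
Proof.
suff -> : \sum_(0 <= k < K) (2 ^+ k)^-1 = 2 - 2 / 2 ^+ K :> R.
  by rewrite gerBl divr_ge0 // exprn_ge0.
elim: K => [|K IH]; first by rewrite big_nil expr0 divr1 subrr.
by rewrite big_nat_recr //= IH exprS; field; rewrite expf_neq0.
Qed.

(** Termwise |d k| <= 2^-k + 2^k (d k)^2, because (1 - 2^k |d k|)^2 >= 0; so the series converges
    absolutely. *)
Lemma cvg_of_summable_sqr (d : nat -> R) (s : R) :
  (forall K, \sum_(0 <= k < K) 2 ^+ k * d k ^+ 2 <= s) -> cvgn (series d).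
Proof.
move=> ds; apply: normed_cvg; apply: nondecreasing_is_cvgn.
  by apply/nondecreasing_seqP => n; rewrite /normed_series_of /series /= big_nat_recr //= lerDl.
exists (2 + s) => _ [K _ <-]; rewrite /normed_series_of /series /=.
have geo := geometric_half_le K.
apply: le_trans (lerD geo (ds K)); rewrite -big_split; apply: ler_sum => k _ /=.
have : 0 < 2 ^+ k :> R by rewrite exprn_gt0.
move: (2 ^+ k : R) => t t0; have tV : 0 < t^-1 by rewrite invr_gt0.
rewrite -(real_normK (num_real (d k))); move: `|d k| (normr_ge0 (d k)) => r r0.
have : 0 <= (1 - t * r) ^+ 2 / t by rewrite divr_ge0 ?sqr_ge0 // ltW.
have -> : (1 - t * r) ^+ 2 / t = t^-1 - 2 * r + t * r ^+ 2 by field; lra.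
lra.
Qed.

(* Riesz-Fischer: the limit is the pointwise limit of a rapidly converging
   subsequence, by Fatou's lemma. *)
Lemma sqint_complete (u : nat -> R -> R) : (forall n, sqint (u n)) ->
  (forall e, 0 < e -> exists N : nat, forall m n, (N <= m)%N -> (N <= n)%N ->
     dot (fun x => u m x - u n x) (fun x => u m x - u n x) < e) ->
  exists2 v, sqint v & forall e, 0 < e -> exists N : nat, forall n, (N <= n)%N ->
     dot (fun x => u n x - v x) (fun x => u n x - v x) <= e.
Proof.
move=> us uC; have uBs m n : sqint (fun x => u m x - u n x) by exact: sqintB.
(* With the rate 4^-k the functions 2^k (d k)^2 have integrals at most 2^-k, so their sum S is
   integrable, and [cvg_of_summable_sqr] applies wherever S is finite. *)
have /choice[N NP] : forall k, exists N : nat, forall m n, (N <= m)%N -> (N <= n)%N ->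
    dot (fun x => u m x - u n x) (fun x => u m x - u n x) < (4 ^+ k)^-1.
  by move=> k; apply: uC; rewrite invr_gt0 exprn_gt0.
(* This index exceeds every N i with i <= k, and also k itself, so that a tail of the subsequence is
   a tail of the sequence. *)
pose nk k := (k + \sum_(i < k.+1) N i)%N.
have Nnk i k : (i <= k)%N -> (N i <= nk k)%N.
  move=> ik; rewrite /nk (bigD1 (Ordinal (ik : (i < k.+1)%N))) //=.
  by rewrite addnCA leq_addr.
pose w k := u (nk k); pose d k x := w k.+1 x - w k x.
have ds k : sqint (d k) by exact: uBs.
have dd k : dot (d k) (d k) <= (4 ^+ k)^-1.
  by apply/ltW/NP; [apply: Nnk; exact: leqnSn|exact: Nnk].
pose g k x : \bar R := (2 ^+ k * d k x ^+ 2)%:E.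
have mg k : measurable_fun I (g k).
  apply/measurable_EFinP; apply: measurable_funM; first exact: measurable_cst.
  by apply: measurable_funX; exact: (sqint_measurable (ds k)).
have g0 k x : I x -> (0 <= g k x)%E.
  by move=> _; rewrite lee_fin mulr_ge0 ?sqr_ge0 // exprn_ge0.
pose S x := (\sum_(0 <= k <oo) g k x)%E.
have intg k : (\int[mu]_(x in I) g k x <= ((2 ^+ k)^-1)%:E)%E.
  have -> : (\int[mu]_(x in I) g k x = (2 ^+ k * dot (d k) (d k))%:E)%E.
    rewrite -dotZl // dotE EFin_Rintegral; last by apply: sqint_integrableM => //; exact: sqintZ.
    by apply: eq_integral => x _; rewrite /g expr2 mulrA.
  rewrite lee_fin (le_trans (ler_wpM2l _ (dd k))) ?exprn_ge0 //.
  by rewrite (_ : 4 = 2 * 2 :> R) ?exprMn ?invfM ?mulrA ?divff ?expf_neq0 ?mul1r //; lra.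
have Sint : (\int[mu]_(x in I) S x <= 2%:E)%E.
  rewrite integral_nneseries //; last exact: mIoo.
  apply: lime_le; first by apply: is_cvg_nneseries => n _ _; apply: integral_ge0 => x; exact: g0.
  apply: nearW => K; apply: (@le_trans _ _ (\sum_(0 <= k < K) ((2 ^+ k)^-1)%:E)%E).
    by apply: lee_sum => k _; exact: intg.
  rewrite sumEFin lee_fin.
  exact: geometric_half_le.
have mS : measurable_fun I S.
  by apply: ge0_emeasurable_sum => [k x Ix _|k _]; [exact: g0|exact: mg].
have Sfin : {ae mu, forall x, I x -> S x \is a fin_num}.
  apply: (integrable_ae mIoo); apply/integrableP; split => //.
  apply: le_lt_trans (ltry 2); apply: le_trans Sint; rewrite le_eqVlt.
  apply/orP; left; apply/eqP; apply: eq_integral => x; rewrite inE => Ix.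
  by rewrite gee0_abs //; apply: nneseries_ge0 => n _ _; exact: g0.
have wcvg x : I x -> S x \is a fin_num -> cvgn (fun k => w k x).
  move=> Ix Sx; have cd : cvgn (series (fun k => d k x)).
    apply: (@cvg_of_summable_sqr _ (fine (S x))) => K.
    rewrite -lee_fin fineK // -sumEFin; apply: nneseries_lim_ge => n _ _; exact: g0.
  have -> : (fun k => w k x) = (fun k => w 0%N x + series (fun k => d k x) k).
    apply/funext; elim=> [|k IH]; first by rewrite seriesEnat /= big_nil addr0.
    by rewrite seriesEnat /= big_nat_recr //= addrA [X in _ + X]/d -[X in X + _]IH addrC subrK.
  by apply: is_cvgD => //; exact: is_cvg_cst.
(* The upper limit is measurable on all of I, and it is the limit at every point where S is finite,
   that is, almost everywhere. *)
pose v x := fine (limn_esup (fun k => (w k x)%:E)).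
have vE x : I x -> S x \is a fin_num -> w k x @[k --> \oo] --> v x.
  move=> Ix Sx; have /cvg_ex[l wl] := wcvg x Ix Sx.
  suff -> : v x = l by exact: wl.
  have wl' : (w k x)%:E @[k --> \oo] --> l%:E.
    by apply: cvg_EFin; [exact: nearW|exact: wl].
  by rewrite /v (cvg_limn_einf_sup wl').2.
have mv : measurable_fun I v.
  apply: (measurableT_comp (fine_measurable measurableT)).
  by apply: measurable_fun_limn_esup => n; apply/measurable_EFinP; exact: (sqint_measurable (us _)).
have main n e K : (forall k, (K <= k)%N ->
    dot (fun x => u n x - u k x) (fun x => u n x - u k x) <= e) ->
    (\int[mu]_(x in I) ((u n x - v x) ^+ 2)%:E <= e%:E)%E.
  move=> H; pose f k x : \bar R := ((u n x - w (k + K)%N x) ^+ 2)%:E.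
  have mf k : measurable_fun I (f k).
    by apply/measurable_EFinP; apply: measurable_funX; exact: (sqint_measurable (uBs _ _)).
  have f0 k x : I x -> (0 <= f k x)%E by move=> _; rewrite lee_fin sqr_ge0.
  have -> : (\int[mu]_(x in I) ((u n x - v x) ^+ 2)%:E =
             \int[mu]_(x in I) limn_einf (f^~ x))%E.
    apply: ae_eq_integral.
    - exact: mIoo.
    - apply/measurable_EFinP; apply: measurable_funX.
      by apply: measurable_funB mv; exact: (sqint_measurable (us n)).
    - apply: (measurableT_comp (@oppe_measurable _ setT)); apply: measurable_fun_limn_esup => k.
      by apply: (measurableT_comp (@oppe_measurable _ setT)); exact: mf.
    - apply: ae_imp Sfin => x + Ix => /(_ Ix) Sx.
      have fl : f k x @[k --> \oo] --> ((u n x - v x) ^+ 2)%:E.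
        apply: cvg_EFin; first exact: nearW.
        rewrite /f /=; apply: cvgM; apply: cvgB; try exact: cvg_cst.
          by rewrite (cvg_shiftn K (w^~ x)); exact: vE.
        by rewrite (cvg_shiftn K (w^~ x)); exact: vE.
      by rewrite (cvg_limn_einf_sup fl).1.
  apply: (le_trans (fatou mu mIoo mf f0)); apply: limn_einf_le => k.
  rewrite /f -EFin_dot //; last exact: uBs.
  by rewrite lee_fin; apply: H; rewrite /nk -addnA addnCA leq_addr.
exists v.
  have [N1 H1] := uC 1 ltr01.
  have /main h : forall k, (N1 <= k)%N ->
    dot (fun x => u N1 x - u k x) (fun x => u N1 x - u k x) <= 1.
    by move=> k Nk; apply/ltW/H1.
  have s1 : sqint (fun x => u N1 x - v x).
    split; first by apply: measurable_funB mv; exact: (sqint_measurable (us N1)).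
    exact: le_lt_trans h (ltry _).
  have := sqintB (us N1) s1; congr sqint; apply/funext => x.
  by rewrite opprB addrC subrK.
move=> e e0; have [N1 H1] := uC e e0; exists N1 => n Nn.
have h : (\int[mu]_(x in I) ((u n x - v x) ^+ 2)%:E <= e%:E)%E.
  by apply: (main n e N1) => k Nk; apply/ltW/H1.
rewrite -lee_fin EFin_dot //; split; last exact: le_lt_trans h (ltry _).
by apply: measurable_funB mv; exact: (sqint_measurable (us n)).
Qed.

End SqInt.

(** * Hardy's inequality and the operator domain *)

Section Domain.
Context {R : realType}.
Implicit Types (a b x y e d c : R) (u v w g h : R -> R).
Local Notation mu := (@lebesgue_measure R).
Local Notation I := (@Ioo R).
Local Notation isd u x du := (is_derive (x : R) (1 : R) (u : R -> R) (du : R)).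

(** * Derivative rules and local absolute continuity on ]-1, 1[ *)

Lemma IooP x : I x <-> -1 < x /\ x < 1.
Proof. by rewrite /Ioo /= in_itv /=; split => [/andP[]|[-> ->]]. Qed.

Lemma isd_derive1 u x : derivable u x 1 -> isd u x (derv u x).
Proof. by move=> du; rewrite dervE derive1E; exact: derivableP. Qed.

Lemma derive1_isd u x du : isd u x du -> derv u x = du.
Proof. by move=> H; rewrite dervE derive1E derive_val. Qed.

Lemma isd_eq u x du dv : isd u x du -> du = dv -> isd u x dv.
Proof. by move=> H <-. Qed.

Lemma isdM u v x du dv : isd u x du -> isd v x dv ->
  isd (fun y => u y * v y) x (du * v x + u x * dv).
Proof.
move=> hu hv; apply: isd_eq (is_deriveM hu hv) _.
by rewrite /GRing.scale /= addrC [v x * _]mulrC.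
Qed.

Lemma isdD u v x du dv : isd u x du -> isd v x dv ->
  isd (fun y => u y + v y) x (du + dv).
Proof. by move=> hu hv; exact: is_deriveD. Qed.

Lemma isdB u v x du dv : isd u x du -> isd v x dv ->
  isd (fun y => u y - v y) x (du - dv).
Proof. by move=> hu hv; exact: is_deriveB. Qed.

Lemma isd_cst c x : isd (fun=> c) x 0.
Proof. exact: is_derive_cst. Qed.

Lemma isd_id x : isd (fun y => y) x 1.
Proof. exact: is_derive_id. Qed.

Lemma isdV u x du : u x != 0 -> isd u x du -> isd (fun y => (u y)^-1) x (- du / u x ^+ 2).
Proof.
move=> ux hu; apply: isd_eq (is_deriveV ux hu) _.
by rewrite /GRing.scale /= mulNr mulrC -mulNr.
Qed.

Lemma isd_weight x : isd (fun y => 1 - y ^+ 2) x (- (2 * x)).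
Proof.
have := isdB (isd_cst 1 x) (isdM (isd_id x) (isd_id x)).
rewrite (_ : (fun y => 1 - y * y) = (fun y => 1 - y ^+ 2)); last by apply/funext => y; rewrite expr2.
by move=> H; apply: isd_eq H _; ring.
Qed.

Lemma eq_on_Ioo_near u v x : (forall y, I y -> u y = v y) -> I x -> {near x, u =1 v}.
Proof.
move=> uv Ix; near=> y; apply: uv; rewrite /Ioo /=; near: y; exact: near_in_itvoo.
Unshelve. all: by end_near. Qed.

Lemma derive1_eq_on u v x : (forall y, I y -> u y = v y) -> I x -> derv u x = derv v x.
Proof.
by move=> uv Ix; rewrite !dervE !derive1E; apply: near_eq_derive; exact: eq_on_Ioo_near.
Qed.

Definition abscont_loc u : Prop :=
  forall a b, -1 < a -> a <= b -> b < 1 -> abscont a b u.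

Lemma abscont_locW u : abscont (-1) 1 u -> abscont_loc u.
Proof. by move=> uac a b a1 ab b1; apply: abscont_sub uac; exact: ltW. Qed.

Lemma abscont_loc_eq u v : (forall x, I x -> u x = v x) -> abscont_loc u -> abscont_loc v.
Proof.
move=> uv uac a b a1 ab b1; apply: (abscont_eq (u := u)); last exact: uac.
move=> x /andP[ax xb]; apply: uv; apply/IooP; lra.
Qed.

Lemma Ioo_inner x : I x -> [/\ -1 < (x - 1) / 2, (x - 1) / 2 < (x + 1) / 2,
  (x + 1) / 2 < 1 & x \in `](x - 1) / 2, (x + 1) / 2[].
Proof. by move=> /IooP[? ?]; rewrite in_itv /=; split; [lra|lra|lra|apply/andP; split; lra]. Qed.

Lemma abscont_loc_continuous u : abscont_loc u -> {in `]-1, 1[, continuous u}.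
Proof.
move=> uac x xI; have [h1 h2 h3 h4] := Ioo_inner xI.
exact: abscont_continuous_in (uac _ _ h1 (ltW h2) h3) _ h4.
Qed.

Lemma abscont_loc_measurable u : abscont_loc u -> measurable_fun I u.
Proof.
move=> uac; apply: open_continuous_measurable_fun; first exact: itv_open.
by move=> x; rewrite inE => xI; exact: abscont_loc_continuous.
Qed.

Lemma abscont_loc_measurable_derive1 u : abscont_loc u -> measurable_fun I (derv u).
Proof. by move=> uac; apply: measurable_derive1; exact: abscont_loc_continuous. Qed.

(** [derv u] is a density of u, so u is differentiable wherever [derv u] is continuous. This
    excludes that [derv u x] is merely the default value 0. *)
Lemma abscont_loc_derivable u x : abscont_loc u -> {for x, continuous (derv u)} -> I x ->
  derivable u x 1.
Proof.
move=> uac cu xI; have [h1 h2 h3 h4] := Ioo_inner xI.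
have [pu _] := abscont_ftc h2 (uac _ _ h1 (ltW h2) h3).
by have [] := primitive_on_continuous pu h4 cu.
Qed.

Lemma abscont_loc_ae u : abscont_loc u -> {ae mu, forall x, I x -> derivable u x 1}.
Proof.
move=> uac; have H n : {ae mu, forall x,
    x \in `](-1) + n.+2%:R^-1, 1 - n.+2%:R^-1[ -> derivable u x 1}.
  have : n.+2%:R^-1 <= 2^-1 :> R by rewrite lef_pV2 ?posrE ?ltr0n // ler_nat.
  have : 0 < n.+2%:R^-1 :> R by rewrite invr_gt0 ltr0n.
  move: (n.+2%:R^-1 : R) => r r0 r2.
  have ab : -1 + r < 1 - r by lra.
  have a1 : -1 < -1 + r by lra.
  have b1 : 1 - r < 1 by lra.
  by have [] := abscont_ftc ab (uac _ _ a1 (ltW ab) b1).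
have /ae_foralln := H; apply: ae_imp => x Hx; rewrite Ioo_exhaust => -[n _]; exact: Hx.
Qed.

Lemma abscont_weight a b : a <= b -> abscont a b (fun x => 1 - x ^+ 2).
Proof.
move=> ab; apply: abscontB => //; first exact: abscont_cst.
by have := abscontM ab (@abscont_id R a b) (@abscont_id R a b).
Qed.

Lemma weight_gt0 x : I x -> 0 < 1 - x ^+ 2.
Proof. by move=> /IooP[? ?]; nra. Qed.

Lemma abscont_weightV a b : -1 < a -> a <= b -> b < 1 -> abscont a b (fun x => (1 - x ^+ 2)^-1).
Proof.
move=> a1 ab b1; apply: (@abscontV _ a b ((1 - b) * (1 + a))).
- by rewrite mulr_gt0 //; lra.
- move=> x /andP[ax xb]; rewrite ger0_norm; last by apply/ltW/weight_gt0/IooP; lra.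
  rewrite (_ : 1 - x ^+ 2 = (1 - x) * (1 + x)); last by ring.
  by apply: ler_pM; lra.
- exact: abscont_weight.
Qed.

Lemma abscont_locM u v : abscont_loc u -> abscont_loc v -> abscont_loc (fun x => u x * v x).
Proof. by move=> ua va a b a1 ab b1; apply: abscontM => //; [exact: ua|exact: va]. Qed.

Lemma abscont_loc_weight : abscont_loc (fun x => 1 - x ^+ 2).
Proof. by move=> a b _ ab _; exact: abscont_weight. Qed.

Lemma abscont_loc_weightV : abscont_loc (fun x => (1 - x ^+ 2)^-1).
Proof. exact: abscont_weightV. Qed.

Lemma measurable_weight : measurable_fun I (fun x => 1 - x ^+ 2 : R).
Proof. exact: abscont_loc_measurable abscont_loc_weight. Qed.

Lemma primitive_exists h : mu.-integrable I (EFin \o h) ->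
  primitive_on (-1) 1 h (fun x => \int[mu]_(t in `]-1, x[) h t).
Proof.
move=> hi; split => // x y x1 xy y1.
have iS z : z <= 1 -> mu.-integrable `]-1, z[ (EFin \o h).
  move=> z1; apply: integrableS hi; [exact: mIoo|exact: mitv|].
  by apply: subset_itvl; rewrite bnd_simp.
have [->|nx] := eqVneq x (-1); first by rewrite set_itvoo0 Rintegral_set0 subr0.
have {nx}x1' : -1 < x by rewrite lt_neqAle eq_sym nx.
have [->|nxy] := eqVneq x y; first by rewrite set_itvoo0 Rintegral_set0 subrr.
have {nxy}xy' : x < y by rewrite lt_neqAle nxy.
have := Rintegral_itvB (iS y y1) (a := BRight (-1)) (x := x).
rewrite !bnd_simp (ltW x1') => /(_ isT xy').
rewrite -Rintegral_itv_bndo_bndc => [-> //|].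
by apply: iS; exact: le_trans xy y1.
Qed.

(** A square integrable derivative is integrable on the bounded interval, so its primitive P is
    absolutely continuous up to the end points. The additive constant is fixed by the value at 0. *)
Lemma abscont_extend v : abscont_loc v -> sqint (derv v) ->
  exists V, [/\ abscont (-1) 1 V, primitive_on (-1) 1 (derv v) V &
    forall x, I x -> V x = v x].
Proof.
move=> vac vs; have vi := sqint_integrable vs.
pose P x := \int[mu]_(t in `]-1, x[) derv v t.
have pP : primitive_on (-1) 1 (derv v) P by exact: primitive_exists.
pose V x := v 0 - P 0 + P x.
have pV : primitive_on (-1) 1 (derv v) V.
  split => // x y x1 xy y1; rewrite pP.2 // /V; ring.
exists V; split => //; first exact: primitive_on_abscont pV.
have I0 : I 0 by apply/IooP; lra.
move=> x /IooP[x1 x2]; rewrite /V.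
have [x0|x0|<-] := ltgtP x 0; last by rewrite subrK.
- have [pv _] := abscont_ftc x0 (vac _ _ x1 (ltW x0) ltr01).
  have := pv.2 x 0 (lexx _) (ltW x0) (lexx _); rewrite pP.2 ?ltW //; lra.
- have [|pv _] := abscont_ftc x0 (vac _ _ _ (ltW x0) x2); first by lra.
  have := pv.2 0 x (lexx _) (ltW x0) (lexx _); rewrite pP.2 ?ltW //; lra.
Qed.

Lemma Rintegral_indic u (J : set R) : J `<=` I ->
  \int[mu]_(t in J) u t = \int[mu]_(t in I) (u t * \1_J t).
Proof.
move=> JI; rewrite -[J in LHS](setIidr JI) Rintegral_mkcondr; apply: eq_Rintegral => t _.
by rewrite patchE indicE; case: ifPn => tJ; rewrite ?mulr1 ?mulr0 ?(negbTE tJ) ?tJ ?mulr1 ?mulr0.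
Qed.

(** Cauchy-Schwarz for h and the indicator function of ]x, y[. *)
Lemma abscont_increment_sqr h V x y : primitive_on (-1) 1 h V -> sqint h ->
  -1 <= x -> x <= y -> y <= 1 -> (V y - V x) ^+ 2 <= (y - x) * dot h h.
Proof.
move=> [hi hE] hs x1 xy y1; pose J := `]x, y[%classic : set R.
have JI : J `<=` I by apply: subset_itv; rewrite bnd_simp.
have sJ : sqint (\1_J : R -> R).
  apply: (@sqint_bounded _ 1); first by apply: measurable_indic; exact: measurable_itv.
  by move=> t _; rewrite indicE; case: (t \in J); rewrite ?normr1 ?normr0.
have res u : \int[mu]_(t in J) u t = dot u (\1_J).
  by rewrite dotE; exact: Rintegral_indic.
have muJ : mu `]x, y[ = (y - x)%:E.
  rewrite lebesgue_measure_itv /= lte_fin.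
  move: xy; rewrite le_eqVlt => /predU1P[->|->]; last by rewrite EFinB.
  by rewrite ltxx subrr.
have JJ : dot (\1_J) (\1_J) = y - x.
  rewrite -res (@eq_Rintegral _ _ _ mu J (cst 1)); last by move=> t tJ; rewrite indicE tJ.
  rewrite Rintegral_cst; last exact: mitv.
  rewrite mul1r; transitivity (fine (y - x)%:E) => //; congr fine; exact: muJ.
have := dot_Cauchy_Schwarz hs sJ.
by rewrite -res JJ hE // [_ * (y - x)]mulrC.
Qed.

(** The increment is taken from the nearer end point, whose distance to x is at most 1 - x^2. *)
Lemma vanishing_sqr_le h V x : primitive_on (-1) 1 h V -> sqint h ->
  V (-1) = 0 -> V 1 = 0 -> I x -> V x ^+ 2 <= (1 - x ^+ 2) * dot h h.
Proof.
move=> pV hs Va Vb /IooP[x1 x2]; have N0 := dot_ge0 h.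
have := abscont_increment_sqr pV hs (lexx _) (ltW x1) (ltW x2).
have := abscont_increment_sqr pV hs (ltW x1) (ltW x2) (lexx _).
rewrite Va Vb sub0r subr0 sqrrN => H1 H2.
have [x0|x0] := leP 0 x.
- apply: (le_trans H1); apply: ler_wpM2r => //; nra.
- apply: (le_trans H2); apply: ler_wpM2r => //; nra.
Qed.

Lemma sqint_of_local_bound u (M : R) : measurable_fun I u ->
  (forall a b, -1 < a -> a < 0 -> 0 < b -> b < 1 ->
     (\int[mu]_(x in `]a, b[) (u x ^+ 2)%:E <= M%:E)%E) -> sqint u.
Proof.
move=> mu' H; split => //; apply: le_lt_trans (ltry M); apply: integral_Ioo_le => //.
- exact: measurable_funX.
- by move=> x _; exact: sqr_ge0.
Qed.

Lemma Rintegral_sub_le u a b : sqint u -> -1 <= a -> b <= 1 ->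
  mu.-integrable `]a, b[ (EFin \o (fun x => u x ^+ 2)) /\
  \int[mu]_(x in `]a, b[) (u x ^+ 2) <= dot u u.
Proof.
move=> us a1 b1; have sub : `]a, b[ `<=` I by apply: subset_itv; rewrite bnd_simp.
have ui : mu.-integrable `]a, b[ (EFin \o (fun x => u x ^+ 2)).
  by apply: integrableS (sqint_sqr us); [exact: mIoo|exact: mitv|].
split => //; rewrite -lee_fin EFin_Rintegral // EFin_dot //.
apply: ge0_subset_integral => //; first exact: mitv.
- by apply/measurable_EFinP; apply: measurable_funX; exact: (sqint_measurable us).
- by move=> x _; rewrite lee_fin sqr_ge0.
Qed.

(* Hardy's inequality: integrate (V^2 phi)' = 2 V V' phi + V^2 phi' with
   phi = 2x/(1 - x^2) and use |2 V V' phi| <= V^2 phi^2 / 4 + 4 V'^2. *)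
Lemma hardy h V : primitive_on (-1) 1 h V -> sqint h -> V (-1) = 0 -> V 1 = 0 ->
  sqint (fun x => V x / (1 - x ^+ 2)).
Proof.
move=> pV hs Va Vb; have Vac := primitive_on_abscont pV.
have Vloc := abscont_locW Vac; have N0 := dot_ge0 h.
(* 8 = 2 + 2 + 4: each boundary value of U is at most 2 [dot h h] in modulus, by [vanishing_sqr_le],
   and the integral of (2 h)^2 gives 4. *)
apply: (@sqint_of_local_bound _ (8 * dot h h)).
  exact: abscont_loc_measurable (abscont_locM Vloc abscont_loc_weightV).
move=> a b a1 a0 b0 b1; have ab := lt_trans a0 b0.
pose U x := V x * V x * (2 * x * (1 - x ^+ 2)^-1).
have Uac : abscont a b U.
  apply: abscontM (ltW ab) _ _; first by apply: abscontM (ltW ab) _ _; apply: Vloc => //; exact: ltW.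
  apply: abscontM (ltW ab) _ _; last by apply: abscont_weightV => //; exact: ltW.
  by apply: abscontZ (ltW ab) _; exact: abscont_id.
have subI : `]a, b[ `<=` I by apply: subset_itv; rewrite bnd_simp ltW.
have Ubd x : I x -> `|U x| <= 2 * dot h h.
  move=> Ix; have D0 := weight_gt0 Ix.
  have E : U x = 2 * x * (V x ^+ 2 / (1 - x ^+ 2)) by rewrite /U; ring.
  rewrite E normrM (ger0_norm (divr_ge0 (sqr_ge0 _) (ltW D0))); apply: ler_pM => //.
  - by apply: divr_ge0; [exact: sqr_ge0|exact: ltW].
  - by move/IooP : Ix => [? ?]; rewrite ler_norml; apply/andP; split; lra.
  - rewrite ler_pdivrMr // mulrC; exact: vanishing_sqr_le.
have s2h : sqint (fun x => 2 * h x) by exact: sqintZ.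
have [qi qle] := Rintegral_sub_le s2h (ltW a1) (ltW b1).
have := @abscont_integral_le _ a b U (fun x => (V x / (1 - x ^+ 2)) ^+ 2)
  (fun x => (2 * h x) ^+ 2) ab Uac.
have mp : measurable_fun `]a, b[ (fun x => (V x / (1 - x ^+ 2)) ^+ 2).
  apply: measurable_funX; apply: measurable_funS subI _; first exact: measurable_itv.
  exact: abscont_loc_measurable (abscont_locM Vloc abscont_loc_weightV).
move=> /(_ mp (fun x _ => sqr_ge0 _) qi) H; apply: le_trans (H _) _.
  apply: ae_imp (primitive_on_ae pV) => x Hx xab _.
  have Ix : I x by exact: subI.
  have [dV VE] := Hx Ix; have D0 := weight_gt0 Ix.
  have HU : isd U x ((h x * V x + V x * h x) * (2 * x * (1 - x ^+ 2)^-1) +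
      V x * V x * ((0 * x + 2 * 1) * (1 - x ^+ 2)^-1 +
        2 * x * (- (- (2 * x)) / (1 - x ^+ 2) ^+ 2))).
    have hV : isd V x (h x) by rewrite -VE; exact: isd_derive1.
    exact: isdM (isdM hV hV) (isdM (isdM (isd_cst 2 x) (isd_id x))
      (isdV (u := fun y => 1 - y ^+ 2) (lt0r_neq0 D0) (isd_weight x))).
  rewrite (derive1_isd HU) -subr_ge0.
  have -> : (h x * V x + V x * h x) * (2 * x * (1 - x ^+ 2)^-1) +
      V x * V x * ((0 * x + 2 * 1) * (1 - x ^+ 2)^-1 +
        2 * x * (- (- (2 * x)) / (1 - x ^+ 2) ^+ 2)) + (2 * h x) ^+ 2 -
      (V x / (1 - x ^+ 2)) ^+ 2 =
      (2 * h x + x * V x / (1 - x ^+ 2)) ^+ 2 + (1 + x ^+ 2) * (V x / (1 - x ^+ 2)) ^+ 2.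
    by field; lra.
  by rewrite addr_ge0 ?sqr_ge0 // mulr_ge0 ?sqr_ge0 // addr_ge0 ?sqr_ge0.
rewrite lee_fin.
have /Ubd Ua : I a by apply/IooP; lra.
have /Ubd Ub : I b by apply/IooP; lra.
move: Ua Ub; rewrite !ler_norml => /andP[Ua _] /andP[_ Ub].
have E : dot (fun x => 2 * h x) (fun x => 2 * h x) = 4 * dot h h.
  by rewrite dotZl // dotZr // mulrA; congr (_ * _); ring.
rewrite E in qle; lra.
Qed.

(* [2 w^2 = 3(1 - x^2) w^2 - (x (1 - x^2) w^2)' + 2 x (1 - x^2) w w'], and the
   boundary terms of the exact derivative have the favourable sign. *)
Lemma sqint_of_weighted w : abscont_loc w ->
  sqint (fun x => (1 - x ^+ 2) * derv w x) ->
  sqint (fun x => Num.sqrt (1 - x ^+ 2) * w x) -> sqint w.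
Proof.
move=> wac s1 s2; set q1 := fun x => _ in s1; set q2 := fun x => _ in s2.
apply: (@sqint_of_local_bound _ (3 * dot q2 q2 + dot q1 q1)).
  exact: abscont_loc_measurable.
move=> a b a1 a0 b0 b1; have ab := lt_trans a0 b0.
pose U x := -1 * (x * (1 - x ^+ 2) * (w x * w x)).
have wab : abscont a b w by apply: wac => //; exact: ltW.
have Uac : abscont a b U.
  apply: abscontZ (ltW ab) _; apply: abscontM (ltW ab) _ _.
    by apply: abscontM (ltW ab) _ _; [exact: abscont_id|exact/abscont_weight/ltW].
  exact: abscontM (ltW ab) _ _.
have subI : `]a, b[ `<=` I by apply: subset_itv; rewrite bnd_simp ltW.
have [i1 le1] := Rintegral_sub_le s1 (ltW a1) (ltW b1).
have [i2 le2] := Rintegral_sub_le s2 (ltW a1) (ltW b1).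
have i3 : mu.-integrable `]a, b[ (EFin \o (fun x => 3 * q2 x ^+ 2)).
  by have := integrableZl (mitv _) 3 i2; congr (_.-integrable _ _); apply/funext => x /=; rewrite EFinM.
have qi : mu.-integrable `]a, b[ (EFin \o (fun x => 3 * q2 x ^+ 2 + q1 x ^+ 2)).
  by have := integrableD (mitv _) i3 i1.
have mp : measurable_fun `]a, b[ (fun x => w x ^+ 2).
  apply: measurable_funX; apply: measurable_funS subI _; first exact: measurable_itv.
  exact: abscont_loc_measurable.
apply: le_trans (abscont_integral_le ab Uac mp (fun x _ => sqr_ge0 _) qi _) _.
  apply: ae_imp (abscont_loc_ae wac) => x Hx xab _.
  have Ix : I x by exact: subI.
  have hw := isd_derive1 (Hx Ix); have D0 := weight_gt0 Ix.
  have HU : isd U x (0 * (x * (1 - x ^+ 2) * (w x * w x)) +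
     -1 * ((1 * (1 - x ^+ 2) + x * (- (2 * x))) * (w x * w x) +
     x * (1 - x ^+ 2) * (derv w x * w x + w x * derv w x))).
    exact: isdM (isd_cst (-1) x) (isdM (isdM (isd_id x) (isd_weight x)) (isdM hw hw)).
  rewrite (derive1_isd HU) /q1 /q2 exprMn sqr_sqrtr; last exact: ltW.
  rewrite -subr_ge0.
  have x2 : x ^+ 2 <= 1 by lra.
  move: (derv w x) => w'; set D := 1 - x ^+ 2.
  have -> : 0 * (x * D * (w x * w x)) + -1 * ((1 * D + x * (- (2 * x))) * (w x * w x) +
     x * D * (w' * w x + w x * w')) + (3 * (D * w x ^+ 2) + (D * w') ^+ 2) - w x ^+ 2 =
     (w x - x * (D * w')) ^+ 2 + (1 - x ^+ 2) * (D * w') ^+ 2 by rewrite /D; ring.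
  by rewrite addr_ge0 ?sqr_ge0 // mulr_ge0 ?sqr_ge0 // subr_ge0.
rewrite lee_fin RintegralD; [|exact: mitv|exact: i3|exact: i1].
rewrite RintegralZl; [|exact: mitv|exact: i2].
have Ia : I a by apply/IooP; lra.
have Ib : I b by apply/IooP; lra.
have := weight_gt0 Ia; have := weight_gt0 Ib => Db Da.
have Ub : U b <= 0.
  rewrite /U mulN1r oppr_le0 mulr_ge0 //; last by rewrite -expr2 sqr_ge0.
  by rewrite mulr_ge0 // ltW.
have Ua : 0 <= U a.
  rewrite /U mulN1r oppr_ge0 mulr_le0_ge0 //; last by rewrite -expr2 sqr_ge0.
  by rewrite mulr_le0_ge0 // ltW.
lra.
Qed.

Lemma sqint_lower_bound w p q K : sqint w -> -1 <= p -> p < q -> q <= 1 ->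
  (forall x, p < x -> x < q -> K <= w x ^+ 2) -> K * (q - p) <= dot w w.
Proof.
move=> ws p1 pq q1 H; have [wi] := Rintegral_sub_le ws p1 q1; apply: le_trans.
have mpq : mu `]p, q[ = (q - p)%:E.
  by rewrite lebesgue_measure_itv /= lte_fin pq EFinB.
have -> : K * (q - p) = \int[mu]_(x in `]p, q[) (cst K x).
  rewrite Rintegral_cst; last exact: mitv.
  by congr (_ * _); transitivity (fine (q - p)%:E) => //; congr fine; rewrite -mpq.
apply: le_Rintegral => //.
- apply: integrableS (integrable_cst_Ioo K); [exact: mIoo|exact: mitv|].
  by apply: subset_itv; rewrite bnd_simp.
- by move=> x /=; rewrite in_itv /= => /andP[? ?]; exact: H.
Qed.

Lemma ltN11 : (-1 : R) < 1.
Proof. lra. Qed.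

Lemma N11_in : -1 <= (-1 : R) <= 1.
Proof. by rewrite lexx ltW // ltN11. Qed.

Lemma P11_in : -1 <= (1 : R) <= 1.
Proof. by rewrite lexx ltW // ltN11. Qed.

(* Otherwise V / (1 - x^2) would have a non-square-integrable pole. *)
Lemma sqint_div_weight_vanish V z : abscont (-1) 1 V ->
  sqint (fun x => V x / (1 - x ^+ 2)) -> z = 1 \/ z = -1 -> V z = 0.
Proof.
move=> Vac; set w := fun x => _ => ws zE; apply/eqP/negP => /negP Vz.
have N0 := dot_ge0 w; set N := dot w w in N0.
have c0 : 0 < `|V z| by rewrite normr_gt0.
have [d d0 Hd] := abscont_unif Vac (divr_gt0 c0 (ltr0n _ 2)).
have V2 : 0 < V z ^+ 2 by rewrite exprn_even_gt0.
(* At distance between e and 2 e from z one has |V| >= |V z| / 2 (first bound on e) and 1 - x^2 <= 4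
   e, hence w^2 >= (V z)^2 / (64 e^2). The second bound keeps these points inside the interval.
   Integrating over length e gives (V z)^2 / (64 e) >= N + 1 by the third bound, although the
   integral of w^2 is N. *)
pose e := Num.min (d / 2) (Num.min 4^-1 (V z ^+ 2 / (64 * (N + 1)))).
have N1 : 0 < N + 1 by lra.
have e0 : 0 < e.
  by rewrite !lt_min invr_gt0 (divr_gt0 d0) // (divr_gt0 V2) ?mulr_gt0 //= ltr0n.
have [ed e4 eN] : [/\ e <= d / 2, e <= 4^-1 & e <= V z ^+ 2 / (64 * (N + 1))].
  by split; rewrite /e !ge_min lexx ?orbT.
suff : N + 1 <= N by lra.
have K1 : N + 1 <= (V z ^+ 2 / (64 * e ^+ 2)) * e.
  have -> : (V z ^+ 2 / (64 * e ^+ 2)) * e = V z ^+ 2 / (64 * e) by field; lra.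
  rewrite ler_pdivlMr ?mulr_gt0 //.
  by move: eN; rewrite ler_pdivlMr ?mulr_gt0 //; lra.
apply: (le_trans K1).
have main x : -1 <= x <= 1 -> `|z - x| < 2 * e -> 0 < 1 - x ^+ 2 -> 1 - x ^+ 2 <= 4 * e ->
    V z ^+ 2 / (64 * e ^+ 2) <= w x ^+ 2.
  move=> xI zx D0 D4.
  have zI : -1 <= z <= 1 by case: zE => ->; rewrite lexx ?ltW // ltN11.
  have : `|V z - V x| < `|V z| / 2 by apply: Hd => //; lra.
  move=> Vzx; have Vx : `|V z| / 2 <= `|V x|.
    have := ler_normD (V z - V x) (V x); rewrite subrK; lra.
  have -> : V z ^+ 2 / (64 * e ^+ 2) = (`|V z| / 2 / (4 * e)) ^+ 2.
    rewrite !expr_div_n real_normK ?num_real //; field; lra.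
  rewrite -[w x ^+ 2]real_normK ?num_real // lerXn2r ?nnegrE //.
    by rewrite !divr_ge0 // mulr_ge0 // ltW.
  rewrite /w normrM normfV (gtr0_norm D0) ler_pM //.
  - by rewrite invr_ge0 mulr_ge0 // ltW.
  - by rewrite lef_pV2 ?posrE // mulr_gt0.
case: zE => zE; rewrite zE in main *.
- have -> : e = (1 - e) - (1 - 2 * e) by ring.
  rewrite [X in _ / (64 * X ^+ 2)](_ : _ = e); last by ring.
  apply: sqint_lower_bound => //; try lra.
  move=> x x1 x2; apply: main; [lra|rewrite gtr0_norm; lra|nra|nra].
- have -> : e = (-1 + 2 * e) - (-1 + e) by ring.
  rewrite [X in _ / (64 * X ^+ 2)](_ : _ = e); last by ring.
  apply: sqint_lower_bound => //; try lra.
  move=> x x1 x2; apply: main; [lra|rewrite ltr0_norm; lra|nra|nra].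
Qed.

(** * The operator domain and integration by parts *)

Definition supp u : Prop := forall x, ~~ (-1 <= x <= 1) -> u x = 0.

(* The real and imaginary parts of elements of D(T) and W: see [dom_T], [WP]. *)
Record ddom u : Prop := DDom {
  ddom_regular : [/\ supp u, abscont (-1) 1 u, abscont_loc (derv u)
    & abscont_loc (derv (derv u))];
  ddom_sqint : [/\ sqint (fun x => (1 - x ^+ 2) * derv (derv (derv u)) x),
      sqint (fun x => Num.sqrt (1 - x ^+ 2) * derv (derv u) x) & sqint (derv u)] }.

Record wspace u : Prop := WSpace {
  wspace_supp : supp u;
  wspace_abscont : abscont (-1) 1 u;
  wspace_sqint : sqint (derv u) }.

Lemma wspace_primitive u : abscont (-1) 1 u -> primitive_on (-1) 1 (derv u) u.
Proof. by move=> uac; have [] := abscont_ftc ltN11 uac. Qed.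

Lemma ddom_derivable u x : ddom u -> I x ->
  isd u x (derv u x) /\ isd (derv u) x (derv (derv u) x).
Proof.
move=> [[_ uac u1 u2] _] Ix; split; apply: isd_derive1.
  exact: abscont_loc_derivable (abscont_locW uac) (abscont_loc_continuous u1 Ix) Ix.
exact: abscont_loc_derivable u1 (abscont_loc_continuous u2 Ix) Ix.
Qed.

Lemma ddom_sqint2 u : ddom u -> sqint (derv (derv u)).
Proof. by move=> [[_ _ _ u2] [s3 s2 _]]; exact: sqint_of_weighted. Qed.

Lemma sqint_bounded_poly M u v : abscont_loc u -> (forall x, I x -> `|u x| <= M) ->
  sqint v -> sqint (fun x => u x * v x).
Proof. by move=> uac; apply: sqint_mul_bounded; exact: abscont_loc_measurable. Qed.

Lemma sqint_mul_2x v : sqint v -> sqint (fun x => - (2 * x) * v x).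
Proof.
move=> vs; apply: (@sqint_bounded_poly 2 (fun x => - (2 * x)) _ _ _ vs).
  move=> a b _ ab _; apply: (abscont_eq (u := fun x => -2 * x)).
    by move=> x _; ring.
  exact: abscontZ ab (abscont_id _ _).
by move=> x /IooP[? ?]; rewrite ler_norml; apply/andP; split; lra.
Qed.

(** The flux has the square integrable derivative (1 - x^2) u''' - 2 x u'', so it extends to the end
    points. It vanishes there by [sqint_div_weight_vanish], since its quotient by 1 - x^2 is u''. *)
Lemma ddom_flux u : ddom u -> exists F, [/\ abscont (-1) 1 F, sqint (derv F),
  F (-1) = 0, F 1 = 0 & forall x, I x -> F x = (1 - x ^+ 2) * derv (derv u) x].
Proof.
move=> du; have s2 := ddom_sqint2 du; have [[_ _ _ u2] [s3 _ _]] := du.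
pose f x := (1 - x ^+ 2) * derv (derv u) x.
have fac : abscont_loc f by exact: abscont_locM abscont_loc_weight u2.
have fs : sqint (derv f).
  apply: (sqint_ae (u := fun x => (1 - x ^+ 2) * derv (derv (derv u)) x +
      - (2 * x) * derv (derv u) x)).
  - exact: abscont_loc_measurable_derive1.
  - apply: ae_imp (abscont_loc_ae u2) => x Hx Ix.
    by rewrite (derive1_isd (isdM (isd_weight x) (isd_derive1 (Hx Ix)))); exact: addrC.
  - exact: sqintD s3 (sqint_mul_2x s2).
have [F [Fac pF FE]] := abscont_extend fac fs.
have F1 z : z = 1 \/ z = -1 -> F z = 0.
  apply: sqint_div_weight_vanish => //; apply: sqint_ae s2.
    exact: abscont_loc_measurable (abscont_locM (abscont_locW Fac) abscont_loc_weightV).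
  apply/aeW => x Ix; rewrite FE // /f mulrC mulKf // gt_eqF //; exact: weight_gt0.
exists F; split; [exact: Fac| |by apply: F1; right|by apply: F1; left|exact: FE].
apply: sqint_ae fs; first exact: abscont_loc_measurable_derive1 (abscont_locW Fac).
by apply/aeW => x Ix; apply: (derive1_eq_on _ Ix) => y Iy; rewrite FE.
Qed.

(** u'' is square integrable, so u' extends absolutely continuously to [-1, 1]. In [ddom_parts] this
    extension is integrated by parts against a flux. *)
Lemma ddom_derive1_extend u : ddom u -> exists G, [/\ abscont (-1) 1 G,
  forall x, I x -> G x = derv u x & forall x, I x -> derv G x = derv (derv u) x].
Proof.
move=> du; have [[_ _ u1 _] _] := du.
have [G [Gac pG GE]] := abscont_extend u1 (ddom_sqint2 du).
by exists G; split => // x Ix; apply: derive1_eq_on.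
Qed.

Lemma abscont_parts a b u v : a < b -> abscont a b u -> abscont a b v ->
  mu.-integrable `]a, b[ (EFin \o (fun x => derv u x * v x + u x * derv v x)) /\
  \int[mu]_(x in `]a, b[) (derv u x * v x + u x * derv v x) =
  u b * v b - u a * v a.
Proof.
move=> ab uac vac; have uvac := abscontM (ltW ab) uac vac.
have [[dint dE] dae] := abscont_ftc ab uvac.
have [_ uae] := abscont_ftc ab uac; have [_ vae] := abscont_ftc ab vac.
have mW w : abscont a b w -> measurable_fun `]a, b[ (derv w).
  by move=> wac; apply: measurable_derive1; exact: abscont_continuous_in.
have mW' w : abscont a b w -> measurable_fun `]a, b[ w.
  move=> wac; apply: open_continuous_measurable_fun; first exact: itv_open.
  by move=> x; rewrite inE => xab; apply: abscont_continuous_in wac _ _.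
have mexp : measurable_fun `]a, b[ (fun x => derv u x * v x + u x * derv v x).
  apply: measurable_funD; apply: measurable_funM;
    [exact: mW|exact: mW'|exact: mW'|exact: mW].
have aeE : ae_eq mu `]a, b[%classic (EFin \o derv (fun x => u x * v x))
    (EFin \o (fun x => derv u x * v x + u x * derv v x)).
  apply: ae_imp2 uae vae => x ux vx xab /=.
  by rewrite (derive1_isd (isdM (isd_derive1 (ux xab)) (isd_derive1 (vx xab)))).
split.
  by apply: integrable_ae_eq dint mexp _; apply: ae_imp aeE => x + xab => /(_ xab) [].
rewrite -(dE a b) ?lexx ?ltW // /Rintegral; congr fine; apply/esym/ae_eq_integral => //.
- by apply/measurable_EFinP; exact: mW.
- exact/measurable_EFinP.
Qed.

Lemma ddom_parts u v F : ddom u -> ddom v -> abscont (-1) 1 F -> sqint (derv F) ->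
  F (-1) = 0 -> F 1 = 0 -> (forall x, I x -> F x = (1 - x ^+ 2) * derv (derv u) x) ->
  dot (derv F) (derv v) =
    - \int[mu]_(x in I) ((1 - x ^+ 2) * (derv (derv u) x * derv (derv v) x)).
Proof.
move=> du dv Fac Fs Fa Fb FE; have [G [Gac GE G1E]] := ddom_derive1_extend dv.
have [_] := abscont_parts ltN11 Fac Gac.
rewrite Fa Fb !mul0r subrr => H; apply/eqP; rewrite -subr_eq0 opprK; apply/eqP.
have s1v : sqint (derv v) by case: dv => _ [].
have s2u := ddom_sqint2 du; have s2v := ddom_sqint2 dv.
have sD : sqint (fun x => (1 - x ^+ 2) * derv (derv u) x).
  apply: (@sqint_bounded_poly 1 (fun x => 1 - x ^+ 2) _ _ _ s2u); first exact: abscont_loc_weight.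
  by move=> x Ix; have := weight_gt0 Ix => ?; rewrite gtr0_norm //; have := sqr_ge0 x; lra.
rewrite -H dotE -RintegralD; last 3 first.
- exact: mIoo.
- exact: sqint_integrableM Fs s1v.
- have := sqint_integrableM sD s2v; congr (_.-integrable _ _).
  by apply/funext => x /=; rewrite mulrA.
apply: eq_Rintegral => x; rewrite inE => Ix.
by rewrite GE // G1E // FE // mulrA.
Qed.

End Domain.

(** * The operator on real functions *)

Section RealOperator.
Context {R : realType}.
Implicit Types (a b x y e d c k : R) (u v w g h F : R -> R).
Local Notation mu := (@lebesgue_measure R).
Local Notation I := (@Ioo R).
Local Notation isd u x du := (is_derive (x : R) (1 : R) (u : R -> R) (du : R)).

Definition cext u : R -> R := fun x =>
  if -1 < x < 1 then u x
  else if x == -1 then lim (u y @[y --> (-1)^'+])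
  else if x == 1 then lim (u y @[y --> 1^'-])
  else 0.

Lemma cext_supp u : supp (cext u).
Proof.
move=> x nx; rewrite /cext; case: ifPn => [/andP[/ltW h1 /ltW h2]|_].
  by rewrite h1 h2 in nx.
case: eqVneq => [E|_]; first by rewrite E lexx (ltW ltN11) in nx.
by case: eqVneq => [E|//]; rewrite E lexx (ltW ltN11) in nx.
Qed.

Lemma cext_Ioo u x : I x -> cext u x = u x.
Proof. by move=> /IooP[h1 h2]; rewrite /cext h1 h2. Qed.

Lemma cext_eq u V x : abscont (-1) 1 V -> (forall y, I y -> V y = u y) ->
  -1 <= x <= 1 -> cext u x = V x.
Proof.
move=> Vac VE /andP[h1 h2]; rewrite /cext.
case: ifPn => [/andP[? ?]|nI]; first by rewrite VE //; apply/IooP.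
case: eqVneq => [->|n1].
  apply/cvg_lim => //; apply: cvg_trans (abscont_cvg_right ltN11 Vac).
  apply: near_eq_cvg; near=> y; rewrite VE //; apply/IooP; split.
    by near: y; exact: nbhs_right_gt.
  by near: y; apply: nbhs_right_lt; exact: ltN11.
case: eqVneq => [->|n2].
  apply/cvg_lim => //; apply: cvg_trans (abscont_cvg_left ltN11 Vac).
  apply: near_eq_cvg; near=> y; rewrite VE //; apply/IooP; split.
    by near: y; apply: nbhs_left_gt; exact: ltN11.
  by near: y; exact: nbhs_left_lt.
by rewrite !lt_neqAle eq_sym n1 n2 h1 h2 in nI.
Unshelve. all: by end_near. Qed.

Lemma cext_supported u V : abscont (-1) 1 V -> supp V -> (forall y, I y -> V y = u y) ->
  cext u = V.
Proof.
move=> Vac Vs VE; apply/funext => x; case: (boolP (-1 <= x <= 1)) => xI.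
  exact: cext_eq.
by rewrite Vs // cext_supp.
Qed.

Lemma sqint_eq u v : (forall x, I x -> u x = v x) -> sqint u -> sqint v.
Proof.
move=> uv us; apply: (sqint_ae _ _ us); last exact/aeW.
apply: (eq_measurable_fun u) (sqint_measurable us) => x; rewrite inE; exact: uv.
Qed.

Lemma sqint_cst c : sqint (cst c : R -> R).
Proof.
by apply: (@sqint_bounded _ `|c|); [exact: measurable_cst|move=> x _].
Qed.

Lemma abscont_extend_cext u : abscont_loc u -> sqint (derv u) -> abscont (-1) 1 (cext u).
Proof.
move=> ua us; have [V [Vac _ VE]] := abscont_extend ua us.
by apply: (abscont_eq _ Vac) => x xI; rewrite (cext_eq Vac VE xI).
Qed.

Lemma ddom_cext u : abscont_loc u -> abscont_loc (derv u) ->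
  abscont_loc (derv (derv u)) ->
  sqint (fun x => (1 - x ^+ 2) * derv (derv (derv u)) x) ->
  sqint (fun x => Num.sqrt (1 - x ^+ 2) * derv (derv u) x) ->
  sqint (derv u) -> ddom (cext u).
Proof.
move=> u0 u1 u2 s3 s2 s1.
have E0 x : I x -> u x = cext u x by move=> Ix; rewrite cext_Ioo.
have E1 x : I x -> derv u x = derv (cext u) x by exact: derive1_eq_on.
have E2 x : I x -> derv (derv u) x = derv (derv (cext u)) x.
  exact: derive1_eq_on.
have E3 x : I x -> derv (derv (derv u)) x = derv (derv (derv (cext u))) x.
  exact: derive1_eq_on.
split; split.
- exact: cext_supp.
- exact: abscont_extend_cext.
- exact: abscont_loc_eq E1 u1.
- exact: abscont_loc_eq E2 u2.
- by apply: sqint_eq s3 => x Ix; rewrite E3.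
- by apply: sqint_eq s2 => x Ix; rewrite E2.
- exact: sqint_eq E1 s1.
Qed.

Lemma ddom_wspace u : ddom u -> wspace u.
Proof. by move=> [[su uac _ _] [_ _ s1]]. Qed.

Lemma abscont_lin a b c u v : a <= b -> abscont a b u -> abscont a b v ->
  abscont a b (fun x => c * u x + v x).
Proof. by move=> ab ua va; apply: abscontD va; exact: abscontZ. Qed.

Lemma isd_lin c u v x du dv : isd u x du -> isd v x dv ->
  isd (fun y => c * u y + v y) x (c * du + dv).
Proof.
move=> hu hv; have := isdD (isdM (isd_cst c x) hu) hv.
by move=> H; apply: isd_eq H _; rewrite mul0r add0r.
Qed.

Lemma derive1_lin_ae c u v : abscont_loc u -> abscont_loc v ->
  {ae mu, forall x, I x -> derv (fun y => c * u y + v y) x = c * derv u x + derv v x}.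
Proof.
move=> ua va; apply: ae_imp2 (abscont_loc_ae ua) (abscont_loc_ae va) => x Hu Hv Ix.
exact: derive1_isd (isd_lin c (isd_derive1 (Hu Ix)) (isd_derive1 (Hv Ix))).
Qed.

Lemma abscont_loc_lin c u v : abscont_loc u -> abscont_loc v ->
  abscont_loc (fun x => c * u x + v x).
Proof.
by move=> ua va a b a1 ab b1; exact: (abscont_lin c ab (ua _ _ a1 ab b1) (va _ _ a1 ab b1)).
Qed.

Lemma sqint_lin c u v : sqint u -> sqint v -> sqint (fun x => c * u x + v x).
Proof. by move=> us vs; exact: sqintD (sqintZ c us) vs. Qed.

Lemma sqint_derive1_lin c u v : abscont_loc u -> abscont_loc v ->
  sqint (derv u) -> sqint (derv v) -> sqint (derv (fun x => c * u x + v x)).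
Proof.
move=> ua va us vs; apply: sqint_ae (sqint_lin c us vs).
  exact: abscont_loc_measurable_derive1 (abscont_loc_lin c ua va).
by apply: ae_imp (derive1_lin_ae c ua va) => x H Ix; rewrite H.
Qed.

Lemma wspace_lin c u v : wspace u -> wspace v -> wspace (fun x => c * u x + v x).
Proof.
move=> [su ua us] [sv va vs]; split.
- by move=> x nx; rewrite su // sv // mulr0 addr0.
- exact: abscont_lin (ltW ltN11) ua va.
- exact: sqint_derive1_lin (abscont_locW ua) (abscont_locW va) us vs.
Qed.

(** On the domain the first two derivatives exist at every interior point, so linearity holds
    everywhere and can be differentiated again, unlike [derive1_lin_ae]. *)
Lemma ddom_derv_lin c u v : ddom u -> ddom v ->
  forall x, I x -> c * derv u x + derv v x = derv (fun x => c * u x + v x) x.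
Proof.
move=> du dv x Ix; have [hu _] := ddom_derivable du Ix; have [hv _] := ddom_derivable dv Ix.
by rewrite (derive1_isd (isd_lin c hu hv)).
Qed.

Lemma ddom_derv2_lin c u v : ddom u -> ddom v -> forall x, I x ->
  c * derv (derv u) x + derv (derv v) x = derv (derv (fun x => c * u x + v x)) x.
Proof.
move=> du dv x Ix; have [_ hu] := ddom_derivable du Ix; have [_ hv] := ddom_derivable dv Ix.
by rewrite -(derive1_eq_on (ddom_derv_lin c du dv) Ix) (derive1_isd (isd_lin c hu hv)).
Qed.

Lemma ddom_lin c u v : ddom u -> ddom v -> ddom (fun x => c * u x + v x).
Proof.
move=> du dv; have [su ua us] := wspace_lin c (ddom_wspace du) (ddom_wspace dv).
have [[_ _ u1 u2] [su3 su2 su1]] := du; have [[_ _ v1 v2] [sv3 sv2 sv1]] := dv.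
have E1 := ddom_derv_lin c du dv; have E2 := ddom_derv2_lin c du dv.
have E3 x : I x -> derv (fun x => c * derv (derv u) x + derv (derv v) x) x =
    derv (derv (derv (fun x => c * u x + v x))) x.
  by move=> Ix; rewrite (derive1_eq_on E2 Ix).
have l2 : abscont_loc (derv (derv (fun x => c * u x + v x))).
  exact: abscont_loc_eq E2 (abscont_loc_lin c u2 v2).
split; split; [exact: su|exact: ua| |exact: l2| | |exact: us].
- exact: abscont_loc_eq E1 (abscont_loc_lin c u1 v1).
- apply: sqint_ae (sqint_lin c su3 sv3).
    apply: measurable_funM; first exact: measurable_weight.
    exact: abscont_loc_measurable_derive1.
  apply: ae_imp (derive1_lin_ae c u2 v2) => x H Ix.
  rewrite -(E3 x Ix) (H Ix); move: (derv _ x) (derv _ x) (1 - _) => p q r; ring.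
- apply: sqint_eq (sqint_lin c su2 sv2) => x Ix.
  rewrite -(E2 x Ix); move: (derv _ x) (derv _ x) (Num.sqrt _) => p q r; ring.
Qed.

Lemma ddom_of_const_derive1 u c : wspace u -> (forall x, I x -> derv u x = c) -> ddom u.
Proof.
move=> [su ua us] uc.
have E1 x : I x -> cst c x = derv u x by move=> Ix; rewrite uc.
have E2 x : I x -> cst 0 x = derv (derv u) x.
  by move=> Ix; rewrite -(derive1_eq_on E1 Ix) (derive1_isd (isd_cst c x)).
have E3 x : I x -> cst 0 x = derv (derv (derv u)) x.
  by move=> Ix; rewrite -(derive1_eq_on E2 Ix) (derive1_isd (isd_cst 0 x)).
have lc d : abscont_loc (cst d : R -> R) by move=> a b _ _ _; exact: abscont_cst.
split; split; [exact: su|exact: ua|exact: abscont_loc_eq E1 (lc c)|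
  exact: abscont_loc_eq E2 (lc 0)| | |exact: us].
- by apply: sqint_eq sqint0 => x Ix; rewrite -E3 //= mulr0.
- by apply: sqint_eq sqint0 => x Ix; rewrite -E2 //= mulr0.
Qed.

Definition affine a b : R -> R := fun x => if -1 <= x <= 1 then a + b * x else 0.

Lemma affine_derive1 a b x : I x -> derv (affine a b) x = b.
Proof.
move=> Ix; rewrite -(@derive1_eq_on _ (fun y => b * y + a) _ x) //.
  by rewrite (derive1_isd (isd_lin b (isd_id x) (isd_cst a x))) mulr1 addr0.
by move=> y /IooP[h1 h2]; rewrite /affine !ltW //= addrC.
Qed.

Lemma affine_wspace a b : wspace (affine a b).
Proof.
split.
- by move=> x /negbTE nx; rewrite /affine nx.
- apply: (abscont_eq (u := fun x => b * x + a)).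
    by move=> x xI; rewrite /affine xI addrC.
  exact: abscont_lin (ltW ltN11) (abscont_id _ _) (abscont_cst _ _ _).
- by apply: sqint_eq (sqint_cst b) => x Ix; rewrite affine_derive1.
Qed.

Lemma affine00 : affine 0 0 = cst 0.
Proof. by apply/funext => x; rewrite /affine mul0r addr0; case: ifP. Qed.

Lemma ddom_affine a b : ddom (affine a b).
Proof. by apply: (@ddom_of_const_derive1 _ b); [exact: affine_wspace|exact: affine_derive1]. Qed.

Lemma continuous_sqrt_weight : {in `]-1, 1[, continuous (fun x => Num.sqrt (1 - x ^+ 2) : R)}.
Proof.
move=> x Ix; apply: (@continuous_comp _ _ _ (fun x => 1 - x ^+ 2) Num.sqrt).
  exact: abscont_loc_continuous abscont_loc_weight _ Ix.
exact: sqrt_continuous.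
Qed.

Lemma sqint_sqrt_weight h : sqint h -> sqint (fun x => Num.sqrt (1 - x ^+ 2) * h x).
Proof.
apply: (@sqint_mul_bounded _ 1 (fun x => Num.sqrt (1 - x ^+ 2))).
  apply: open_continuous_measurable_fun; first exact: itv_open.
  by move=> x; rewrite inE => Ix; exact: continuous_sqrt_weight.
move=> x Ix; rewrite ger0_norm ?sqrtr_ge0 // -[leRHS]sqrtr1 ler_sqrt //.
by have := sqr_ge0 x; lra.
Qed.

(** By [vanishing_sqr_le] the quotient is even bounded. This supplies the last condition in the
    definition of [V3]. *)
Lemma wspace_sqint_weighted u : wspace u -> u (-1) = 0 -> u 1 = 0 ->
  sqint (fun x => (Num.sqrt (1 - x ^+ 2))^-1 * u x).
Proof.
move=> [su ua us] ua0 ub0; have N0 := dot_ge0 (derv u).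
have mV : measurable_fun I (fun x => (Num.sqrt (1 - x ^+ 2))^-1 : R).
  apply: open_continuous_measurable_fun; first exact: itv_open.
  move=> x; rewrite inE => Ix; have D0 := weight_gt0 Ix.
  by apply: cvgV; [rewrite gt_eqF // sqrtr_gt0|exact: continuous_sqrt_weight].
apply: (sqint_dom (u := cst (Num.sqrt (dot (derv u) (derv u)))) (v := cst 0)).
- by apply: measurable_funM mV _; exact: abscont_loc_measurable (abscont_locW ua).
- exact: sqint_cst.
- exact: sqint_cst.
- move=> x Ix; have D0 := weight_gt0 Ix; rewrite /= expr0n addr0 exprMn exprVn.
  rewrite !sqr_sqrtr //; last exact: ltW.
  rewrite mulrC ler_pdivrMr // mulrC.
  exact: vanishing_sqr_le (wspace_primitive ua) us ua0 ub0 Ix.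
Qed.

(** * The real form, symmetry and surjectivity *)

Definition bform u v : R :=
  2^-1 * (u (-1) * v (-1)) + 2^-1 * (u 1 * v 1) + dot (derv u) (derv v).

Lemma bformC u v : bform u v = bform v u.
Proof. by rewrite /bform dotC ![u _ * _]mulrC. Qed.

Lemma bform_lin c u v w : wspace u -> wspace v -> wspace w ->
  bform (fun x => c * u x + v x) w = c * bform u w + bform v w.
Proof.
move=> wu wv [_ _ sw]; have [_ ua us] := wu; have [_ va vs] := wv.
have -> : bform (fun x => c * u x + v x) w = 2^-1 * ((c * u (-1) + v (-1)) * w (-1)) +
    2^-1 * ((c * u 1 + v 1) * w 1) + (c * dot (derv u) (derv w) + dot (derv v) (derv w)).
  congr (_ + _); rewrite -(dotZl c us sw) -(dotDl (sqintZ c us) vs sw) !dotE.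
  have [_ la ls] := wspace_lin c wu wv.
  apply: Rintegral_ae_eq_Ioo.
  - by apply: measurable_funM; [exact: (sqint_measurable ls)|exact: (sqint_measurable sw)].
  - by apply: measurable_funM; [exact: (sqint_measurable (sqint_lin c us vs))|exact: (sqint_measurable sw)].
  - apply: ae_imp (derive1_lin_ae c (abscont_locW ua) (abscont_locW va)) => x H Ix.
    by rewrite H.
rewrite /bform; move: (dot _ _) (dot _ _) (u _) (v _) (w _) (u _) (v _) (w _).
by move=> *; ring.
Qed.

Lemma bform_ge0 u : 0 <= bform u u.
Proof.
rewrite /bform; have := dot_ge0 (derv u).
by have := sqr_ge0 (u (-1)); have := sqr_ge0 (u 1); rewrite !expr2; lra.
Qed.

Lemma bform_eq0 u : wspace u -> bform u u = 0 -> u = cst 0.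
Proof.
move=> [su ua us] B0; have d0 := dot_ge0 (derv u).
have := sqr_ge0 (u (-1)); have := sqr_ge0 (u 1); rewrite /bform -!expr2 in B0 * => p1 p2.
have u0 : u (-1) = 0 by apply/eqP; rewrite -sqrf_eq0; apply/eqP; lra.
have dd0 : dot (derv u) (derv u) = 0 by lra.
apply/funext => x /=; case: (boolP (-1 <= x <= 1)) => [/andP[x1 x2]|/su //].
have := abscont_increment_sqr (wspace_primitive ua) us (lexx _) x1 x2.
rewrite dd0 mulr0 u0 subr0 => H; apply/eqP; rewrite -sqrf_eq0 eq_le H /=.
exact: sqr_ge0.
Qed.

Lemma ddom_flux_wspace u : ddom u -> exists F, [/\ wspace F, F (-1) = 0, F 1 = 0 &
  forall x, I x -> F x = (1 - x ^+ 2) * derv (derv u) x].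
Proof.
move=> du; have [F [Fac Fs Fa Fb FE]] := ddom_flux du.
have E x : -1 <= x <= 1 -> cext F x = F x by exact: cext_eq.
have E' x : I x -> F x = cext F x by move=> Ix; rewrite cext_Ioo.
exists (cext F); split.
- split; first exact: cext_supp.
    by apply: abscont_eq Fac => x xI; rewrite E.
  by apply: sqint_eq Fs => x Ix; exact: derive1_eq_on.
- by rewrite E // N11_in.
- by rewrite E // P11_in.
- by move=> x Ix; rewrite -E' // FE.
Qed.

Definition opR k u : R -> R :=
  cext (fun x => - ((1 - x ^+ 2) * derv (derv u) x) + k * u x).

(** Once the flux is represented by a function continuous up to the end points, the limits inside
    [cext] are evaluated once and for all. *)
Lemma opRE k u F : ddom u -> wspace F ->
  (forall x, I x -> F x = (1 - x ^+ 2) * derv (derv u) x) ->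
  opR k u = (fun x => k * u x + -1 * F x).
Proof.
move=> du wF FE; have [[su ua _ _] _] := du; have [sF Fa _] := wF.
apply: cext_supported.
- apply: abscont_lin (ltW ltN11) ua _; exact: abscontZ (ltW ltN11) Fa.
- by move=> x nx; rewrite su // sF // !mulr0 addr0.
- by move=> x Ix; rewrite FE // mulN1r addrC.
Qed.

Lemma wspaceZ c u : wspace u -> wspace (fun x => c * u x).
Proof.
move=> wu; have := wspace_lin c wu (affine_wspace 0 0); rewrite affine00.
by congr wspace; apply/funext => x; rewrite addr0.
Qed.

Lemma opR_wspace k u : ddom u -> wspace (opR k u).
Proof.
move=> du; have [F [wF _ _ FE]] := ddom_flux_wspace du.
by rewrite (opRE k du wF FE); apply: wspace_lin (ddom_wspace du) (wspaceZ _ wF).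
Qed.

Lemma bform0 u : wspace u -> bform u (cst 0) = 0.
Proof.
move=> wu; have -> : cst 0 = (fun x => -1 * u x + u x).
  by apply/funext => x; rewrite mulN1r addNr.
by rewrite bformC (bform_lin _ wu wu wu) mulN1r addNr.
Qed.

Lemma bformZ c u v : wspace u -> wspace v -> bform (fun x => c * u x) v = c * bform u v.
Proof.
move=> wu wv; have w0 : wspace (cst 0 : R -> R) by rewrite -affine00; exact: affine_wspace.
rewrite -[RHS]addr0 -(bform0 wv) (bformC v) -(bform_lin _ wu w0 wv).
by congr bform; apply/funext => x; rewrite addr0.
Qed.

Lemma bform_opR k u v : ddom u -> ddom v -> bform (opR k u) v = k * bform u v +
  \int[mu]_(x in I) ((1 - x ^+ 2) * (derv (derv u) x * derv (derv v) x)).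
Proof.
move=> du dv; have [F [wF Fa Fb FE]] := ddom_flux_wspace du; have [_ Fac Fs] := wF.
have wu := ddom_wspace du; have wv := ddom_wspace dv.
rewrite (opRE k du wF FE) (bform_lin _ wu (wspaceZ _ wF) wv) (bformZ _ wF wv).
rewrite /bform Fa Fb !mul0r !mulr0 !add0r (ddom_parts du dv Fac Fs Fa Fb FE).
by rewrite mulN1r opprK.
Qed.

Lemma opR_sym k u v : ddom u -> ddom v -> bform (opR k u) v = bform u (opR k v).
Proof.
move=> du dv; rewrite [RHS]bformC (bform_opR k du dv) (bform_opR k dv du) (bformC v u).
congr (_ + _).
by apply: eq_Rintegral => x _; congr (_ * _); rewrite mulrC.
Qed.

(* Two integrations of f'' = - g / (1 - x^2), which is square integrable by
   Hardy's inequality, invert u |-> - (1 - x^2) u''. *)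
Lemma opR_surj k g : wspace g -> g (-1) = 0 -> g 1 = 0 ->
  exists f, [/\ ddom f, f (-1) = 0, f 1 = 0 & opR k f = (fun x => k * f x + g x)].
Proof.
move=> wg ga gb; have [sg gac gs] := wg; have gl := abscont_locW gac.
have pg := wspace_primitive gac.
pose q x := g x / (1 - x ^+ 2); have qs : sqint q by exact: hardy pg gs ga gb.
have ql : abscont_loc q by exact: abscont_locM gl abscont_loc_weightV.
pose h x := -1 * q x; have hs : sqint h by exact: sqintZ.
have hl : abscont_loc h by move=> a b a1 ab b1; exact: (abscontZ _ ab (ql _ _ a1 ab b1)).
pose p x := \int[mu]_(t in `]-1, x[) h t.
have pp : primitive_on (-1) 1 h p by exact: primitive_exists (sqint_integrable hs).
have pac : abscont (-1) 1 p by exact: primitive_on_abscont pp.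
have [M M0 pM] := abscont_bounded (ltW ltN11) pac.
have ps : sqint p.
  apply: (@sqint_bounded _ M); first exact: abscont_loc_measurable (abscont_locW pac).
  by move=> x /IooP[x1 x2]; rewrite pM // !ltW.
pose P x := \int[mu]_(t in `]-1, x[) p t.
have pP : primitive_on (-1) 1 p P by exact: primitive_exists (sqint_integrable ps).
have Pac : abscont (-1) 1 P by exact: primitive_on_abscont pP.
have Pa : P (-1) = 0 by rewrite /P set_itvoo0 Rintegral_set0.
(* The affine correction leaves f'' alone, preserves f(-1) = 0 and makes f(1) = P 1 + 2 c vanish. *)
pose c := - (P 1 / 2); pose f x := if -1 <= x <= 1 then P x + c * (x + 1) else 0.
have fI x : I x -> P x + c * (x + 1) = f x by move=> /IooP[x1 x2]; rewrite /f !ltW.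
have fa : f (-1) = 0 by rewrite /f lexx (ltW ltN11) Pa addNr mulr0 addr0.
have fb : f 1 = 0 by rewrite /f lexx (ltW ltN11) /c; field.
have E1 x : I x -> p x + c = derv f x.
  move=> Ix; rewrite -(derive1_eq_on fI Ix).
  have [dP PE] := primitive_on_continuous pP Ix (abscont_loc_continuous (abscont_locW pac) Ix).
  have hP : isd P x (p x) by rewrite -PE; exact: isd_derive1.
  rewrite (derive1_isd (isdD hP (isdM (isd_cst c x) (isdD (isd_id x) (isd_cst 1 x))))).
  by ring.
have E2 x : I x -> h x = derv (derv f) x.
  move=> Ix; rewrite -(derive1_eq_on E1 Ix).
  have [dp pE] := primitive_on_continuous pp Ix (abscont_loc_continuous hl Ix).
  have hp : isd p x (h x) by rewrite -pE; exact: isd_derive1.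
  by rewrite (derive1_isd (isdD hp (isd_cst c x))) addr0.
have E3 x : I x -> derv h x = derv (derv (derv f)) x by exact: derive1_eq_on.
have fac : abscont (-1) 1 f.
  apply: (abscont_eq (u := fun x => P x + (c * x + c))).
    by move=> x xI; rewrite /f xI mulrDr mulr1.
  apply: abscontD Pac _; apply: abscont_lin (ltW ltN11) (abscont_id _ _) (abscont_cst _ _ _).
have l1 : abscont_loc (derv f).
  apply: abscont_loc_eq E1 _; apply: abscont_locW.
  exact: abscontD pac (abscont_cst _ _ _).
have l2 : abscont_loc (derv (derv f)) by exact: abscont_loc_eq E2 hl.
have df : ddom f.
  split; split; [by move=> x /negbTE nx; rewrite /f nx|exact: fac|exact: l1|exact: l2| | |].
  (* Almost everywhere (1 - x^2) h' = - g' - 2 x q, where q is square integrable by [hardy]. *)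
  - apply: (sqint_ae (u := fun x => -1 * derv g x + - (2 * x) * q x)).
    + apply: measurable_funM; first exact: measurable_weight.
      exact: abscont_loc_measurable_derive1.
    + apply: ae_imp (abscont_loc_ae gl) => x Hg Ix; rewrite -E3 //.
      have D0 := weight_gt0 Ix.
      have hd := isdM (isd_cst (-1) x) (isdM (isd_derive1 (Hg Ix))
        (isdV (u := fun y => 1 - y ^+ 2) (lt0r_neq0 D0) (isd_weight x))).
      rewrite [derv h x](derive1_isd hd) /q.
      by move: (derv g x) (g x) => g' gx; field; lra.
    + exact: sqint_lin gs (sqint_mul_2x qs).
  - apply: (@sqint_eq (fun x => Num.sqrt (1 - x ^+ 2) * h x)).
      by move=> x Ix; rewrite -E2.
    exact: sqint_sqrt_weight hs.
  - exact: sqint_eq E1 (sqintD ps (sqint_cst c)).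
exists f; split; [exact: df|exact: fa|exact: fb|].
have := @opRE k f (fun x => -1 * g x) df (wspaceZ _ wg).
move=> -> => [|x Ix]; first by apply/funext => x; rewrite mulrA mulrNN mulr1 mul1r.
have D0 := weight_gt0 Ix.
by rewrite -E2 // /h /q mulrCA [(1 - _) * _]mulrC divfK // gt_eqF.
Qed.

End RealOperator.

(** * Completeness and density of polynomials *)

Section RealSpace.
Context {R : realType}.
Implicit Types (a b x y e d c : R) (u v w g h : R -> R) (p q : {poly R}).
Local Notation mu := (@lebesgue_measure R).
Local Notation I := (@Ioo R).

Lemma wspaceB u v : wspace u -> wspace v -> wspace (fun x => u x - v x).
Proof.
move=> wu wv; have := wspace_lin (-1) wv wu; congr wspace.
by apply/funext => x; rewrite mulN1r addrC.
Qed.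

Lemma derv_sub_ae u v : abscont (-1) 1 u -> abscont (-1) 1 v ->
  {ae mu, forall x, I x -> derv (fun y => u y - v y) x = derv u x - derv v x}.
Proof.
move=> ua va; have := derive1_lin_ae (-1) (abscont_locW va) (abscont_locW ua).
apply: ae_imp => x H Ix; have := H Ix; rewrite mulN1r addrC => <-.
by congr derv; apply/funext => y; rewrite mulN1r addrC.
Qed.

(** The value at 1 is controlled by the value at -1 and the derivative: (g(1) - g(-1))^2 <= 2
    [dot (derv g) (derv g)]. *)
Lemma bform_le g : wspace g -> bform g g <= 2 * g (-1) ^+ 2 + 3 * dot (derv g) (derv g).
Proof.
move=> [sg ga gs]; have := abscont_increment_sqr (wspace_primitive ga) gs (lexx _) (ltW ltN11) (lexx _).
rewrite /bform -!expr2; move: (dot _ _) (dot_ge0 (derv g)) => D D0 H.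
have E2 : g 1 ^+ 2 <= 2 * g (-1) ^+ 2 + 2 * (g 1 - g (-1)) ^+ 2.
  rewrite -subr_ge0 (_ : _ - _ = (2 * g (-1) - g 1) ^+ 2); first exact: sqr_ge0.
  by move: (g 1) (g (-1)) => s t; ring.
have := sqr_ge0 (g (-1)); lra.
Qed.

Lemma dot_le_bform g : dot (derv g) (derv g) <= bform g g.
Proof. by rewrite /bform -!expr2; have := sqr_ge0 (g 1); have := sqr_ge0 (g (-1)); lra. Qed.

Lemma sqr_le_bform g : g (-1) ^+ 2 <= 2 * bform g g.
Proof.
rewrite /bform -!expr2; have := dot_ge0 (derv g); have := sqr_ge0 (g 1); lra.
Qed.

Lemma dot_ae u u' v v' : sqint u -> sqint u' -> sqint v -> sqint v' ->
  {ae mu, forall x, I x -> u x = u' x} -> {ae mu, forall x, I x -> v x = v' x} ->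
  dot u v = dot u' v'.
Proof.
move=> us us' vs vs' uu vv; rewrite !dotE; apply: Rintegral_ae_eq_Ioo.
- by apply: measurable_funM; exact: sqint_measurable.
- by apply: measurable_funM; exact: sqint_measurable.
- by apply: ae_imp2 uu vv => x h1 h2 Ix; rewrite h1 // h2.
Qed.

(** The map from u to (u(-1), u') identifies the space with R x L2, with equivalent norms by
    [bform_le], [sqr_le_bform] and [dot_le_bform], so completeness is inherited from
    [sqint_complete]. *)
Lemma wspace_complete (u : nat -> R -> R) : (forall n, wspace (u n)) ->
  (forall e, 0 < e -> exists N : nat, forall m n, (N <= m)%N -> (N <= n)%N ->
     bform (fun x => u m x - u n x) (fun x => u m x - u n x) < e) ->
  exists2 v, wspace v & forall e, 0 < e -> exists N : nat, forall n, (N <= n)%N ->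
     bform (fun x => u n x - v x) (fun x => u n x - v x) < e.
Proof.
move=> wu uC; pose du n := derv (u n).
have dus n : sqint (du n) by case: (wu n).
have dE m n : dot (fun x => du m x - du n x) (fun x => du m x - du n x) =
    dot (derv (fun x => u m x - u n x)) (derv (fun x => u m x - u n x)).
  have [_ _ s] := wspaceB (wu m) (wu n); have [_ am _] := wu m; have [_ an _] := wu n.
  have := derv_sub_ae am an => ae; have s' := sqintB (dus m) (dus n).
  by symmetry; apply: dot_ae.
have [|w ws wl] := sqint_complete dus.
  move=> e e0; have [N NP] := uC e e0; exists N => m n Nm Nn.
  by rewrite dE; apply: le_lt_trans (NP m n Nm Nn); exact: dot_le_bform.
have [al ual] : exists al : R, u n (-1) @[n --> \oo] --> al.
  apply/cvg_ex/cauchy_cvgP/cauchy_exP => e e0.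
  have [|N NP] := uC (e ^+ 2 / 4); first by rewrite divr_gt0 // exprn_gt0.
  exists (u N (-1)); exists N => // n /= Nn; rewrite /ball /=.
  have := sqr_le_bform (fun x => u N x - u n x); have := NP N n (leqnn _) Nn.
  move: (bform _ _) => B B1 B2.
  have : (u N (-1) - u n (-1)) ^+ 2 < e ^+ 2 by have := exprn_gt0 2 e0; lra.
  by rewrite ltr_norml => H; apply/andP; split; nra.
pose P x := \int[mu]_(t in `]-1, x[) w t.
have pP : primitive_on (-1) 1 w P by exact: primitive_exists (sqint_integrable ws).
pose v x := if -1 <= x <= 1 then al + P x else 0.
have pv : primitive_on (-1) 1 w v.
  case: pP => wi PE; split => // x y x1 xy y1; rewrite PE // /v.
  by rewrite x1 y1 (le_trans xy y1) (le_trans x1 xy) /=; ring.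
have va := primitive_on_abscont pv.
have vw : {ae mu, forall x, I x -> derv v x = w x}.
  by apply: ae_imp (primitive_on_ae pv) => x H Ix; have [_ ->] := H Ix.
have vs : sqint (derv v).
  apply: sqint_ae ws; first exact: abscont_loc_measurable_derive1 (abscont_locW va).
  by apply: ae_imp vw => x H Ix; rewrite H.
have wv : wspace v by split => // x /negbTE nx; rewrite /v nx.
have v1 : v (-1) = al by rewrite /v lexx (ltW ltN11) /P set_itvoo0 Rintegral_set0 addr0.
exists v => // e e0.
have [N1 P1] : exists N : nat, forall n, (N <= n)%N -> (u n (-1) - v (-1)) ^+ 2 < e / 8.
  have /cvgrPdist_lt := ual; move=> /(_ (Num.sqrt (e / 8))) [|N _ NP].
    by rewrite sqrtr_gt0 divr_gt0.
  exists N => n Nn; have := NP n Nn; rewrite v1 /= distrC => H.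
  rewrite -[X in _ < X]sqr_sqrtr; last by rewrite divr_ge0 // ltW.
  by move: H; rewrite ltr_norml => /andP[h1 h2]; nra.
have [|N2 P2] := wl (e / 8); first by rewrite divr_gt0.
exists (maxn N1 N2) => n; rewrite geq_max => /andP[n1 n2].
have := P1 n n1; have := P2 n n2; have := bform_le (wspaceB (wu n) wv).
suff -> : dot (derv (fun x => u n x - v x)) (derv (fun x => u n x - v x)) =
    dot (fun x => du n x - w x) (fun x => du n x - w x).
  by move: (dot _ _) (bform _ _) => D B; move: (_ ^+ 2) => t; lra.
have [_ _ s] := wspaceB (wu n) wv; have [_ an _] := wu n.
have ae : {ae mu, forall x, I x -> derv (fun y => u n y - v y) x = du n x - w x}.
  by apply: ae_imp2 (derv_sub_ae an va) vw => x h1 h2 Ix; rewrite h1 // h2.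
have s' := sqintB (dus n) ws.
by apply: dot_ae.
Qed.

(** * Totality of the polynomials *)

Definition rpoly p : R -> R := fun x => if -1 <= x <= 1 then p.[x] else 0.

Lemma rpolyE p x : -1 <= x <= 1 -> rpoly p x = p.[x].
Proof. by rewrite /rpoly => ->. Qed.

Lemma rpoly_Ioo p x : I x -> rpoly p x = p.[x].
Proof. by move=> /IooP[? ?]; apply: rpolyE; rewrite !ltW. Qed.

Lemma rpoly_derv p x : I x -> derv (rpoly p) x = p^`().[x].
Proof.
move=> Ix; rewrite -(@derive1_eq_on _ (horner p) _ x) //.
  by rewrite dervE -derivE.
by move=> y Iy; rewrite rpoly_Ioo.
Qed.

Lemma abscont_horner a b p : a <= b -> abscont a b (horner p).
Proof.
move=> ab; elim/poly_ind: p => [|p c IH].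
  by apply: (abscont_eq _ (abscont_cst _ _ 0)) => x _; rewrite horner0.
apply: (abscont_eq (u := fun x => p.[x] * x + c)).
  by move=> x _; rewrite hornerMXaddC.
by apply: abscontD (abscont_cst _ _ _); apply: abscontM => //; exact: abscont_id.
Qed.

Lemma sqint_horner p : sqint (horner p).
Proof.
have pa := abscont_horner p (ltW ltN11); have [M M0 pM] := abscont_bounded (ltW ltN11) pa.
apply: (@sqint_bounded _ M); first exact: abscont_loc_measurable (abscont_locW pa).
by move=> x /IooP[? ?]; rewrite pM // !ltW.
Qed.

Lemma rpoly_wspace p : wspace (rpoly p).
Proof.
split.
- by move=> x /negbTE nx; rewrite /rpoly nx.
- by apply: abscont_eq (abscont_horner p (ltW ltN11)) => x xI; rewrite rpolyE.
- by apply: sqint_eq (sqint_horner p^`()) => x Ix; rewrite rpoly_derv.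
Qed.

Lemma poly_primitive q : exists p, p^`() = q.
Proof.
exists (\sum_(i < size q) (q`_i / i.+1%:R) *: 'X^(i.+1))%R.
rewrite raddf_sum /= -[RHS]coefK poly_def; apply: eq_bigr => i _.
by rewrite derivZ derivXn /= -scalerMnr scalerMnl -mulr_natr divfK // pnatr_eq0.
Qed.

Lemma bernoulli_le (t : R) n : 0 <= t -> 1 + n%:R * (t - 1) <= t ^+ n.
Proof.
move=> t0; elim: n => [|n IH]; first by rewrite mul0r addr0 expr0.
rewrite exprS; have := ler_wpM2l t0 IH; apply: le_trans.
rewrite -natr1; have : 0 <= n%:R * (t - 1) ^+ 2 by rewrite mulr_ge0 ?sqr_ge0.
by move: (n%:R : R) => k; rewrite expr2; lra.
Qed.

(** The slope 1/4 keeps y = 1/2 + (x - c)/4 inside ]0, 1[ for x and c in ]-1, 1[, and sends c to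
    1/2, the threshold at which (1 - y^n)^(2^n) switches from limit 1 to limit 0. *)
Definition cutoff c n : {poly R} :=
  (1 - (4^-1 *: 'X + (2^-1 - c / 4)%:P) ^+ n) ^+ (2 ^ n).

Lemma horner_cutoff c n x : (cutoff c n).[x] = (1 - (2^-1 + (x - c) / 4) ^+ n) ^+ (2 ^ n).
Proof.
rewrite /cutoff horner_exp hornerD hornerN horner_exp hornerD hornerZ hornerX !hornerC.
by congr ((_ - _ ^+ _) ^+ _); ring.
Qed.

Lemma cutoff_bound c n x : 0 <= 2^-1 + (x - c) / 4 <= 1 -> `|(cutoff c n).[x]| <= 1.
Proof.
rewrite horner_cutoff; move: (2^-1 + _) => y /andP[y0 y1].
have := exprn_ge0 n y0; have := exprn_ile1 n y0 y1; move: (y ^+ n) => a a1 a0.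
by rewrite ger0_norm; [apply: exprn_ile1|apply: exprn_ge0]; lra.
Qed.

(* Bernoulli's inequality gives 1 - (2y)^n <= (1 - y^n)^(2^n) <= (2y)^(-n). *)
Lemma cutoff_cvg c x : 0 < 2^-1 + (x - c) / 4 < 1 -> x != c ->
  (cutoff c n).[x] @[n --> \oo] --> ((x < c)%R%:R : R).
Proof.
move=> yI xc.
have -> : (fun n => (cutoff c n).[x]) =
    (fun n => (1 - (2^-1 + (x - c) / 4) ^+ n) ^+ (2 ^ n)).
  by apply/funext => n; rewrite horner_cutoff.
have : (x < c) = (2^-1 + (x - c) / 4 < 2^-1) by apply/idP/idP => ?; lra.
move=> ->; have : 2^-1 + (x - c) / 4 != 2^-1 by apply: contra_neq xc => ?; lra.
move: (2^-1 + _) yI => y /andP[y0 y1] y2.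
have N2 n : ((2 ^ n)%:R : R) * y ^+ n = (2 * y) ^+ n by rewrite natrX exprMn.
have a01 n : 0 <= y ^+ n <= 1 by rewrite exprn_ge0 ?exprn_ile1 // ltW.
have [ylt|ygt|/eqP] := ltgtP y 2^-1; last by rewrite (negbTE y2).
- apply: (@squeeze_cvgr _ _ _ _ (fun n => 1 - (2 * y) ^+ n) (cst 1)).
  + apply: nearW => n; have /andP[h0 h1] := a01 n.
    have := @bernoulli_le (1 - y ^+ n) (2 ^ n); rewrite addrAC subrr add0r mulrN N2.
    move=> -> /=; last by lra.
    by apply: exprn_ile1; lra.
  + rewrite -[X in _ --> X]subr0; apply: cvgB; first exact: cvg_cst.
    by apply: cvg_expr; rewrite gtr0_norm; lra.
  + exact: cvg_cst.
- apply: (@squeeze_cvgr _ _ _ _ (cst 0) (fun n => (2 * y)^-1 ^+ n)).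
  + apply: nearW => n; have /andP[h0 h1] := a01 n.
    rewrite exprn_ge0 ?subr_ge0 //=.
    have Y0 : 0 < (2 * y) ^+ n by rewrite exprn_gt0 //; lra.
    rewrite exprVn -[leRHS]mul1r ler_pdivlMr //.
    have p0 : 0 <= (1 - y ^+ n) ^+ (2 ^ n) by rewrite exprn_ge0 //; lra.
    have : (2 * y) ^+ n <= (1 + y ^+ n) ^+ (2 ^ n).
      have := @bernoulli_le (1 + y ^+ n) (2 ^ n); rewrite [1 + _ - 1]addrAC subrr add0r N2.
      by move=> H; have := H (addr_ge0 ler01 h0); lra.
    move=> /(ler_wpM2l p0) H; apply: (le_trans H).
    rewrite -exprMn; apply: exprn_ile1; move: (y ^+ n) h0 h1 => a; nra.
  + exact: cvg_cst.
  + by apply: cvg_expr; rewrite gtr0_norm ?invr_gt0 ?invf_lt1; lra.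
Qed.

Lemma wspace_total u : wspace u -> (forall p, bform u (rpoly p) = 0) -> u = cst 0.
Proof.
move=> [su ua us] ortho; have pu := wspace_primitive ua.
have dotp p : dot (derv u) (derv (rpoly p)) = dot (derv u) (horner p^`()).
  have [_ _ s1] := rpoly_wspace p; have s2 := sqint_horner p^`().
  by apply: dot_ae => //; apply/aeW => // x Ix; rewrite rpoly_derv.
have total_int : dot (derv u) (horner 1) = u 1 - u (-1).
  rewrite dotE -pu.2 ?lexx ?ltW ?ltN11 //; apply: eq_Rintegral => x _.
  by rewrite hornerC mulr1.
have dot0 : dot (derv u) (horner 0) = 0.
  rewrite dotE; transitivity (\int[mu]_(x in I) (cst (0 : R) x)).
    by apply: eq_Rintegral => x _; rewrite horner0 mulr0.
  by rewrite /Rintegral /= integral0_eq.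
(* Testing with 1 gives u(1) + u(-1) = 0, testing with X gives u(1) = u(-1). *)
have [ua0 ub0] : u (-1) = 0 /\ u 1 = 0.
  have := ortho 1; have := ortho 'X; rewrite /bform !dotp !rpolyE ?N11_in ?P11_in //.
  rewrite derivX derivC dot0 total_int !hornerX !hornerC.
  by move: (u 1) (u (-1)) => s t H1 H2; split; lra.
(* Every polynomial is a derivative, and the boundary terms of the form are now gone. *)
have dq q : dot (derv u) (horner q) = 0.
  have [p pq] := poly_primitive q; have := ortho p.
  by rewrite /bform ua0 ub0 !mul0r mulr0 !add0r dotp pq.
apply/funext => c /=; case: (boolP (-1 <= c <= 1)) => [|/su //].
rewrite !le_eqVlt => /andP[/predU1P[<- //|c1] /predU1P[-> //|c2]].
pose J := `]-1, c[%classic : set R.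
have JI : J `<=` I by apply: subset_itvl; rewrite bnd_simp ltW.
have mu' := sqint_measurable us.
have yI x : I x -> 0 < 2^-1 + (x - c) / 4 < 1.
  by move=> /IooP[? ?]; apply/andP; split; lra.
have mJ : measurable_fun I (\1_J : R -> R).
  by apply: measurable_indic; exact: measurable_itv.
have ui := sqint_integrable us.
have aiu : mu.-integrable I (fun x => `|(derv u x)%:E|)%E by exact: integrable_abse ui.
have := @dominated_convergence _ _ _ mu I mIoo
  (fun n x => (derv u x * (cutoff c n).[x])%:E) (fun x => (derv u x * \1_J x)%:E)
  (fun x => `|(derv u x)%:E|)%E.
case.
- move=> n; apply/measurable_EFinP; apply: measurable_funM => //.
  exact: sqint_measurable (sqint_horner _).
- by apply/measurable_EFinP; apply: measurable_funM.
(* At x = c the base y is 1/2 and [cutoff_cvg] says nothing, but a single point is null. *)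
- have nc : {ae mu, forall x, x != c}.
    exists [set c]; split; [exact: measurable_set1|exact: lebesgue_measure_set1|].
    by move=> x /= /negP; rewrite negbK => /eqP.
  apply: ae_imp nc => x xc Ix; apply: cvg_EFin; first exact: nearW.
  apply: cvgM; first exact: cvg_cst.
  have -> : \1_J x = (x < c)%R%:R :> R.
    rewrite indicE; congr (_ : bool)%:R; apply/idP/idP; rewrite inE /J /= in_itv /=.
      by move=> /andP[].
    by move=> ->; case/IooP: Ix => -> _.
  exact: cutoff_cvg (yI x Ix) xc.
- exact: aiu.
- apply/aeW => x n Ix; suff : `|derv u x * (cutoff c n).[x]| <= `|derv u x| by rewrite -lee_fin.
  rewrite normrM -[leRHS]mulr1 ler_wpM2l //.
  by apply: cutoff_bound; have /andP[/ltW -> /ltW ->] := yI x Ix.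
move=> _ _; set l := (X in _ --> X).
set s := (X in X @ _ --> _); have -> : s = (fun n : nat => 0%E : \bar R).
  apply/funext => n; transitivity (dot (derv u) (horner (cutoff c n)))%:E; last by rewrite dq.
  by rewrite dotE EFin_Rintegral //; exact: sqint_integrableM us (sqint_horner _).
move=> /cvg_unique /(_ (cvg_cst _)); rewrite /l.
have iJ : mu.-integrable I (EFin \o (fun x => derv u x * \1_J x)).
  apply: le_integrable_Ioo (aiu) _; first by apply: measurable_funM.
  move=> x _; rewrite normrM -[leRHS]mulr1 ler_wpM2l // indicE.
  by case: (x \in J); rewrite ?normr1 ?normr0.
move=> l0; have H : \int[mu]_(x in I) (derv u x * \1_J x) = 0.
  by apply: EFin_inj; rewrite EFin_Rintegral //; apply: l0; exact: ereal_hausdorff.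
have := pu.2 (-1) c (lexx _) (ltW c1) (ltW c2).
by rewrite -/J ua0 subr0 => <-; rewrite -H; exact: Rintegral_indic.
Qed.

End RealSpace.

(** * Jacobi polynomials *)

(* The next two identities are over an abstract ring because [ring] is slow on {poly R}. *)
Lemma product_deriv_identity (A : comNzRingType) (h p q r s : A) (j i : nat) :
  h * p *+ j * q + r * (h * s *+ i) = h * ((p * q) *+ j + (r * s) *+ i).
Proof. by ring. Qed.

Lemma second_deriv_identity (A : comNzRingType) (h s t : A) (j i : nat) : 4 * (h * h) = 1 ->
  4 * (s * t) * (h * (
    (h * ((s ^+ j.-2 * t ^+ i) *+ j.-1 + (s ^+ j.-1 * t ^+ i.-1) *+ i)) *+ j +
    (h * ((s ^+ j.-1 * t ^+ i.-1) *+ j + (s ^+ j * t ^+ i.-2) *+ i.-1)) *+ i)) =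
  (s ^+ j.-1 * t ^+ i.+1) *+ (j * j.-1) + (s ^+ j * t ^+ i) *+ (2 * (j * i)) +
  (s ^+ j.+1 * t ^+ i.-1) *+ (i * i.-1).
Proof.
move=> h4; set r := (X in _ = X).
transitivity (4 * (h * h) * r); last by rewrite h4 mul1r.
rewrite {}/r {h4}; by case: j => [|[|j]]; case: i => [|[|i]]; rewrite /= ?exprS; ring.
Qed.

Section Jacobi.
Context {R : realType}.
Implicit Types (a b x y e d c k : R) (u v w g h : R -> R) (p q : {poly R}).
Local Notation mu := (@lebesgue_measure R).
Local Notation I := (@Ioo R).

Local Notation half := ((2^-1)%:P : {poly R}).
Definition jS : {poly R} := ('X - 1) * half.
Definition jT : {poly R} := ('X + 1) * half.

Definition jcoef n j : nat := ('C(n.-1, n - j) * 'C(n.-1, j))%N.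

Definition jsum n : {poly R} := \sum_(0 <= j < n.+1) (jcoef n j)%:R *: (jS ^+ j * jT ^+ (n - j)).

Definition jpoly n : {poly R} :=
  match n with
  | 0 => 1
  | 1 => (Num.sqrt 3)^-1 *: 'X
  | _ => (Num.sqrt (4 * n%:R - 2) / (n%:R - 1)) *: jsum n
  end.

Lemma jS_deriv : jS^`() = half.
Proof. by rewrite /jS derivM derivC mulr0 addr0 derivB derivX derivC subr0 mul1r. Qed.

Lemma jT_deriv : jT^`() = half.
Proof. by rewrite /jT derivM derivC mulr0 addr0 derivD derivX derivC addr0 mul1r. Qed.

Lemma half_sqr : 4 * (half * half) = 1.
Proof.
rewrite -polyCM (_ : 4 = (4 : R)%:P); last by rewrite polyCMn.
by rewrite -polyCM (_ : 4 * (2^-1 * 2^-1) = 1 :> R) //; field.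
Qed.

Lemma jST : 'X ^+ 2 - 1 = 4 * (jS * jT).
Proof.
have -> : 4 * (jS * jT) = (4 * (half * half)) * ('X ^+ 2 - 1) by rewrite /jS /jT; ring.
by rewrite half_sqr mul1r.
Qed.

Lemma jterm_deriv i j : (jS ^+ j * jT ^+ i)^`() =
  half * ((jS ^+ j.-1 * jT ^+ i) *+ j + (jS ^+ j * jT ^+ i.-1) *+ i).
Proof.
rewrite derivM !deriv_exp jS_deriv jT_deriv; exact: product_deriv_identity.
Qed.

(** Both S and T have derivative 1/2, so on polynomials in S and T the operator (X^2 - 1) d^2/dX^2
    is S T (d/dS + d/dT)^2. Where a predecessor is truncated at 0, its coefficient vanishes. *)
Lemma jterm_ode i j : ('X ^+ 2 - 1) * (jS ^+ j * jT ^+ i)^`()^`() =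
  (jS ^+ j.-1 * jT ^+ i.+1) *+ (j * j.-1) + (jS ^+ j * jT ^+ i) *+ (2 * (j * i)) +
  (jS ^+ j.+1 * jT ^+ i.-1) *+ (i * i.-1).
Proof.
rewrite jterm_deriv derivM derivC mul0r add0r derivD !derivMn !jterm_deriv jST.
exact: second_deriv_identity half_sqr.
Qed.

Lemma jcoef_rec n j : (j < n)%N ->
  (jcoef n j.+1 * (j.+1 * j) = jcoef n j * ((n - j) * (n - j).-1))%N.
Proof.
case: n => // n; rewrite /jcoef ltnS => jn /=.
rewrite subSS subSn //=.
have e1 : ('C(n, j.+1) * j.+1 = 'C(n, j) * (n - j))%N.
  by rewrite mulnC [RHS]mulnC; exact: mul_bin_left.
have e2 : ('C(n, (n - j).+1) * (n - j).+1 = 'C(n, n - j) * j)%N.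
  by have := mul_bin_left n (n - j); rewrite subKn // mulnC => ->; rewrite mulnC.
have -> : ('C(n, n - j) * 'C(n, j.+1) * (j.+1 * j) =
           ('C(n, j.+1) * j.+1) * ('C(n, n - j) * j))%N by lia.
by rewrite e1 -e2; lia.
Qed.

(* With S = (X - 1)/2 and T = (X + 1)/2 one has X^2 - 1 = 4 S T, and the
   coefficients a_j of S^j T^(n-j) satisfy
   (j + 1) j a_(j+1) = (n - j) (n - j - 1) a_j. *)
Lemma jsum_ode n : ('X ^+ 2 - 1) * (jsum n)^`()^`() = jsum n *+ (n * n.-1).
Proof.
pose M j := jS ^+ j * jT ^+ (n - j).
pose A j := (jcoef n j * (j * j.-1))%N.
have A_S j : (j <= n)%N -> A j.+1 = (jcoef n j * ((n - j) * (n - j).-1))%N.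
  rewrite leq_eqVlt => /predU1P[->|]; last exact: jcoef_rec.
  rewrite /A /jcoef subnn mul0n muln0; case: n {M A} => // n.
  by rewrite (@bin_small n.+1.-1 n.+2) // muln0.
have jsumE : jsum n = \sum_(0 <= j < n.+1) M j *+ jcoef n j.
  by apply: eq_bigr => j _; rewrite scaler_nat.
rewrite jsumE !raddf_sum /= mulr_sumr -sumrMnl.
transitivity (\sum_(0 <= j < n.+1) (M j.-1 *+ A j) +
  \sum_(0 <= j < n.+1) (M j.+1 *+ A j.+1) +
  \sum_(0 <= j < n.+1) (M j *+ (jcoef n j * (2 * (j * (n - j)))))).
  rewrite -!big_split; apply: eq_big_nat => j /andP[_ jn] /=; rewrite !derivMn.
  rewrite mulrnAr jterm_ode !mulrnDl -!mulrnA [RHS]addrAC; congr (_ + _ + _).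
  - case: j jn => [|j] jn; first by rewrite /A !mul0n muln0 !mulr0n.
    by rewrite /A /M /= -subSn // mulnC.
  - by rewrite /M mulnC.
  - by rewrite A_S // mulnC /M subnS.
have A0 : A 0%N = 0%N by rewrite /A mul0n muln0.
have An : A n.+1 = 0%N by rewrite A_S // subnn mul0n muln0.
rewrite [X in X + _ + _]big_nat_recl //= A0 mulr0n add0r.
rewrite [X in _ + X + _]big_nat_recr //= An mulr0n addr0.
have -> : \sum_(0 <= i < n) M i *+ A i.+1 = \sum_(0 <= i < n.+1) M i *+ A i.+1.
  by rewrite big_nat_recr //= An mulr0n addr0.
have -> : \sum_(0 <= i < n) M i.+1 *+ A i.+1 = \sum_(0 <= i < n.+1) M i *+ A i.
  by rewrite [RHS]big_nat_recl //= A0 mulr0n add0r.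
rewrite -!big_split; apply: eq_big_nat => j /andP[_ jn] /=.
(* After both shifts of index, what remains is (n-j)(n-j-1) + j(j-1) + 2 j (n-j) = n(n-1). *)
rewrite -!mulrnDr -mulrnA A_S // /A; congr (_ *+ _).
rewrite -!mulnDr; congr (_ * _)%N.
have -> : n = (n - j + j)%N by rewrite subnK.
by rewrite addnK; case: j {jn} => [|j]; case: (n - _)%N => [|m] /=; nia.
Qed.

Lemma jpoly_ode n : ('X ^+ 2 - 1) * (jpoly n)^`()^`() = jpoly n *+ (n * n.-1).
Proof.
case: n => [|[|n]].
- by rewrite /= derivC deriv0 mulr0 mul0n mulr0n.
- by rewrite /= derivZ derivX derivZ derivC scaler0 mulr0 muln0 mulr0n.
- by rewrite /jpoly !derivZ -scalerAr jsum_ode scalerMnr.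
Qed.

(** Serves to show that the sum is nonzero. At 3 one has S = 1 and T = 2, so nothing cancels, and
    the term j = 1 is positive. *)
Lemma jsum_gt0 n : (0 < (jsum n.+2).[3])%R.
Proof.
rewrite /jsum horner_sum.
have S3 : jS.[3] = 1 :> R by rewrite /jS !hornerE; field.
have T3 : jT.[3] = 2 :> R by rewrite /jT !hornerE; field.
have term j : ((jcoef n.+2 j)%:R *: (jS ^+ j * jT ^+ (n.+2 - j))).[3] =
    (jcoef n.+2 j)%:R * 2 ^+ (n.+2 - j) :> R.
  by rewrite hornerZ hornerM !horner_exp S3 T3 expr1n mul1r.
rewrite big_nat_recl // big_nat_recl //= !term; apply: ltr_wpDl.
  by rewrite mulr_ge0 // exprn_ge0.
apply: ltr_pwDl.
  by rewrite mulr_gt0 ?exprn_gt0 // ltr0n /jcoef subSS subn0 binn mul1n bin1.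
by apply: sumr_ge0 => j _; rewrite term mulr_ge0 // exprn_ge0.
Qed.

Lemma jpoly_neq0 n : jpoly n != 0.
Proof.
case: n => [|[|n]]; first exact: oner_neq0.
  by rewrite scaler_eq0 polyX_eq0 orbF invr_eq0 gt_eqF // sqrtr_gt0.
rewrite /jpoly scaler_eq0 negb_or; apply/andP; split; last first.
  by apply/eqP => j0; have := jsum_gt0 n; rewrite j0 horner0 ltxx.
have : (2 : R) <= n.+2%:R by rewrite ler_nat.
move=> n2; apply: mulf_neq0.
  have : 0 < 4 * n.+2%:R - 2 :> R by move: (n.+2%:R : R) n2 => t ?; lra.
  by move=> n0; rewrite gt_eqF // sqrtr_gt0.
by rewrite invr_eq0 gt_eqF // subr_gt0 (lt_le_trans _ n2) // ltr1n.
Qed.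

(* Comparing leading coefficients in the differential equation. *)
Lemma size_jpoly n : size (jpoly n) = n.+1.
Proof.
have p0 := jpoly_neq0 n; have := jpoly_ode n; case: n p0 => [|[|n]] p0.
- by rewrite size_poly1.
- by rewrite size_scale ?size_polyX // invr_eq0 gt_eqF // sqrtr_gt0.
move: (jpoly _) p0 => p p0 ode.
have [d sp] : exists d : nat, size p = d.+1.
  by exists (size p).-1; rewrite prednK // size_poly_gt0.
have pd : p`_d != 0 by have := p0; rewrite -lead_coef_eq0 /lead_coef sp.
have := congr1 (fun q : {poly R} => q`_d) ode.
rewrite mulrBl mul1r coefB coefMn coefXnM !coef_deriv.
have -> : p`_d.+2 = 0 by rewrite nth_default // sp.
rewrite !mul0rn subr0 => E; rewrite sp; congr _.+1.
case: d sp pd E => [|[|d]] sp pd /=.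
- by move=> /esym /eqP; rewrite mulrn_eq0 (negbTE pd).
- by move=> /esym /eqP; rewrite mulrn_eq0 (negbTE pd).
have -> : (d.+2 - 2 = d)%N by lia.
rewrite -mulrnA => /(mulrIn pd) E; nia.
Qed.


(** * Jacobi polynomials as orthogonal eigenfunctions *)

Lemma rpoly_derv2 p x : I x -> p^`()^`().[x] = derv (derv (rpoly p)) x.
Proof.
have E1 y : I y -> p^`().[y] = derv (rpoly p) y by move=> Iy; rewrite rpoly_derv.
by move=> Ix; rewrite -(derive1_eq_on E1 Ix) dervE -derivE.
Qed.

Lemma ddom_rpoly p : ddom (rpoly p).
Proof.
have [su ua us] := rpoly_wspace p.
have E1 x : I x -> p^`().[x] = derv (rpoly p) x by move=> Ix; rewrite rpoly_derv.
have E2 := @rpoly_derv2 p.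
have E3 x : I x -> p^`()^`()^`().[x] = derv (derv (derv (rpoly p))) x.
  by move=> Ix; rewrite -(derive1_eq_on E2 Ix) dervE -derivE.
have lq q : abscont_loc (horner q) by move=> a b _ ab _; exact: abscont_horner.
split; split; [exact: su|exact: ua|exact: abscont_loc_eq E1 (lq _)|
  exact: abscont_loc_eq E2 (lq _)| | |exact: us].
- apply: sqint_eq (sqint_horner ((1 - 'X^2) * p^`()^`()^`())) => x Ix.
  by rewrite -E3 // hornerM hornerD hornerN hornerXn hornerC.
- apply: sqint_eq (sqint_sqrt_weight (sqint_horner p^`()^`())) => x Ix.
  by rewrite E2.
Qed.

Lemma opR_rpoly k c p : ('X^2 - 1) * p^`()^`() = c *: p ->
  opR k (rpoly p) = (fun x => (c + k) * rpoly p x).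
Proof.
move=> ode; have [su ua us] := wspaceZ (c + k) (rpoly_wspace p).
apply: cext_supported => // x Ix.
rewrite -(rpoly_derv2 _ Ix).
have := congr1 (fun q : {poly R} => q.[x]) ode.
rewrite /= hornerM hornerD hornerN hornerXn hornerC hornerZ rpoly_Ioo //.
by move: (p^`()^`().[x]) (p.[x]) => s t H; lra.
Qed.

Definition jeigen n : R := n%:R * (n%:R - 1).

Lemma jeigenE n : jeigen n = (n * n.-1)%:R.
Proof.
by rewrite /jeigen natrM; case: n => [|n]; [rewrite !mul0r|rewrite -natr1 addrK].
Qed.

Lemma opR_jpoly k n : opR k (rpoly (jpoly n)) = (fun x => (jeigen n + k) * rpoly (jpoly n) x).
Proof. by apply: opR_rpoly; rewrite jpoly_ode jeigenE scaler_nat. Qed.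

(** n(n-1) vanishes for both n = 0 and n = 1. This is the only coincidence of eigenvalues, so the
    only pair whose orthogonality does not follow from symmetry. *)
Lemma bform01 : bform (rpoly (jpoly 0)) (rpoly (jpoly 1)) = 0.
Proof.
have [_ _ s0] := rpoly_wspace (jpoly 0); have [_ _ s1] := rpoly_wspace (jpoly 1).
rewrite /bform !rpolyE ?N11_in ?P11_in // hornerC hornerC !hornerZ !hornerX.
have -> : dot (derv (rpoly (jpoly 0))) (derv (rpoly (jpoly 1))) =
    dot (fun x => 0 * cst 0 x) (derv (rpoly (jpoly 1))).
  apply: dot_ae => //; first exact: sqintZ (sqint_cst 0).
    by apply/aeW => x Ix; rewrite rpoly_derv // derivC horner0 mul0r.
  exact/aeW.
rewrite (dotZl 0 (sqint_cst 0) s1) mul0r addr0.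
by rewrite mulrN1 mulr1 !mul1r mulrN addNr.
Qed.

Lemma bform_jpoly_orthogonal m n : m <> n ->
  bform (rpoly (jpoly m)) (rpoly (jpoly n)) = 0.
Proof.
move=> mn; have [/eqP|/eqP nl] := eqVneq (jeigen m) (jeigen n).
  rewrite !jeigenE eqr_nat => /eqP E.
  have [[-> ->]|[-> ->]] : (m = 0 /\ n = 1 \/ m = 1 /\ n = 0)%N.
  - case: m n mn E => [|[|m]] [|[|n]] //= mn E; [by left|by right|nia..].
  - exact: bform01.
  - by rewrite bformC bform01.
have := opR_sym 0 (ddom_rpoly (jpoly m)) (ddom_rpoly (jpoly n)).
rewrite !opR_jpoly !addr0 [RHS]bformC !bformZ; try exact: rpoly_wspace.
rewrite (bformC (rpoly (jpoly n))) => /eqP.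
by rewrite -subr_eq0 -mulrBl mulf_eq0 subr_eq0 => /orP[/eqP //|/eqP].
Qed.

Lemma jpoly_total u : wspace u -> (forall n, bform u (rpoly (jpoly n)) = 0) -> u = cst 0.
Proof.
move=> wu H; apply: wspace_total => // p.
have [N sp] : exists N : nat, (size p <= N)%N by exists (size p).
elim: N p sp => [|N IH] p sp.
  move: sp; rewrite leqn0 size_poly_eq0 => /eqP ->.
  have -> : rpoly 0 = (fun x => 0 * rpoly 0 x).
    by apply/funext => x; rewrite /rpoly horner0 mul0r; case: ifP.
  by rewrite bformC bformZ ?mul0r //; exact: rpoly_wspace.
pose c := p`_N / (jpoly N)`_N; pose q := p - c *: jpoly N.
have jN : (jpoly N)`_N != 0.
  have := jpoly_neq0 N; rewrite -lead_coef_eq0 lead_coefE size_jpoly; exact.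
have sq : (size q <= N)%N.
  apply/leq_sizeP => i; rewrite leq_eqVlt => /predU1P[<-|Ni].
    by rewrite coefB coefZ /c divfK // subrr.
  rewrite coefB coefZ [p`_i]nth_default ?(leq_trans sp) //.
  by rewrite [(jpoly N)`_i]nth_default ?size_jpoly // mulr0 subrr.
have -> : rpoly p = (fun x => c * rpoly (jpoly N) x + rpoly q x).
  apply/funext => x; rewrite /rpoly; case: ifP => _; last by rewrite mulr0 addr0.
  by rewrite /q hornerD hornerN hornerZ addrC subrK.
rewrite bformC bform_lin //; try exact: rpoly_wspace.
by rewrite ![bform (rpoly _) u]bformC H IH // mulr0 addr0.
Qed.

Lemma jpoly_jacobi n x : jacobi R n x = ((jpoly n).[x])%:C%C.
Proof.
case: n => [|[|n]]; rewrite /jacobi /jpoly.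
- by rewrite hornerC.
- by rewrite hornerZ hornerX mulrC.
- rewrite hornerZ horner_sum; congr (real_complex _ (_ * _)).
  apply: eq_bigr => j _; rewrite hornerZ hornerM !horner_exp /jcoef natrM !mulrA.
  by rewrite /jS /jT !hornerM hornerD hornerD hornerN !hornerC hornerX.
Qed.

(** * The adjoint *)

Lemma bform_linr c u v w : wspace u -> wspace v -> wspace w ->
  bform w (fun x => c * u x + v x) = c * bform w u + bform w v.
Proof. by move=> wu wv ww; rewrite bformC bform_lin // ![bform _ w]bformC. Qed.

Lemma opR_lin k c u v : ddom u -> ddom v ->
  opR k (fun x => c * u x + v x) = (fun x => c * opR k u x + opR k v x).
Proof.
move=> du dv; have [F [wF _ _ FE]] := ddom_flux_wspace du.
have [G [wG _ _ GE]] := ddom_flux_wspace dv.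
have wl := wspace_lin c wF wG; have dl := ddom_lin c du dv.
have E2 := ddom_derv2_lin c du dv.
rewrite (opRE k dl wl); last first.
  move=> x Ix; rewrite FE // GE // -E2 //.
  by move: (derv _ x) (derv _ x) (1 - _) => s t r; ring.
rewrite (opRE k du wF FE) (opRE k dv wG GE); apply/funext => x.
by move: (u x) (v x) (F x) (G x) => s t r q; ring.
Qed.

Lemma dot_derv_affine u a b : wspace u -> dot (derv u) (derv (affine a b)) = b * (u 1 - u (-1)).
Proof.
move=> [su ua us]; have [_ _ s1] := affine_wspace a b.
have -> : dot (derv u) (derv (affine a b)) = dot (derv u) (fun x => b * cst 1 x).
  apply: dot_ae => //; [exact: sqintZ (sqint_cst 1)|exact: aeW|].
  by apply/aeW => x Ix; rewrite affine_derive1 // mulr1.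
rewrite (dotZr b (sqint_cst 1) us) dotE; congr (_ * _).
rewrite -(wspace_primitive ua).2 ?lexx ?ltW ?ltN11 //; apply: eq_Rintegral => x _.
by rewrite mulr1.
Qed.

Lemma bform_affine u a b : wspace u ->
  bform u (affine a b) = 2^-1 * (u (-1) * (a - b)) + 2^-1 * (u 1 * (a + b)) +
    b * (u 1 - u (-1)).
Proof.
move=> wu; rewrite /bform dot_derv_affine // /affine N11_in P11_in.
by move: (u 1) (u (-1)) => s t; ring.
Qed.

Lemma opR_affine k a b : opR k (affine a b) = (fun x => k * affine a b x).
Proof.
have wF := affine_wspace (0 : R) 0; rewrite (opRE k (ddom_affine a b) wF).
  apply/funext => x; rewrite {2}/affine mul0r addr0; case: ifP => _; ring.
move=> x Ix.
have E1 y : I y -> cst b y = derv (affine a b) y by move=> Iy; rewrite affine_derive1.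
rewrite -(derive1_eq_on E1 Ix) (derive1_isd (isd_cst b x)) mulr0 /affine.
by rewrite mul0r addr0; case: ifP.
Qed.

Definition interpolant u : R -> R := affine ((u 1 + u (-1)) / 2) ((u 1 - u (-1)) / 2).

Lemma interpolantN1 u : interpolant u (-1) = u (-1).
Proof. by rewrite /interpolant /affine N11_in; move: (u 1) (u (-1)) => s t; field. Qed.

Lemma interpolant1 u : interpolant u 1 = u 1.
Proof. by rewrite /interpolant /affine P11_in; move: (u 1) (u (-1)) => s t; field. Qed.

(** The difference h of d and its interpolant vanishes at the end points, so it is orthogonal to d
    by hypothesis and to affine functions by [bform_affine]; hence it is orthogonal to itself. *)
Lemma orthogonal_vanishing_affine (d : R -> R) : wspace d ->
  (forall h, wspace h -> h (-1) = 0 -> h 1 = 0 -> bform h d = 0) -> d = interpolant d.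
Proof.
move=> wd H; have wi : wspace (interpolant d) by exact: affine_wspace.
pose h x := d x - interpolant d x; have wh : wspace h by exact: wspaceB.
have ha : h (-1) = 0 by rewrite /h interpolantN1 subrr.
have hb : h 1 = 0 by rewrite /h interpolant1 subrr.
have h0 : bform h h = 0.
  have -> : bform h h = bform h (fun x => -1 * interpolant d x + d x).
    by congr bform; apply/funext => x; rewrite mulN1r addrC.
  by rewrite bform_linr // H // bform_affine // ha hb; ring.
apply/funext => x; have := congr1 (fun g : R -> R => g x) (bform_eq0 wh h0).
by rewrite /h /= => /eqP; rewrite subr_eq0 => /eqP.
Qed.

(* [w - k u] is orthogonal to the affine functions, hence vanishes at the end points
   and equals [(T - k) f] for some f; then [u - f] is orthogonal to all functions
   vanishing at the end points, hence affine. *)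
Lemma opR_adjoint k u w : wspace u -> wspace w ->
  (forall v, ddom v -> bform (opR k v) u = bform v w) -> ddom u /\ opR k u = w.
Proof.
move=> wu ww adj; pose g x := -k * u x + w x.
have wg : wspace g by exact: wspace_lin.
have g_aff a b : bform g (affine a b) = 0.
  rewrite bformC bform_linr //; last exact: affine_wspace.
  rewrite -adj; last exact: ddom_affine.
  by rewrite opR_affine bformZ //; [rewrite mulNr addNr|exact: affine_wspace].
have [ga gb] : g (-1) = 0 /\ g 1 = 0.
  have := g_aff 1 0; have := g_aff 0 1; rewrite !bform_affine //.
  by move: (g 1) (g (-1)) => s t H1 H2; split; lra.
have [f [df fa fb fE]] := opR_surj k wg ga gb; have wf := ddom_wspace df.
pose d x := u x - f x; have wd : wspace d by exact: wspaceB.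
have dE v : wspace v -> bform v d = bform v u - bform v f.
  move=> wv; have -> : d = (fun x => -1 * f x + u x).
    by apply/funext => x; rewrite mulN1r addrC.
  by rewrite bform_linr // mulN1r addrC.
have d_aff : d = interpolant d.
  apply: orthogonal_vanishing_affine => // h wh ha hb.
  (* Writing h = (T - k) v, the adjoint relation for u and the symmetry for f show that [bform h u]
     and [bform h f] both equal [bform v g]. *)
  have [v [dv va vb vE]] := opR_surj k wh ha hb; have wv := ddom_wspace dv.
  have := adj v dv; have := opR_sym k dv df.
  rewrite fE vE !bform_lin // bform_linr // dE //.
  rewrite /g bform_linr //.
  by move: (bform v f) (bform h f) (bform v u) (bform v w) (bform h u) => *; lra.
have uE : u = (fun x => 1 * f x + interpolant d x).
  by apply/funext => x; rewrite -d_aff /d mul1r addrC subrK.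
have du : ddom u by rewrite uE; apply: ddom_lin => //; exact: ddom_affine.
split => //; have wA := opR_wspace k du; pose r x := opR k u x - w x.
have wr : wspace r by exact: wspaceB.
(* Polynomials lie in the domain and are total, so the adjoint relation tested on them determines T
   u. *)
have r0 : r = cst 0.
  apply: wspace_total => // p; have dp := ddom_rpoly p; have wp := ddom_wspace dp.
  have -> : r = (fun x => -1 * w x + opR k u x).
    by apply/funext => x; rewrite mulN1r addrC.
  rewrite bform_lin //.
  have := adj _ dp; rewrite opR_sym // !(bformC (rpoly p)) => ->.
  by rewrite mulN1r addNr.
apply/funext => x; have := congr1 (fun g : R -> R => g x) r0.
by rewrite /r /= => /eqP; rewrite subr_eq0 => /eqP.
Qed.

End Jacobi.

Local Open Scope complex_scope.

(** * Orthogonal eigenvectors in a Hilbert space *)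

Lemma summable_tail (R : realType) (a : nat -> R) (M : R) : (forall n, 0 <= a n) ->
  (forall n, \sum_(0 <= i < n) a i <= M) ->
  forall e, 0 < e -> exists N : nat, forall m n : nat, (N <= m)%N -> (m <= n)%N ->
    \sum_(m <= i < n) a i < e.
Proof.
move=> a0 aM e e0; pose t n := \sum_(0 <= i < n) a i.
have St : has_sup (range t).
  by split; [exists (t 0%N), 0%N|exists M => _ [n _ <-]; exact: aM].
have [_ [N _ <-] tN] := sup_adherent e0 St.
have tnd m n : (m <= n)%N -> t m <= t n.
  by move=> mn; rewrite /t (big_cat_nat (leq0n m) mn) /= lerDl sumr_ge0.
exists N => m n Nm mn.
have -> : \sum_(m <= i < n) a i = t n - t m.
  by rewrite /t (big_cat_nat (leq0n m) mn) /= addrAC subrr add0r.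
have := tnd _ _ Nm; have : t n <= sup (range t) by apply: ub_le_sup; [case: St|exists n].
lra.
Qed.

Section Hilbert.
Context {R : realType} {E : lmodType R[i]}.
Implicit Types (f g h : E) (c z : R[i]).

Definition inner_product_on (H : set E) (ip : E -> E -> R[i]) : Prop :=
  [/\ forall c f g, H f -> H g -> H (c *: f + g),
      forall c f g h, H f -> H g -> H h -> ip (c *: f + g) h = c * ip f h + ip g h,
      forall f g, H f -> H g -> ip g f = (ip f g)^*,
      forall f, H f -> 0 <= ip f f
    & forall f, H f -> ip f f = 0 -> f = 0].

(** Estimates with squared norms stay polynomial; square roots enter only where [hnorm] is met. *)
Definition sqnorm (ip : E -> E -> R[i]) f : R := complex.Re (ip f f).

Definition complete_for (H : set E) (ip : E -> E -> R[i]) : Prop :=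
  forall u : nat -> E, (forall n, H (u n)) ->
    (forall e : R, 0 < e -> exists N : nat, forall m n : nat, (N <= m)%N -> (N <= n)%N ->
       sqnorm ip (u m - u n) < e) ->
    exists2 f, H f & forall e : R, 0 < e -> exists N : nat, forall n : nat, (N <= n)%N ->
       sqnorm ip (u n - f) < e.

Definition csqr z : R := complex.Re z ^+ 2 + complex.Im z ^+ 2.

Lemma csqrE z : (csqr z)%:C = z * z^*.
Proof. by case: z => a b; apply/eqP; rewrite eq_complex /csqr /=; apply/andP; split; apply/eqP; ring. Qed.

Lemma csqr_ge0 z : 0 <= csqr z.
Proof. by rewrite addr_ge0 ?sqr_ge0. Qed.

Lemma csqr_eq0 z : csqr z = 0 -> z = 0.
Proof.
case: z => a b; rewrite /csqr /= => H; have := sqr_ge0 a; have := sqr_ge0 b => b0 a0.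
have /eqP : a ^+ 2 = 0 by lra.
have /eqP : b ^+ 2 = 0 by lra.
by rewrite !sqrf_eq0 => /eqP -> /eqP ->.
Qed.

Lemma csqr0 : csqr 0 = 0.
Proof. by rewrite /csqr /= expr0n addr0. Qed.

Lemma csqrM z c : csqr (z * c) = csqr z * csqr c.
Proof. by case: z => a b; case: c => x y; rewrite /csqr /=; ring. Qed.

Lemma csqrV z : z != 0 -> csqr z^-1 = (csqr z)^-1.
Proof.
move=> z0; have : csqr (z^-1 * z) = 1.
  by rewrite mulVf // /csqr /= expr1n expr0n addr0.
rewrite csqrM => H; have cz : csqr z != 0.
  by apply/eqP => /csqr_eq0 /eqP; rewrite (negbTE z0).
by rewrite -[LHS](mulfK cz) H div1r.
Qed.

Lemma csqr_small z : (forall e : R, 0 < e -> csqr z <= e) -> z = 0.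
Proof.
move=> H; apply: csqr_eq0; apply/eqP; rewrite eq_le csqr_ge0 andbT.
by apply/ler_addgt0Pr => e /H; rewrite add0r.
Qed.

Lemma conjcZ (x : R) z : (x%:C * z)^* = x%:C * z^*.
Proof.
by case: z => a b; apply/eqP; rewrite eq_complex /=; apply/andP; split; apply/eqP; ring.
Qed.

Section Theory.
Variables (H : set E) (ip : E -> E -> R[i]).
Hypothesis ipP : inner_product_on H ip.
Hypothesis H0 : H 0.

Lemma ip_addZl c f g h : H f -> H g -> H h -> ip (c *: f + g) h = c * ip f h + ip g h.
Proof. by case: ipP => _ L _ _ _; exact: L. Qed.

Lemma ipC f g : H f -> H g -> ip g f = (ip f g)^*.
Proof. by case: ipP => _ _ L _ _; exact: L. Qed.

Lemma subspace_addZ c f g : H f -> H g -> H (c *: f + g).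
Proof. by case: ipP => L _ _ _ _; exact: L. Qed.

Lemma subspaceD f g : H f -> H g -> H (f + g).
Proof. by move=> hf hg; rewrite -[f]scale1r; exact: subspace_addZ. Qed.

Lemma subspaceZ c f : H f -> H (c *: f).
Proof. by move=> hf; rewrite -[_ *: _]addr0; exact: subspace_addZ. Qed.

Lemma subspaceB f g : H f -> H g -> H (f - g).
Proof. by move=> hf hg; rewrite addrC -scaleN1r; exact: subspace_addZ. Qed.

Lemma subspace_sum m n (F : nat -> E) : (forall i, H (F i)) -> H (\sum_(m <= i < n) F i).
Proof. by move=> HF; apply: (big_ind H) => //; exact: subspaceD. Qed.

Lemma ip0l h : H h -> ip 0 h = 0.
Proof.
move=> hh; have := ip_addZl 1 H0 H0 hh; rewrite scale1r addr0 mul1r.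
by move=> /eqP; rewrite -subr_eq0 opprD addNKr oppr_eq0 => /eqP.
Qed.

Lemma ipDl f g h : H f -> H g -> H h -> ip (f + g) h = ip f h + ip g h.
Proof. by move=> hf hg hh; rewrite -[f in LHS]scale1r ip_addZl // mul1r. Qed.

Lemma ipZl c f h : H f -> H h -> ip (c *: f) h = c * ip f h.
Proof. by move=> hf hh; rewrite -[_ *: _]addr0 ip_addZl // ip0l // addr0. Qed.

Lemma ipBl f g h : H f -> H g -> H h -> ip (f - g) h = ip f h - ip g h.
Proof.
by move=> hf hg hh; rewrite addrC -scaleN1r ip_addZl // mulN1r addrC.
Qed.

Lemma ip0r h : H h -> ip h 0 = 0.
Proof. by move=> hh; rewrite ipC // ip0l // conjc0. Qed.

Lemma ipDr f g h : H f -> H g -> H h -> ip h (f + g) = ip h f + ip h g.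
Proof.
move=> hf hg hh; rewrite ipC //; last exact: subspaceD.
by rewrite ipDl // rmorphD /= -!ipC.
Qed.

Lemma ipZr c f h : H f -> H h -> ip h (c *: f) = c^* * ip h f.
Proof.
move=> hf hh; rewrite ipC //; last exact: subspaceZ.
by rewrite ipZl // rmorphM /= -ipC.
Qed.

Lemma ipBr f g h : H f -> H g -> H h -> ip h (f - g) = ip h f - ip h g.
Proof.
move=> hf hg hh; rewrite ipC //; last exact: subspaceB.
by rewrite ipBl // rmorphB /= -!ipC.
Qed.

Lemma sqnormE f : H f -> ip f f = (sqnorm ip f)%:C.
Proof.
move=> hf; case: ipP => _ _ _ /(_ f hf) + _; rewrite /sqnorm.
by case: (ip f f) => a b; rewrite lecE /= => /andP[/eqP -> _].
Qed.

Lemma sqnorm_ge0 f : H f -> 0 <= sqnorm ip f.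
Proof.
move=> hf; case: ipP => _ _ _ /(_ f hf) + _; rewrite /sqnorm.
by case: (ip f f) => a b; rewrite lecE /= => /andP[].
Qed.

Lemma sqnorm_eq0 f : H f -> sqnorm ip f = 0 -> f = 0.
Proof. by move=> hf f0; case: ipP => _ _ _ _; apply => //; rewrite sqnormE // f0. Qed.

Lemma sqnorm_gt0 f : H f -> f <> 0 -> 0 < sqnorm ip f.
Proof.
move=> hf nf; rewrite lt_neqAle sqnorm_ge0 // andbT eq_sym; apply/eqP => /sqnorm_eq0.
by move=> /(_ hf).
Qed.

Lemma sqnormZ c f : H f -> sqnorm ip (c *: f) = csqr c * sqnorm ip f.
Proof.
move=> hf; apply: (@complexI R); rewrite rmorphM /= -!sqnormE //; last exact: subspaceZ.
by rewrite ipZl ?ipZr ?csqrE ?mulrA //; exact: subspaceZ.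
Qed.

Lemma sqnormN f : H f -> sqnorm ip (- f) = sqnorm ip f.
Proof.
by move=> hf; rewrite -scaleN1r sqnormZ // /csqr /= oppr0 sqrrN expr1n expr0n addr0 mul1r.
Qed.

Lemma sqnormBC f g : H f -> H g -> sqnorm ip (f - g) = sqnorm ip (g - f).
Proof. by move=> hf hg; rewrite -[f - g]opprB sqnormN //; exact: subspaceB. Qed.

Lemma sqnorm_orthoD f g : H f -> H g -> ip f g = 0 ->
  sqnorm ip (f + g) = sqnorm ip f + sqnorm ip g.
Proof.
move=> hf hg fg; have gf : ip g f = 0 by rewrite ipC // fg conjc0.
apply: (@complexI R); rewrite rmorphD /= -!sqnormE //; last exact: subspaceD.
by rewrite ipDl ?ipDr ?fg ?gf ?addr0 ?add0r //; exact: subspaceD.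
Qed.

Lemma ip_Cauchy_Schwarz f g : H f -> H g -> csqr (ip f g) <= sqnorm ip f * sqnorm ip g.
Proof.
move=> hf hg; have [g0|ng] := pselect (g = 0).
  by rewrite g0 ip0r // /csqr /= expr0n addr0 mulr_ge0 // sqnorm_ge0.
have G0 := sqnorm_gt0 hg ng; set G := sqnorm ip g in G0 *.
have GC : G%:C != 0 by rewrite (inj_eq (@complexI R)) gt_eqF.
pose c := ip f g / G%:C; have hcg : H (c *: g) by exact: subspaceZ.
have hfc : H (f - c *: g) by exact: subspaceB.
have orth : ip (f - c *: g) (c *: g) = 0.
  rewrite ipZr // ipBl // ipZl // sqnormE // -/G.
  by rewrite /c divfK // subrr mulr0.
have := sqnorm_orthoD hfc hcg orth; rewrite subrK => ->.
rewrite mulrDl -[leLHS]add0r lerD //; first by rewrite mulr_ge0 ?sqnorm_ge0 // ltW.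
rewrite sqnormZ // -/G /c csqrM csqrV //.
have -> : csqr G%:C = G * G by rewrite /csqr /= expr0n addr0 expr2.
by rewrite -mulrA -mulrA mulVf ?mulr1 // gt_eqF // mulr_gt0.
Qed.

(** From the parallelogram identity; it replaces the triangle inequality. *)
Lemma sqnormD_le f g : H f -> H g -> sqnorm ip (f + g) <= 2 * sqnorm ip f + 2 * sqnorm ip g.
Proof.
move=> hf hg; have := sqnorm_ge0 (subspaceB hf hg); have hfg := subspaceD hf hg.
have hB := subspaceB hf hg.
suff : sqnorm ip (f + g) + sqnorm ip (f - g) =
    (sqnorm ip f + sqnorm ip f) + (sqnorm ip g + sqnorm ip g).
  by have := sqnorm_ge0 hB; lra.
apply: (@complexI R); rewrite !rmorphD /= -!sqnormE //.
rewrite (ipDl hf hg hfg) (ipBl hf hg hB) (ipDr hf hg hf) (ipDr hf hg hg).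
rewrite (ipBr hf hg hf) (ipBr hf hg hg).
by move: (ip f f) (ip g g) (ip f g) (ip g f) => p q r t; ring.
Qed.

Definition converges_to (u : nat -> E) f : Prop :=
  forall e : R, 0 < e -> exists N : nat, forall n : nat, (N <= n)%N ->
    sqnorm ip (u n - f) < e.

Lemma ip_limit u f g z : (forall n, H (u n)) -> H f -> H g -> converges_to u f ->
  (exists N : nat, forall n, (N <= n)%N -> ip (u n) g = z) -> ip f g = z.
Proof.
move=> hu hf hg uf [N zN]; apply/eqP; rewrite -subr_eq0; apply/eqP/csqr_small => e e0.
have G0 := sqnorm_ge0 hg.
have [|N1 uN1] := uf (e / (sqnorm ip g + 1)); first by rewrite divr_gt0 //; lra.
pose n := maxn N N1; have := uN1 n (leq_maxr _ _).
have -> : ip f g - z = - ip (u n - f) g.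
  by rewrite ipBl // (zN n) ?leq_maxl // opprB.
have -> : csqr (- ip (u n - f) g) = csqr (ip (u n - f) g).
  by case: (ip _ _) => a b; rewrite /csqr /= !sqrrN.
rewrite ltr_pdivlMr; last by lra.
have hB := subspaceB (hu n) hf.
have := ip_Cauchy_Schwarz hB hg; have := sqnorm_ge0 hB; nra.
Qed.

(** * Fourier series in a total orthogonal system *)

Section Orthogonal.
Variable e : nat -> E.
Hypothesis eH : forall n, H (e n).
Hypothesis eO : forall m n, m <> n -> ip (e m) (e n) = 0.
Hypothesis e_neq0 : forall n, e n <> 0.
Hypothesis Hcomplete : complete_for H ip.
Hypothesis e_total : forall f, H f -> (forall n, ip f (e n) = 0) -> f = 0.

Lemma ip_sum_basis (a : nat -> R[i]) m n k : (m <= n)%N ->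
  ip (\sum_(m <= i < n) a i *: e i) (e k) =
  if (m <= k < n)%N then a k * ip (e k) (e k) else 0.
Proof.
move=> mn; elim: n mn => [|n IH].
  by rewrite leqn0 => /eqP ->; rewrite big_geq // ip0l // andbF.
rewrite leq_eqVlt => /predU1P[->|mn].
  rewrite big_geq // ip0l //; case: ifP => // /andP[h1 h2].
  by rewrite ltnNge h1 in h2.
rewrite big_nat_recr //= ipDl //; last 2 first.
- by apply: subspace_sum => i; exact: subspaceZ.
- exact: subspaceZ.
rewrite ipZl // IH //; have [->|nk] := eqVneq k n.
  by rewrite ltnn leqnn andbF andbT -ltnS mn add0r.
rewrite (eO (nesym (elimN eqP nk))) mulr0 addr0 ltnS.
by rewrite [(k <= n)%N]leq_eqVlt (negbTE nk).
Qed.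

Lemma sqnorm_sum_basis (a : nat -> R[i]) m n : (m <= n)%N ->
  sqnorm ip (\sum_(m <= i < n) a i *: e i) = \sum_(m <= i < n) csqr (a i) * sqnorm ip (e i).
Proof.
elim: n => [|n IH]; first by rewrite leqn0 => /eqP ->; rewrite !big_geq // /sqnorm ip0l.
rewrite leq_eqVlt => /predU1P[->|mn]; first by rewrite !big_geq // /sqnorm ip0l.
have hs : H (\sum_(m <= i < n) a i *: e i) by apply: subspace_sum => i; exact: subspaceZ.
rewrite !big_nat_recr //= sqnorm_orthoD ?IH ?sqnormZ //; first exact: subspaceZ.
by rewrite ipZr // ip_sum_basis // ltnn andbF mulr0.
Qed.

Definition fourier f n : R[i] := ip f (e n) / ip (e n) (e n).

Lemma ip_basis_neq0 n : ip (e n) (e n) != 0.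
Proof. by apply/eqP; case: ipP => _ _ _ _ /(_ _ (eH n)) h /h; exact: e_neq0. Qed.

Lemma ip_orthogonal_sum (a : nat -> R[i]) g n : H g ->
  (forall i, (i < n)%N -> ip g (e i) = 0) -> ip g (\sum_(0 <= i < n) a i *: e i) = 0.
Proof.
move=> hg; elim: n => [|n IH] ge; first by rewrite big_geq // ip0r.
rewrite big_nat_recr //= ipDr //; last 2 first.
- by apply: subspace_sum => i; exact: subspaceZ.
- exact: subspaceZ.
rewrite ipZr // ge // mulr0 addr0; apply: IH => i ni; apply: ge; exact: ltnW.
Qed.

Lemma bessel f n : H f ->
  \sum_(0 <= i < n) csqr (fourier f i) * sqnorm ip (e i) <= sqnorm ip f.
Proof.
move=> hf; rewrite -sqnorm_sum_basis //; set s := \sum_(0 <= i < n) _.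
have hs : H s by apply: subspace_sum => i; exact: subspaceZ.
have hB := subspaceB hf hs.
have : ip (f - s) s = 0.
  apply: (ip_orthogonal_sum _ hB) => k kn.
  rewrite ipBl // ip_sum_basis // kn /fourier divfK ?subrr //.
  exact: ip_basis_neq0.
move=> /(sqnorm_orthoD hB hs); rewrite subrK => ->.
by rewrite lerDr sqnorm_ge0.
Qed.

Lemma partial_sum_in (a : nat -> R[i]) m n : H (\sum_(m <= i < n) a i *: e i).
Proof. by apply: subspace_sum => i; exact: subspaceZ. Qed.

Lemma orthogonal_series_converges (a : nat -> R[i]) (M : R) :
  (forall n, \sum_(0 <= i < n) csqr (a i) * sqnorm ip (e i) <= M) ->
  exists2 f, H f & converges_to (fun n => \sum_(0 <= i < n) a i *: e i) f.
Proof.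
move=> aM; apply: Hcomplete => [n|eps eps0]; first exact: partial_sum_in.
have a0 i : 0 <= csqr (a i) * sqnorm ip (e i) by rewrite mulr_ge0 ?csqr_ge0 ?sqnorm_ge0.
have [N NP] := summable_tail a0 aM eps0; exists N.
have main m n : (N <= m)%N -> (m <= n)%N ->
    sqnorm ip (\sum_(0 <= i < n) a i *: e i - \sum_(0 <= i < m) a i *: e i) < eps.
  move=> Nm mn; rewrite (big_cat_nat (leq0n m) mn) /= addrAC subrr add0r.
  by rewrite sqnorm_sum_basis //; exact: NP.
move=> m n Nm Nn; have [mn|/ltnW nm] := leqP m n; last exact: main.
by rewrite sqnormBC; [exact: main|exact: partial_sum_in|exact: partial_sum_in].
Qed.

Lemma ip_series_limit (a : nat -> R[i]) f k : H f ->
  converges_to (fun n => \sum_(0 <= i < n) a i *: e i) f ->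
  ip f (e k) = a k * ip (e k) (e k).
Proof.
move=> hf af; apply: (ip_limit _ hf (eH k) af); first by move=> n; exact: partial_sum_in.
by exists k.+1 => n kn; rewrite ip_sum_basis // kn.
Qed.

(** By Bessel and completeness the series converges to some g with the same coefficients as f, so f
    - g is orthogonal to every e n and vanishes by totality. *)
Lemma fourier_converges f : H f ->
  converges_to (fun n => \sum_(0 <= i < n) fourier f i *: e i) f.
Proof.
move=> hf; have [g hg sg] := orthogonal_series_converges (fun n => bessel n hf).
suff gf : g = f by rewrite gf in sg.
apply/eqP; rewrite -subr_eq0; apply/eqP/e_total => [|k]; first exact: subspaceB.
rewrite ipBl // (ip_series_limit k hg sg) /fourier divfK ?subrr //.
exact: ip_basis_neq0.
Qed.

Lemma sqnorm_lt_hnorm f (eps : R) : 0 < eps -> sqnorm ip f < eps ^+ 2 -> hnorm ip f < eps.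
Proof.
move=> e0 fe; rewrite /hnorm -[ltRHS](gtr0_norm e0) -sqrtr_sqr ltr_sqrt //.
exact: exprn_gt0.
Qed.

Theorem complete_orthogonal_of_total : complete_orthogonal H ip e.
Proof.
split => //; split => [_ [n [c ->]]|f hf eps eps0].
  by rewrite -(big_mkord xpredT (fun i => c i *: e i)); exact: partial_sum_in.
have [N NP] := fourier_converges hf (exprn_gt0 2 eps0).
exists (\sum_(0 <= i < N) fourier f i *: e i).
  by exists N, (fourier f); rewrite big_mkord.
apply: sqnorm_lt_hnorm => //; rewrite sqnormBC //; last exact: partial_sum_in.
exact: NP.
Qed.

Lemma csqrB_le z c : csqr (z - c) <= 2 * csqr z + 2 * csqr c.
Proof.
case: z => a b; case: c => x y; rewrite /csqr /=.
by have := sqr_ge0 (a + x); have := sqr_ge0 (b + y); nra.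
Qed.

(** The difference of the two limits is ip g (v n - y) - ip f (u n - x), which Cauchy-Schwarz makes
    small. The use is to pass an adjoint relation from partial sums to their limits. *)
Lemma ip_limit_eq (u v : nat -> E) f g x y : (forall n, H (u n)) -> (forall n, H (v n)) ->
  H f -> H g -> H x -> H y -> converges_to u x -> converges_to v y ->
  (forall n, ip f (u n) = ip g (v n)) -> ip f x = ip g y.
Proof.
move=> hu hv hf hg hx hy ux vy uv; apply/eqP; rewrite -subr_eq0.
apply/eqP/csqr_small => eps e0; have F0 := sqnorm_ge0 hf; have G0 := sqnorm_ge0 hg.
have [|N1 uN1] := ux (eps / (4 * (sqnorm ip f + 1))); first by rewrite divr_gt0 //; lra.
have [|N2 vN2] := vy (eps / (4 * (sqnorm ip g + 1))); first by rewrite divr_gt0 //; lra.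
pose n := maxn N1 N2.
have := uN1 n (leq_maxl _ _); have := vN2 n (leq_maxr _ _).
have -> : ip f x - ip g y = ip g (v n - y) - ip f (u n - x).
  rewrite (ipBr (hv n) hy hg) (ipBr (hu n) hx hf) uv.
  by move: (ip f x) (ip g y) (ip g (v n)) => p q r; ring.
rewrite !ltr_pdivlMr; [|lra|lra].
have hvB := subspaceB (hv n) hy; have huB := subspaceB (hu n) hx.
have := csqrB_le (ip g (v n - y)) (ip f (u n - x)).
have := ip_Cauchy_Schwarz hg hvB; have := ip_Cauchy_Schwarz hf huB.
have := sqnorm_ge0 hvB; have := sqnorm_ge0 huB.
move: (sqnorm ip (v n - y)) (sqnorm ip (u n - x)) => V U U0 V0 C1 C2 C3 V1 U1.
nra.
Qed.

(** * Spectrum of a self-adjoint operator with total eigenvectors *)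

Section Spectrum.
Variables (A : operator E) (l : nat -> R).
Hypothesis A_linear : linear_operator_in H A.
Hypothesis A_adjoint : adjoint_graph H ip A = graph A.
Hypothesis e_dom : forall n, dom A (e n).
Hypothesis e_eigen : forall n, op A (e n) = (l n)%:C *: e n.

(** Each eigenpair lies in the graph, which is the adjoint graph, and l n is real. *)
Lemma ip_eigen f n : dom A f -> ip (op A f) (e n) = (l n)%:C * ip f (e n).
Proof.
move=> df; have [dH _ _ _] := A_linear.
have : graph A (e n, (l n)%:C *: e n) by split; [exact: e_dom|exact: e_eigen].
rewrite -A_adjoint => -[_ _ /(_ f df) ->] /=; rewrite ipZr //; last exact: dH.
by congr (_ * _); exact: conjc_real.
Qed.

Lemma ip_shift_eigen f (lam : R[i]) n : dom A f ->
  ip (op A f - lam *: f) (e n) = ((l n)%:C - lam) * ip f (e n).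
Proof.
move=> df; have [dH _ _ oH] := A_linear; have hf := dH _ df.
rewrite ipBl //; [|exact: oH|exact: subspaceZ].
by rewrite ip_eigen // ipZl // mulrBl.
Qed.

Lemma eigenvalue_spectrum n : spectrum H ip A (l n)%:C.
Proof.
have [dH d0 lin _] := A_linear; move=> -[[_ inj _] _]; apply: (e_neq0 (n := n)).
have [_ o0] := lin (-1) _ _ (e_dom 0) (e_dom 0).
apply: inj; rewrite ?inE //=.
have E0 : op A 0 = 0.
  by have [_] := lin (-1) 0 0 d0 d0; rewrite scaler0 addr0 scaleN1r addNr.
by rewrite e_eigen subrr E0 scaler0 subrr.
Qed.

(** The coefficients of (A - lam) f are those of f times l n - lam, so Bessel bounds d times the
    squared norm of each partial sum of f. The factor 2 comes from [sqnormD_le] when f is replaced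
    by a partial sum. *)
Lemma sqnorm_le_shift (lam : R[i]) (d : R) f : 0 < d ->
  (forall n, d <= csqr ((l n)%:C - lam)) -> dom A f ->
  d * sqnorm ip f <= 2 * sqnorm ip (op A f - lam *: f).
Proof.
move=> d0 dl df; have [dH _ _ oH] := A_linear; have hf := dH _ df.
set g := op A f - _; have hg : H g by apply: subspaceB; [exact: oH|exact: subspaceZ].
have S_le n : d * sqnorm ip (\sum_(0 <= i < n) fourier f i *: e i) <= sqnorm ip g.
  apply: le_trans (bessel n hg); rewrite sqnorm_sum_basis // mulr_sumr; apply: ler_sum => i _.
  rewrite mulrA ler_wpM2r ?sqnorm_ge0 //.
  have -> : fourier g i = ((l i)%:C - lam) * fourier f i.
    by rewrite /fourier /g ip_shift_eigen // mulrA.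
  by rewrite csqrM ler_wpM2r ?csqr_ge0.
apply/ler_addgt0Pr => eps e0.
have [|N NP] := fourier_converges hf (e := eps / (2 * d)).
  by rewrite divr_gt0 // mulr_gt0.
have := NP N (leqnn _); set s := \sum_(0 <= i < N) _; have hs : H s by exact: partial_sum_in.
rewrite sqnormBC // => fs; have := S_le N; rewrite -/s => dS.
have := sqnormD_le (subspaceB hf hs) hs; rewrite subrK => fl.
have : d * sqnorm ip f <= d * (2 * sqnorm ip (f - s) + 2 * sqnorm ip s).
  by rewrite ler_wpM2l // ltW.
move: fs; rewrite ltr_pdivlMr ?mulr_gt0 //.
move: (sqnorm ip (f - s)) (sqnorm ip s) (sqnorm ip f) fl dS => p q r fl dS; lra.
Qed.

Lemma shift_neq0 (lam : R[i]) (d : R) : 0 < d ->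
  (forall n, d <= csqr ((l n)%:C - lam)) -> forall n, (l n)%:C - lam != 0.
Proof. by move=> d0 dl n; apply/eqP => E0; have := dl n; rewrite E0 csqr0; lra. Qed.

(** Dividing the coefficients of g by l n - lam gives a convergent series, but its sum r is not
    visibly in the domain. The pair (r, g + lam r) satisfies the adjoint relation, as a limit of
    pairs of partial sums that do, so it lies in the graph. *)
Lemma shift_surjective (lam : R[i]) (d : R) g : 0 < d ->
  (forall n, d <= csqr ((l n)%:C - lam)) -> H g ->
  exists2 f, dom A f & op A f - lam *: f = g.
Proof.
move=> d0 dl hg; have l0 := shift_neq0 d0 dl.
pose a n := fourier g n / ((l n)%:C - lam).
have aM n : \sum_(0 <= i < n) csqr (a i) * sqnorm ip (e i) <= sqnorm ip g / d.
  rewrite ler_pdivlMr // mulrC; apply: le_trans (bessel n hg).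
  rewrite mulr_sumr; apply: ler_sum => i _; rewrite mulrA ler_wpM2r ?sqnorm_ge0 //.
  rewrite /a csqrM csqrV // mulrC -mulrA -[leRHS]mulr1 ler_wpM2l ?csqr_ge0 //.
  by rewrite mulrC ler_pdivrMr ?mul1r //; exact: lt_le_trans d0 (dl i).
have [r hr ar] := orthogonal_series_converges aM.
have [dH _ _ oH] := A_linear; have hgr : H (g + lam *: r).
  by apply: subspaceD => //; exact: subspaceZ.
suff : graph A (r, g + lam *: r) by move=> [/= dr or]; exists r => //; rewrite or addrK.
rewrite -A_adjoint; split => //= f df; have hf := dH _ df.
have := ip_limit_eq (u := fun n => \sum_(0 <= i < n) a i *: e i)
  (v := fun n => \sum_(0 <= i < n) fourier g i *: e i + lam *: \sum_(0 <= i < n) a i *: e i).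
apply => //.
- by move=> n; exact: partial_sum_in.
- by move=> n; apply: subspaceD; [exact: partial_sum_in|apply/subspaceZ/partial_sum_in].
- exact: oH.
- move=> eps e0; pose K := csqr lam + 1.
  have K0 : 0 < K by rewrite /K; have := csqr_ge0 lam; lra.
  have [|N1 P1] := fourier_converges hg (e := eps / 4); first by rewrite divr_gt0.
  have [|N2 P2] := ar (eps / (4 * K)); first by rewrite divr_gt0 ?mulr_gt0.
  exists (maxn N1 N2) => n; rewrite geq_max => /andP[n1 n2].
  have := P1 n n1; have := P2 n n2.
  set S := \sum_(0 <= i < n) _; set G := \sum_(0 <= i < n) _ => h2 h1.
  have hS : H S by exact: partial_sum_in.
  have hG : H G by exact: partial_sum_in.
  have -> : G + lam *: S - (g + lam *: r) = (G - g) + lam *: (S - r).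
    by rewrite scalerBr opprD addrACA.
  have hSr := subspaceB hS hr; have hGg := subspaceB hG hg.
  have := sqnormD_le hGg (subspaceZ lam hSr); rewrite sqnormZ //.
  have := csqr_ge0 lam; have := sqnorm_ge0 hSr; move: h2; rewrite ltr_pdivlMr ?mulr_gt0 //.
  rewrite /K; move: (csqr lam) (sqnorm ip (S - r)) (sqnorm ip (G - g)) h1 (sqnorm _ _).
  move=> p q t *; nra.
- move=> n; elim: n => [|n IH].
    rewrite !big_geq // scaler0 addr0 !ip0r //; exact: oH.
  have hS := partial_sum_in a 0 n; have hG := partial_sum_in (fourier g) 0 n.
  have hGl : H (\sum_(0 <= i < n) fourier g i *: e i + lam *: \sum_(0 <= i < n) a i *: e i).
    by apply: subspaceD => //; exact: subspaceZ.
  rewrite !big_nat_recr //= scalerDr scalerA addrACA -scalerDl.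
  have hoA := oH _ df; have hZ c : H (c *: e n) by exact: subspaceZ.
  rewrite (ipDr hS (hZ _) hoA) (ipZr _ (eH n) hoA).
  rewrite (ipDr hGl (hZ _) hf) (ipZr _ (eH n) hf).
  rewrite IH ip_eigen //; congr (_ + _).
  have -> : fourier g n + lam * a n = (l n)%:C * a n.
    by apply: (mulIf (l0 n)); rewrite mulrDl /a -!mulrA !mulVf // !mulr1 mulrCA; ring.
  by rewrite mulrA; congr (_ * _); rewrite mulrC; symmetry; exact: conjcZ.
Qed.

Theorem spectrum_eigenvalues :
  (forall lam : R[i], (forall n, (l n)%:C <> lam) ->
     exists2 d : R, 0 < d & forall n, d <= csqr ((l n)%:C - lam)) ->
  spectrum H ip A = [set (l n)%:C | n in [set: nat]].
Proof.
move=> gap; have [dH d0 lin oH] := A_linear.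
apply/seteqP; split => [lam nlam|_ [n _ <-]]; last exact: eigenvalue_spectrum.
apply: contrapT => nl; apply: nlam.
have [|d dgt dl] := gap lam; first by move=> n En; apply: nl; exists n.
split.
  split.
  - by move=> f df /=; apply: subspaceB; [exact: oH|apply/subspaceZ/dH].
  - move=> f g; rewrite !inE => df dg fg; have hf := dH _ df; have hg := dH _ dg.
    apply/eqP; rewrite -subr_eq0; apply/eqP/e_total => [|n]; first exact: subspaceB.
    rewrite ipBl //; apply/eqP; rewrite subr_eq0; apply/eqP.
    by apply: (mulfI (shift_neq0 dgt dl n)); rewrite -!ip_shift_eigen // fg.
  - by move=> g hg; have [f df fg] := shift_surjective dgt dl hg; exists f.
exists (Num.sqrt (2 / d)) => f df; rewrite /hnorm -sqrtrM; last by rewrite divr_ge0 // ltW.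
rewrite ler_wsqrtr // mulrAC ler_pdivlMr // mulrC.
exact: sqnorm_le_shift dgt dl df.
Qed.

End Spectrum.
End Orthogonal.
End Theory.
End Hilbert.

(** * The complex operator *)

Section ComplexOperator.
Context {R : realType}.
Implicit Types (f g h : cfun R) (u v w : R -> R) (z : R[i]) (k : R).
Local Notation mu := (@lebesgue_measure R).
Local Notation I := (@Ioo R).
Local Notation W := (@W R).
Local Notation phi := (@phi R).

Definition re f : R -> R := fun x => complex.Re (f x).
Definition im f : R -> R := fun x => complex.Im (f x).
Definition cpair u v : cfun R := fun x => u x +i* v x.

Lemma cfun_eq f g : re f = re g -> im f = im g -> f = g.
Proof.
move=> ref imf; apply/funext => x; apply/eqP; rewrite eq_complex.
have := congr1 (fun u : R -> R => u x) ref; have := congr1 (fun u : R -> R => u x) imf.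
by rewrite /re /im => -> ->; rewrite !eqxx.
Qed.

(** The right-hand side is nested so as to consist of two instances of c u + v, the shape of the
    real linearity lemmas. *)
Lemma re_addZ z f g :
  re (z *: f + g) = (fun x => complex.Re z * re f x + (- complex.Im z * im f x + re g x)).
Proof.
apply/funext => x; rewrite /re /im fctE /GRing.scale /=.
by case: z (f x) (g x) => a b [c d] [p q] /=; ring.
Qed.

Lemma im_addZ z f g :
  im (z *: f + g) = (fun x => complex.Re z * im f x + (complex.Im z * re f x + im g x)).
Proof.
apply/funext => x; rewrite /re /im fctE /GRing.scale /=.
by case: z (f x) (g x) => a b [c d] [p q] /=; ring.
Qed.

Lemma re_sub f g : re (f - g) = (fun x => re f x - re g x).
Proof. by apply/funext => x; rewrite /re -raddfB. Qed.

Lemma im_sub f g : im (f - g) = (fun x => im f x - im g x).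
Proof. by apply/funext => x; rewrite /im -raddfB. Qed.

Lemma re_cderive f : re (cderive f) = derv (re f).
Proof. by rewrite dervE. Qed.

Lemma im_cderive f : im (cderive f) = derv (im f).
Proof. by rewrite dervE. Qed.

Lemma normcE z : complex.Re `|z| = Num.sqrt (complex.Re z ^+ 2 + complex.Im z ^+ 2).
Proof. by case: z. Qed.

Lemma normc_ge_Re z : `|complex.Re z| <= complex.Re `|z|.
Proof. by rewrite normcE -sqrtr_sqr ler_wsqrtr // lerDl sqr_ge0. Qed.

Lemma normc_ge_Im z : `|complex.Im z| <= complex.Re `|z|.
Proof. by rewrite normcE -sqrtr_sqr ler_wsqrtr // lerDr sqr_ge0. Qed.

Lemma normc_le z : complex.Re `|z| <= `|complex.Re z| + `|complex.Im z|.
Proof.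
rewrite normcE -[leRHS]ger0_norm ?addr_ge0 // -sqrtr_sqr ler_wsqrtr //.
rewrite -(real_normK (num_real (complex.Re z))) -(real_normK (num_real (complex.Im z))).
have := normr_ge0 (complex.Re z); have := normr_ge0 (complex.Im z); nra.
Qed.

Lemma abs_contP a b f : abs_cont a b f <-> abscont a b (re f) /\ abscont a b (im f).
Proof.
split=> [H|[Hr Hi]].
  split=> e e0; have [d d0 Hd] := H e e0; exists d => // n x y xy xyI sd;
    apply: le_lt_trans (Hd n x y xy xyI sd); apply: ler_sum => i _.
    by apply: le_trans (normc_ge_Re _); rewrite raddfB.
  by apply: le_trans (normc_ge_Im _); rewrite raddfB.
move=> e e0; have e2 : 0 < e / 2 by rewrite divr_gt0.
have [d1 d10 H1] := Hr _ e2; have [d2 d20 H2] := Hi _ e2.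
exists (Num.min d1 d2) => [|n x y xy xyI]; first by rewrite lt_min d10.
rewrite lt_min => /andP[s1 s2].
have := H1 n x y xy xyI s1; have := H2 n x y xy xyI s2 => h2 h1.
apply: (@le_lt_trans _ _ (\sum_i (`|re f (y i) - re f (x i)| + `|im f (y i) - im f (x i)|))).
  by apply: ler_sum => i _; apply: le_trans (normc_le _) _; rewrite !raddfB.
by rewrite big_split /=; lra.
Qed.

Lemma abs_cont_locP f : abs_cont_loc f <-> abscont_loc (re f) /\ abscont_loc (im f).
Proof.
split=> [H|[Hr Hi] a b a1 ab b1].
  by split=> a b a1 ab b1; have /abs_contP[] := H a b a1 ab b1.
by apply/abs_contP; split; [exact: Hr|exact: Hi].
Qed.

Lemma L2P f : L2 f <-> sqint (re f) /\ sqint (im f).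
Proof.
have nE x : complex.Re `|f x| ^+ 2 = re f x ^+ 2 + im f x ^+ 2.
  by rewrite normcE sqr_sqrtr // addr_ge0 ?sqr_ge0.
have iE : (\int[mu]_(x in I) (complex.Re `|f x| ^+ 2)%:E =
    \int[mu]_(x in I) (re f x ^+ 2 + im f x ^+ 2)%:E)%E.
  by apply: eq_integral => x _; rewrite nE.
have iP : measurable_fun I (re f) -> measurable_fun I (im f) ->
    mu.-integrable I (EFin \o (fun x => re f x ^+ 2 + im f x ^+ 2)) <->
    (\int[mu]_(x in I) (complex.Re `|f x| ^+ 2)%:E < +oo)%E.
  move=> mr mi; rewrite iE; apply: integrable_nonneg => [|x]; last by rewrite addr_ge0 ?sqr_ge0.
  by apply: measurable_funD; exact: measurable_funX.
split=> [[mr mi /(iP mr mi) i2]|[fr fi]].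
  split; apply: sqintP => //; apply: le_integrable_Ioo i2 _; try exact: measurable_funX.
    by move=> x _; rewrite ger0_norm ?sqr_ge0 // lerDl sqr_ge0.
  by move=> x _; rewrite ger0_norm ?sqr_ge0 // lerDr sqr_ge0.
have [mr mi] := (sqint_measurable fr, sqint_measurable fi).
split; [exact: mr|exact: mi|apply/(iP mr mi)].
by have := integrableD mIoo (sqint_sqr fr) (sqint_sqr fi).
Qed.

Lemma supportedP f : supported f <-> supp (re f) /\ supp (im f).
Proof.
split=> [H|[Hr Hi] x nx]; first by split=> x nx; rewrite /re /im H.
by apply/eqP; rewrite eq_complex; apply/andP; split; apply/eqP; [exact: Hr|exact: Hi].
Qed.

Lemma WP f : W f <-> wspace (re f) /\ wspace (im f).
Proof.
split=> [[/supportedP[sr si] /abs_contP[ar ai] /L2P[]]|[[sr ar lr] [si ai li]]].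
  by rewrite re_cderive im_cderive => lr li; split; split.
split; [exact/supportedP|exact/abs_contP|apply/L2P].
by rewrite re_cderive im_cderive.
Qed.

Lemma phiE f g : W f -> W g -> phi f g =
  (bform (re f) (re g) + bform (im f) (im g)) +i* (bform (im f) (re g) - bform (re f) (im g)).
Proof.
move=> /WP[[_ _ fr] [_ _ fi]] /WP[[_ _ gr] [_ _ gi]].
have i1 := sqint_integrableM fr gr; have i2 := sqint_integrableM fi gi.
have i3 := sqint_integrableM fi gr; have i4 := sqint_integrableM fr gi.
have cE : cintegral (fun x => cderive f x * (cderive g x)^*) =
   (dot (derv (re f)) (derv (re g)) + dot (derv (im f)) (derv (im g))) +i*
   (dot (derv (im f)) (derv (re g)) - dot (derv (re f)) (derv (im g))).
  rewrite /cintegral !dotE; congr (_ +i* _).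
    rewrite -RintegralD //; last exact: mIoo.
    by apply: eq_Rintegral => x _; rewrite !dervE /=; ring.
  rewrite -RintegralB //; last exact: mIoo.
  by apply: eq_Rintegral => x _; rewrite !dervE /=; ring.
rewrite /phi cE /bform.
have hE (z w : R[i]) : 2^-1 * z * w^* =
   (2^-1 * (complex.Re z * complex.Re w) + 2^-1 * (complex.Im z * complex.Im w)) +i*
   (2^-1 * (complex.Im z * complex.Re w) - 2^-1 * (complex.Re z * complex.Im w)).
  have -> : 2^-1 = (2^-1 : R)%:C by rewrite fmorphV /= rmorph_nat.
  case: z w => a b [c d]; apply/eqP; rewrite eq_complex /=.
  by apply/andP; split; apply/eqP; ring.
rewrite !hE /re /im; apply/eqP; rewrite eq_complex /=.
by apply/andP; split; apply/eqP; ring.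
Qed.

Lemma phi_inner_product : inner_product_on W phi.
Proof.
have closed z f g : W f -> W g -> W (z *: f + g).
  move=> /WP[fr fi] /WP[gr gi]; apply/WP; rewrite re_addZ im_addZ.
  by split; do !apply: wspace_lin.
split=> //.
- move=> z f g h Wf Wg Wh; have Wl := closed z f g Wf Wg.
  rewrite (phiE Wl Wh) (phiE Wf Wh) (phiE Wg Wh) re_addZ im_addZ.
  have [fr fi] := (WP f).1 Wf; have [gr gi] := (WP g).1 Wg; have [hr hi] := (WP h).1 Wh.
  have w1 a := wspace_lin a fi gr; have w2 a := wspace_lin a fr gi.
  rewrite !(bform_lin _ fr (w1 _)) // !(bform_lin _ fi (w2 _)) //.
  rewrite !(bform_lin _ fi gr) // !(bform_lin _ fr gi) //.
  move: (bform _ _) (bform _ _) (bform _ _) (bform _ _) (bform _ _) (bform _ _) (bform _ _) (bform _ _).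
  by case: z {Wl} => a b *; apply/eqP; rewrite eq_complex /=; apply/andP; split; apply/eqP; ring.
- move=> f g Wf Wg; rewrite (phiE Wf Wg) (phiE Wg Wf).
  rewrite (bformC (re g)) (bformC (im g)) (bformC (im g)) (bformC (re g)).
  move: (bform _ _) (bform _ _) (bform _ _) (bform _ _) => a b c d.
  by apply/eqP; rewrite eq_complex /=; apply/andP; split; apply/eqP; ring.
- move=> f Wf; rewrite (phiE Wf Wf) lecE /= [bform (re f) (im f)]bformC subrr eqxx /=.
  by rewrite addr_ge0 // bform_ge0.
- move=> f Wf; rewrite (phiE Wf Wf) => /eqP; rewrite eq_complex /= => /andP[/eqP E _].
  have [fr fi] := (WP f).1 Wf.
  have := bform_ge0 (re f); have := bform_ge0 (im f) => b1 b2.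
  by apply: cfun_eq; apply: bform_eq0 => //; move: (bform _ _) (bform _ _) E b1 b2 => *; lra.
Qed.

Lemma W0 : W 0.
Proof.
have w0 : wspace (cst 0 : R -> R) by rewrite -affine00; exact: affine_wspace.
by apply/WP; split.
Qed.

Lemma sqnorm_phi f : W f -> sqnorm phi f = bform (re f) (re f) + bform (im f) (im f).
Proof. by move=> Wf; rewrite /sqnorm phiE. Qed.

Lemma W_complete : complete_for W phi.
Proof.
move=> u Wu uC; have WB := subspaceB phi_inner_product.
have C n m : W (u m - u n) by exact: WB (Wu m) (Wu n).
have [||v wv vl] := wspace_complete (u := fun n => re (u n)).
- by move=> n; have [] := (WP _).1 (Wu n).
- move=> e e0; have [N NP] := uC e e0; exists N => m n Nm Nn; have := NP m n Nm Nn.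
  rewrite (sqnorm_phi (C n m)) re_sub; apply: le_lt_trans; rewrite lerDl; exact: bform_ge0.
have [||w ww wl] := wspace_complete (u := fun n => im (u n)).
- by move=> n; have [] := (WP _).1 (Wu n).
- move=> e e0; have [N NP] := uC e e0; exists N => m n Nm Nn; have := NP m n Nm Nn.
  rewrite (sqnorm_phi (C n m)) im_sub; apply: le_lt_trans; rewrite lerDr; exact: bform_ge0.
have Wvw : W (cpair v w) by exact/WP.
exists (cpair v w) => // e e0; have e2 : 0 < e / 2 by rewrite divr_gt0.
have [N1 P1] := vl _ e2; have [N2 P2] := wl _ e2.
exists (maxn N1 N2) => n; rewrite geq_max => /andP[n1 n2].
rewrite (sqnorm_phi (WB _ _ (Wu n) Wvw)).
rewrite re_sub im_sub; have := P1 n n1; have := P2 n n2; rewrite /re /im /=; lra.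
Qed.

Local Notation ejac n := (restr (jacobi R n)).

Lemma re_jacobi n : re (ejac n) = rpoly (jpoly n).
Proof.
by apply/funext => x; rewrite /re /restr /rpoly; case: ifP => // _; rewrite jpoly_jacobi.
Qed.

Lemma im_jacobi n : im (ejac n) = cst 0.
Proof.
by apply/funext => x; rewrite /im /restr; case: ifP => // _; rewrite jpoly_jacobi.
Qed.

(** * The domain of T through real and imaginary parts *)

Definition Dom f := ddom (re f) /\ ddom (im f).

Lemma ddom0 : ddom (cst 0 : R -> R).
Proof.
by rewrite -affine00; exact: ddom_affine.
Qed.

Lemma Dom_jacobi n : Dom (ejac n).
Proof. by rewrite /Dom re_jacobi im_jacobi; split; [exact: ddom_rpoly|exact: ddom0]. Qed.

Lemma abs_cont_loc_cderive f :
  abs_cont_loc (cderive f) <-> abscont_loc (derv (re f)) /\ abscont_loc (derv (im f)).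
Proof. by rewrite -re_cderive -im_cderive; exact: abs_cont_locP. Qed.

Lemma abs_cont_loc_cderive2 f : abs_cont_loc (cderive (cderive f)) <->
  abscont_loc (derv (derv (re f))) /\ abscont_loc (derv (derv (im f))).
Proof. by rewrite -re_cderive -im_cderive; exact: abs_cont_loc_cderive. Qed.

Lemma L2_cderive f : L2 (cderive f) <-> sqint (derv (re f)) /\ sqint (derv (im f)).
Proof. by rewrite -re_cderive -im_cderive; exact: L2P. Qed.

Lemma L2_scale (c : R -> R) g : L2 (fun x => (c x)%:C * g x) <->
  sqint (fun x => c x * re g x) /\ sqint (fun x => c x * im g x).
Proof.
have reZ : re (fun x => (c x)%:C * g x) = (fun x => c x * re g x).
  by apply/funext => x; rewrite /re; case: (g x) => a b /=; ring.
have imZ : im (fun x => (c x)%:C * g x) = (fun x => c x * im g x).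
  by apply/funext => x; rewrite /im; case: (g x) => a b /=; ring.
by rewrite -reZ -imZ; exact: L2P.
Qed.

Lemma L2_scale_cderive2 (c : R -> R) f : L2 (fun x => (c x)%:C * cderive (cderive f) x) <->
  sqint (fun x => c x * derv (derv (re f)) x) /\ sqint (fun x => c x * derv (derv (im f)) x).
Proof. by rewrite -!re_cderive -!im_cderive; exact: L2_scale. Qed.

Lemma L2_scale_cderive3 (c : R -> R) f :
  L2 (fun x => (c x)%:C * cderive (cderive (cderive f)) x) <->
  sqint (fun x => c x * derv (derv (derv (re f))) x) /\
  sqint (fun x => c x * derv (derv (derv (im f))) x).
Proof. by rewrite -re_cderive -im_cderive; exact: L2_scale_cderive2. Qed.

Lemma DomP f : Dom f <-> 
  [/\ supported f, abs_cont (-1) 1 f, abs_cont_loc (cderive f)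
          & abs_cont_loc (cderive (cderive f))] /\
        [/\ L2 (fun x => (1 - x ^+ 2)%:C * cderive (cderive (cderive f)) x),
            L2 (fun x => (Num.sqrt (1 - x ^+ 2))%:C * cderive (cderive f) x)
          & L2 (cderive f)].
Proof.
split=> [[[[sr ar r1 r2] [s3r s2r s1r]] [[si ai i1 i2] [s3i s2i s1i]]]|].
  split; split.
  - exact/supportedP.
  - exact/abs_contP.
  - exact/abs_cont_loc_cderive.
  - exact/abs_cont_loc_cderive2.
  - by apply/(L2_scale_cderive3 (fun x => 1 - x ^+ 2)).
  - by apply/(L2_scale_cderive2 (fun x => Num.sqrt (1 - x ^+ 2))).
  - exact/L2_cderive.
move=> [[/supportedP[sr si] /abs_contP[ar ai] /abs_cont_loc_cderive[r1 i1]]].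
move=> /abs_cont_loc_cderive2[r2 i2].
move=> [/(L2_scale_cderive3 (fun x => 1 - x ^+ 2))[s3r s3i]].
move=> /(L2_scale_cderive2 (fun x => Num.sqrt (1 - x ^+ 2)))[s2r s2i] /L2_cderive[s1r s1i].
by split; split; split.
Qed.

Lemma re_cont_ext f : re (cont_ext f) = cext (re f).
Proof.
apply/funext => x; rewrite /re /cont_ext /cext.
by do 3! (case: ifP => // _).
Qed.

Lemma im_cont_ext f : im (cont_ext f) = cext (im f).
Proof.
apply/funext => x; rewrite /im /cont_ext /cext.
by do 3! (case: ifP => // _).
Qed.

Lemma re_op k f : re (op (T k) f) = opR k (re f).
Proof.
rewrite /op /T re_cont_ext /opR; congr cext; apply/funext => x.
rewrite -!re_cderive /re /ell; case: (cderive (cderive f) x) (f x) => a b [c d] /=; ring.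
Qed.

Lemma im_op k f : im (op (T k) f) = opR k (im f).
Proof.
rewrite /op /T im_cont_ext /opR; congr cext; apply/funext => x.
rewrite -!im_cderive /im /ell; case: (cderive (cderive f) x) (f x) => a b [c d] /=; ring.
Qed.

Lemma V3_ddom_cext f : V3 f -> Dom (cont_ext f).
Proof.
move=> [[/abs_cont_locP[r0 i0] /abs_cont_loc_cderive[r1 i1] /abs_cont_loc_cderive2[r2 i2]]].
move=> [/(L2_scale_cderive3 (fun x => 1 - x ^+ 2))[s3r s3i]].
move=> /(L2_scale_cderive2 (fun x => Num.sqrt (1 - x ^+ 2)))[s2r s2i] /L2_cderive[s1r s1i] _.
by split; rewrite ?re_cont_ext ?im_cont_ext; exact: ddom_cext.
Qed.

Lemma W2_Dom f : W2 f -> Dom f.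
Proof.
move=> [/WP[wr wi] [z zE]]; split.
  apply: (@ddom_of_const_derive1 _ _ (complex.Re z)) => // x /IooP[x1 x2].
  by rewrite -re_cderive /re zE // x1.
apply: (@ddom_of_const_derive1 _ _ (complex.Im z)) => // x /IooP[x1 x2].
by rewrite -im_cderive /im zE // x1.
Qed.

Lemma Dom_addZ z f g : Dom f -> Dom g -> Dom (z *: f + g).
Proof.
move=> [fr fi] [gr gi]; split; rewrite ?re_addZ ?im_addZ; apply: ddom_lin => //;
  exact: ddom_lin.
Qed.

Lemma Dom_W f : Dom f -> W f.
Proof. by move=> [fr fi]; apply/WP; split; exact: ddom_wspace. Qed.

(** For the harder inclusion, f2 interpolates f affinely at the end points and f1 = f - f2 vanishes
    there, which gives the weighted condition of [V3]. As f1 is already continuous on [-1, 1] and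
    supported there, [cont_ext] fixes it. *)
Lemma dom_T k : dom (T k) = [set f | Dom f].
Proof.
apply/seteqP; split => [f [f1 [f2 [V1 W2' ->]]]|f df].
  by rewrite -[cont_ext f1]scale1r; apply: Dom_addZ; [exact: V3_ddom_cext|exact: W2_Dom].
have [dr di] := df; pose f2 := cpair (interpolant (re f)) (interpolant (im f)).
have W2f : W2 f2.
  split; first by apply/WP; split; exact: affine_wspace.
  exists (((re f 1 - re f (-1)) / 2) +i* ((im f 1 - im f (-1)) / 2)) => x xI.
  have Ix : I x by rewrite /Ioo /= in_itv.
  by apply/eqP; rewrite eq_complex; apply/andP; split; apply/eqP;
    rewrite /= -dervE affine_derive1.
pose f1 := (-1) *: f2 + f; have d1 : Dom f1 by apply: Dom_addZ => //; exact: W2_Dom.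
have [d1r d1i] := d1; have [w1r w1i] := (ddom_wspace d1r, ddom_wspace d1i).
have van u : (fun x => -1 * interpolant u x + u x) (-1) = 0 /\
    (fun x => -1 * interpolant u x + u x) 1 = 0.
  by rewrite /= interpolantN1 interpolant1 !mulN1r !addNr.
have r1E : re f1 = (fun x => -1 * interpolant (re f) x + re f x).
  by rewrite /f1 re_addZ; apply/funext => x /=; rewrite !oppr0 mul0r add0r.
have i1E : im f1 = (fun x => -1 * interpolant (im f) x + im f x).
  by rewrite /f1 im_addZ; apply/funext => x /=; rewrite oppr0 mul0r add0r.
exists f1, f2; split => //; last first.
  have -> : cont_ext f1 = f1.
    apply: cfun_eq; rewrite ?re_cont_ext ?im_cont_ext.
      by case: w1r => s a _; exact: cext_supported.
    by case: w1i => s a _; exact: cext_supported.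
  by rewrite /f1 scaleN1r addrAC addNr add0r.
have /DomP[[_ a1 a2 a3] [l3 l2 l1]] := d1.
have /abs_contP[ar ai] := a1.
split; split => //.
  by apply/abs_cont_locP; split; exact: abscont_locW.
apply/(L2_scale (fun x => (Num.sqrt (1 - x ^+ 2))^-1)); split.
  by apply: wspace_sqint_weighted => //; rewrite r1E; have [] := van (re f).
by apply: wspace_sqint_weighted => //; rewrite i1E; have [] := van (im f).
Qed.

Lemma T_linear k : linear_operator_in W (T k).
Proof.
split; rewrite ?dom_T.
- by move=> f; exact: Dom_W.
- by split; exact: ddom0.
- move=> z f g df dg; split; first exact: Dom_addZ.
  have [[fr fi] [gr gi]] := (df, dg).
  apply: cfun_eq; rewrite ?re_op ?im_op ?re_addZ ?im_addZ.
    by rewrite (opR_lin k _ fr (ddom_lin _ fi gr)) (opR_lin k _ fi gr) !re_op !im_op.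
  by rewrite (opR_lin k _ fi (ddom_lin _ fr gi)) (opR_lin k _ fr gi) !re_op !im_op.
- by move=> f [fr fi]; apply/WP; rewrite re_op im_op; split; exact: opR_wspace.
Qed.

(** * Self-adjointness, eigenfunctions and spectrum of T *)

Lemma opR0 k : opR k (cst 0 : R -> R) = cst 0.
Proof.
by rewrite -affine00 opR_affine affine00; apply/funext => x; rewrite mulr0.
Qed.

Lemma T_adjoint k : adjoint_graph W phi (T k) = graph (T k).
Proof.
have [TW _ _ opW] := T_linear k.
apply/seteqP; split => [[f g] [Wf Wg adj]|[f g] [df fg]].
  have {}Wf : W f := Wf; have {}Wg : W g := Wg.
  have {}adj h : dom (T k) h -> phi (op (T k) h) f = phi h g := adj h.
  have [fr fi] := (WP f).1 Wf; have [gr gi] := (WP g).1 Wg.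
  have adjR u : ddom u -> bform (opR k u) (re f) = bform u (re g) /\
      bform (opR k u) (im f) = bform u (im g).
    (* A real test function separates the complex adjoint relation into one for [re f] and one for
       [im f]. *)
    move=> du; pose h := cpair u (cst 0).
    have dh : dom (T k) h by rewrite dom_T; split; [exact: du|exact: ddom0].
    have := adj h dh; rewrite (phiE (opW h dh) Wf) (phiE (TW h dh) Wg).
    rewrite re_op im_op (_ : re h = u) // (_ : im h = cst 0) // opR0.
    rewrite !(bformC (cst 0)) !bform0 // !addr0 !sub0r => -[-> /oppr_inj ->].
    by split.
  have [dr Er] := opR_adjoint fr gr (fun u du => (adjR u du).1).
  have [di Ei] := opR_adjoint fi gi (fun u du => (adjR u du).2).
  split; first by rewrite dom_T.
  by apply: cfun_eq; rewrite ?re_op ?im_op.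
have {}df : dom (T k) f := df; have {}fg : op (T k) f = g := fg.
have Wf := TW _ df; have Wg : W g by rewrite -fg; exact: opW.
split; [exact: Wf|exact: Wg|] => h dh; have Wh := TW _ dh.
have : phi (op (T k) h) f = phi h g; last by [].
rewrite (phiE (opW h dh) Wf) (phiE Wh Wg) -fg !re_op !im_op.
move: df dh; rewrite dom_T => -[fr fi] [hr hi].
by rewrite (opR_sym k hr fr) (opR_sym k hi fi) (opR_sym k hi fr) (opR_sym k hr fi).
Qed.

Lemma W_jacobi n : W (ejac n).
Proof. exact: Dom_W (Dom_jacobi n). Qed.

Lemma phi_jacobi f n : W f -> phi f (ejac n) =
  bform (re f) (rpoly (jpoly n)) +i* bform (im f) (rpoly (jpoly n)).
Proof.
move=> Wf; have [fr fi] := (WP f).1 Wf.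
by rewrite (phiE Wf (W_jacobi n)) re_jacobi im_jacobi !bform0 // addr0 subr0.
Qed.

Lemma jacobi_orthogonal m n : m <> n -> phi (ejac m) (ejac n) = 0.
Proof.
move=> mn; rewrite (phi_jacobi _ (W_jacobi m)) re_jacobi im_jacobi.
rewrite (bform_jpoly_orthogonal mn) bformC bform0 //; exact: rpoly_wspace.
Qed.

Lemma jacobi_neq0 n : ejac n <> 0.
Proof.
move=> j0; have := @jpoly_neq0 R n; suff -> : jpoly n = 0 :> {poly R} by rewrite eqxx.
have rj : rpoly (jpoly n) = cst 0 :> (R -> R) by rewrite -re_jacobi j0.
set p := jpoly n in rj *.
(* The points 1/(i + 1) are distinct, lie in ]0, 1] and are as many as the size of p, which is more
   roots than a nonzero p can have. *)
apply: (@roots_geq_poly_eq0 _ p [seq i.+1%:R^-1 | i <- iota 0 (size p)]).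
- apply/allP => _ /mapP[i _ ->]; rewrite /root -rpolyE ?rj //.
  have v0 : 0 <= i.+1%:R^-1 :> R by rewrite invr_ge0.
  by apply/andP; split; [exact: le_trans (lerN10 _) v0|rewrite invf_le1 ?ler1n ?ltr0n].
- rewrite map_inj_uniq ?iota_uniq // => i j /invr_inj /eqP.
  by rewrite eqr_nat => /eqP [].
- by rewrite size_map size_iota.
Qed.

Lemma jacobi_total f : W f -> (forall n, phi f (ejac n) = 0) -> f = 0.
Proof.
move=> Wf H; have [fr fi] := (WP f).1 Wf.
have {}H n : bform (re f) (rpoly (jpoly n)) = 0 /\ bform (im f) (rpoly (jpoly n)) = 0.
  by have := H n; rewrite (phi_jacobi _ Wf) => -[-> ->].
apply: cfun_eq.
  by apply: jpoly_total => // n; have [] := H n.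
by apply: jpoly_total => // n; have [] := H n.
Qed.

Lemma T_jacobi k n : op (T k) (ejac n) = (jeigen n + k)%:C *: ejac n.
Proof.
rewrite -[RHS]addr0; apply: cfun_eq; rewrite ?re_op ?im_op ?re_addZ ?im_addZ ?re_jacobi ?im_jacobi.
  by rewrite opR_jpoly; apply/funext => x /=; rewrite oppr0 mul0r add0r addr0.
by rewrite opR0; apply/funext => x /=; rewrite mulr0 mul0r !add0r.
Qed.

(* The eigenvalues tend to infinity. *)
Lemma eigenvalue_gap k z : (forall n, (jeigen n + k)%:C <> z) ->
  exists2 d : R, 0 < d & forall n, d <= csqr ((jeigen n + k)%:C - z).
Proof.
move=> nz; have pos n : 0 < csqr ((jeigen n + k)%:C - z).
  rewrite lt_neqAle csqr_ge0 andbT eq_sym; apply/eqP => /csqr_eq0 /eqP.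
  by rewrite subr_eq0 => /eqP; exact: nz.
pose N := (Num.truncn `|complex.Re z + 2 - k|).+1.
have far n : (N <= n)%N -> 1 <= csqr ((jeigen n + k)%:C - z).
  move=> Nn; have n1 : 1 <= n%:R :> R by rewrite ler1n; exact: leq_trans Nn.
  have nz' : complex.Re z + 2 - k <= n%:R.
    apply: le_trans (ler_norm _) _; apply: le_trans (ltW (truncnS_gt _)) _.
    by rewrite ler_nat.
  have : n%:R - 1 <= jeigen n :> R.
    by rewrite /jeigen; move: (n%:R : R) n1 => t t1; nra.
  case: z nz' {nz pos N Nn} => a b /= nz' ln; rewrite /csqr /=.
  have := sqr_ge0 b; move: (jeigen n) (n%:R) ln nz' n1 => l t ln nz' n1; nra.
have [d d0 near_] : exists2 d : R, 0 < d & forall n, (n < N)%N ->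
    d <= csqr ((jeigen n + k)%:C - z).
  elim: N {far} => [|N [d d0 IH]]; first by exists 1.
  exists (Num.min d (csqr ((jeigen N + k)%:C - z))); first by rewrite lt_min d0 pos.
  move=> n; rewrite ltnS leq_eqVlt => /predU1P[->|nN]; rewrite ge_min ?lexx ?orbT //.
  by rewrite IH.
exists (Num.min d 1) => [|n]; first by rewrite lt_min d0 ltr01.
rewrite ge_min; have [Nn|nN] := leqP N n; first by rewrite far // orbT.
by rewrite near_.
Qed.

Lemma jacobi_complete : complete_orthogonal W phi (fun n => ejac n).
Proof.
exact: (@complete_orthogonal_of_total _ _ _ _ phi_inner_product W0 (fun n => ejac n)
  W_jacobi jacobi_orthogonal jacobi_neq0 W_complete jacobi_total).
Qed.

(** The domain is a subspace containing the Jacobi polynomials, whose span is dense by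
    [jacobi_complete]. *)
Lemma T_dense k : dense_in W phi (dom (T k)).
Proof.
have [TW T0 Tlin _] := T_linear k; split => // f Wf e e0.
have [_ _ [_ dense]] := jacobi_complete; have [g [n [c ->]] fg] := dense f Wf e e0.
exists (\sum_(i < n) c i *: ejac i) => //.
apply: (big_ind (dom (T k))) => // [x y dx dy|i _].
  by have [] := Tlin 1 x y dx dy; rewrite scale1r.
have dj : dom (T k) (ejac i) by rewrite dom_T; exact: Dom_jacobi.
by have [] := Tlin (c i) _ _ dj T0; rewrite addr0.
Qed.

Lemma T_spectrum k : spectrum W phi (T k) = [set (jeigen n + k)%:C | n in [set: nat]].
Proof.
apply: (spectrum_eigenvalues phi_inner_product W0 W_jacobi jacobi_orthogonal jacobi_neq0
  W_complete jacobi_total (T_linear k) (T_adjoint k)).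
- by move=> n; rewrite dom_T; exact: Dom_jacobi.
- by move=> n; exact: T_jacobi.
- exact: eigenvalue_gap.
Qed.

End ComplexOperator.

Theorem theorem7p9 (R : realType) (k : R) (k_gt0 : 0 < k) :
  [/\ self_adjoint (@W R) (@phi R) (T k),
      dom (T k) = [set f : cfun R |
        [/\ supported f, abs_cont (-1) 1 f, abs_cont_loc (cderive f)
          & abs_cont_loc (cderive (cderive f))] /\
        [/\ L2 (fun x => (1 - x ^+ 2)%:C * cderive (cderive (cderive f)) x),
            L2 (fun x => (Num.sqrt (1 - x ^+ 2))%:C * cderive (cderive f) x)
          & L2 (cderive f)]],
      spectrum (@W R) (@phi R) (T k) =
        [set (n%:R * (n%:R - 1) + k)%:C | n in [set: nat]],
      forall n : nat, eigenfunction (T k) (restr (jacobi R n))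
    & complete_orthogonal (@W R) (@phi R) (fun n => restr (jacobi R n))].
Proof.
split.
- split; [exact: T_linear|exact: T_dense|exact: T_adjoint].
- by rewrite dom_T; apply/seteqP; split => f /DomP.
- exact: T_spectrum.
- move=> n; split; [by rewrite dom_T; exact: Dom_jacobi|exact: jacobi_neq0|].
  by exists (jeigen n + k)%:C; exact: T_jacobi.
- exact: jacobi_complete.
Qed.
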